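(* Let $\phi:M^m\rightarrow N^{m+1}(c)$ be a hypersurface in a space form, with shape operator $A$, mean curvature function $f$, scalar curvature $s$, and biharmonic stress-energy tensor $S_2$. Then \begin{align*} \frac{1}{2}\Delta |S_2|^2=&\ 4cm^4f^4-4m^3f^3(\operatorname{trace} A^3)-4m^2f^2|A|^2(cm-|A|^2)\\ &-8m^4f^2|\operatorname{grad} f|^2-4m^2f^2|\nabla A|^2+4m^2f\langle\operatorname{grad} s,\operatorname{grad} f\rangle\\ &-8m^2\operatorname{div}(f\operatorname{Ricci}(\operatorname{grad} f))-2m^2\operatorname{div}\left(|A|^2\operatorname{grad} f^2\right)\\ & +\frac{m^5}{8}\Delta f^4-4cm^2(m-1)\Delta f^2-10m^2f\langle\tau_2^{\top}(\phi),\operatorname{grad} f\rangle\\ &-4m^2f^2\operatorname{div}\left(\tau_2^{\top}(\phi)\right)-2\left|\tau_2^{\top}(\phi)\right|^2+4mf\langle\nabla\tau_2^{\top}(\phi),A\rangle. \end{align*}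
   Context: Manifolds are smooth, connected and without boundary. $N^{m+1}(c)$ is a space form, i.e. an $(m+1)$-dimensional Riemannian manifold of constant sectional curvature $c$. A hypersurface $\phi:M^m\to N^{m+1}(c)$ is an isometric immersion of an $m$-dimensional Riemannian manifold $M$. $\eta$ is a (local) unit normal vector field, $A$ the shape operator in direction $\eta$, viewed as a symmetric $(1,1)$-tensor on $M$ ($\langle AX,Y\rangle$ is the $\eta$-component of the second fundamental form $B(X,Y)$), $f=\frac1m\operatorname{trace}A$ is the mean curvature function and $H=f\eta$ the mean curvature vector field; all expressions are invariant under $\eta\mapsto-\eta$. The tension field is $\tau(\phi)=\operatorname{trace}\nabla d\phi=mH$. The bitension field is $\tau_2(\phi)=-\Delta\tau(\phi)-\operatorname{trace}R^N(d\phi,\tau(\phi))d\phi$, where $R^N(X,Y)Z=[\nabla^N_X,\nabla^N_Y]Z-\nabla^N_{[X,Y]}Z$ and, on sections of $\phi^{-1}(TN)$, $\Delta=-\operatorname{trace}(\nabla^\phi\nabla^\phi-\nabla^\phi_\nabla)$. $\tau_2^\top(\phi)$ is its tangent part; for a hypersurface in a space form, $\tau_2^{\top}(\phi)=-2mA(\operatorname{grad}f)-\frac{m^2}{2}\operatorname{grad}f^2$. The biharmonic stress-energy tensor is $S_2(X,Y)=\frac12|\tau(\phi)|^2\langle X,Y\rangle+\langle d\phi,\nabla\tau(\phi)\rangle\langle X,Y\rangle-\langle d\phi(X),\nabla_Y\tau(\phi)\rangle-\langle d\phi(Y),\nabla_X\tau(\phi)\rangle$; for a hypersurface, as a $(1,1)$-tensor,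 $S_2=-\frac{m^2f^2}{2}I+2mfA$. On functions $\Delta u=-\operatorname{div}\operatorname{grad}u$. $\operatorname{Ricci}$ is the Ricci operator ($(1,1)$-tensor) and $s$ the scalar curvature of $M$. With $\{X_i\}$ a local orthonormal frame, $|A|^2=\operatorname{trace}A^2$, $|\nabla A|^2=\sum_{i,j}|(\nabla_{X_i}A)X_j|^2$, and $\langle\nabla V,A\rangle=\sum_i\langle\nabla_{X_i}V,AX_i\rangle$ for a vector field $V$. *)

(* Defs.v *)
From HB Require Import structures.
From mathcomp Require Import all_boot all_order all_algebra.
From mathcomp Require Import all_classical all_reals all_analysis.

Set Implicit Arguments.
Unset Strict Implicit.
Unset Printing Implicit Defensive.

Import Order.TTheory GRing.Theory Num.Theory.
Import numFieldNormedType.Exports.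

Local Open Scope classical_set_scope.
Local Open Scope ring_scope.

(* Conventions: tangent vectors are row vectors of components in a chart, so   *)
(* the matrix of a (1,1)-tensor T acts on the right: T(u) is u *m T.  A vector *)
(* field, a tensor field or a section of the pullback bundle is given on a     *)
(* chart domain as a function of the point of the manifold (not of its         *)
(* coordinates), with values in the components in that chart.                  *)

Section Smooth.
Variables (R : realType) (n : nat).
Implicit Types (f : 'rV[R]_n -> R) (U : set 'rV[R]_n).

Definition partial (i : 'I_n) f : 'rV[R]_n -> R :=
  fun v => 'D_(delta_mx 0 i) f v.

Definition iter_partial (s : seq 'I_n) f : 'rV[R]_n -> R := foldr partial f s.

Definition smooth_on U f : Prop :=
  forall (s : seq 'I_n) (v : 'rV[R]_n), U v ->
    {for v, continuous (iter_partial s f)} /\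
    forall i : 'I_n, derivable (iter_partial s f) v (delta_mx 0 i).

End Smooth.

Section Manifold.
Variables (R : realType) (n : nat).

(* [chart_inv] is only meaningful on [coord @` chart_dom]. *)
Record chart (M : topologicalType) := Chart {
  chart_dom : set M;
  coord : M -> 'rV[R]_n;
  chart_inv : 'rV[R]_n -> M;
  chart_dom_open : open chart_dom;
  chart_img_open : open (coord @` chart_dom);
  chart_invK : forall p, chart_dom p -> chart_inv (coord p) = p;
  coord_continuous : {within chart_dom, continuous coord};
  chart_inv_continuous : {within coord @` chart_dom, continuous chart_inv} }.

Definition smooth_in (M : topologicalType) (x : chart M) (W : set M)
    (u : M -> R) : Prop :=
  smooth_on (coord x @` (W `&` chart_dom x)) (u \o chart_inv x).

Record manifold := Manifold {
  manifold_sort :> topologicalType;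
  atlas : set (chart manifold_sort);
  atlas_cover : forall p, exists2 x, atlas x & chart_dom x p;
  atlas_smooth : forall x y, atlas x -> atlas y ->
    forall a, smooth_in x (chart_dom y) (fun p => coord y p 0 a);
  manifold_hausdorff : hausdorff_space manifold_sort;
  manifold_second_countable : @second_countable manifold_sort;
  manifold_connected : connected [set: manifold_sort] }.

(* The derivative of u along the i-th coordinate field of the chart x. *)
Definition pd (M : topologicalType) (x : chart M) (i : 'I_n) (u : M -> R) :
    M -> R :=
  fun p => partial i (u \o chart_inv x) (coord x p).

Definition pdv (M : topologicalType) (x : chart M) (i : 'I_n) (k : nat)
    (V : M -> 'rV[R]_k) : M -> 'rV[R]_k :=
  fun p => \row_a pd x i (fun q => V q 0 a) p.

(* [gram x p] is the Gram matrix at p of the coordinate fields of x. *)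
Record riemannian := Riemannian {
  riemannian_manifold :> manifold;
  gram : chart riemannian_manifold -> riemannian_manifold -> 'M[R]_n;
  gram_smooth : forall x, atlas x ->
    forall i j, smooth_in x setT (fun p => gram x p i j);
  gram_sym : forall x p, atlas x -> chart_dom x p -> (gram x p)^T = gram x p;
  gram_posdef : forall x p, atlas x -> chart_dom x p ->
    forall u : 'rV[R]_n, u != 0 -> 0 < (u *m gram x p *m u^T) 0 0;
  gram_change : forall x y p, atlas x -> atlas y ->
    chart_dom x p -> chart_dom y p ->
    let J := \matrix_(i, a) pd x i (fun q => coord y q 0 a) p in
    gram x p = J *m gram y p *m J^T }.

End Manifold.

Section LeviCivita.
Variables (R : realType) (n : nat) (M : riemannian R n) (x : chart R n M).
Implicit Types (p : M) (u v w : 'rV[R]_n) (X Y Z V : M -> 'rV[R]_n).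
Implicit Types (h : M -> R) (b : 'M[R]_n).

Definition inner p u v : R := (u *m gram x p *m v^T) 0 0.

Definition coord_field (i : 'I_n) : M -> 'rV[R]_n := fun=> delta_mx 0 i.

(* Metric traces of bilinear maps given by their values on the coordinate      *)
(* fields; [form_traceE] and [vec_traceE] give the orthonormal-frame form.     *)
Definition form_trace p b : R := \tr (invmx (gram x p) *m b).

Definition vec_trace p (k : nat) (b : 'I_n -> 'I_n -> 'rV[R]_k) : 'rV[R]_k :=
  \sum_i \sum_j invmx (gram x p) i j *: b i j.

Definition form_normsq p b : R :=
  form_trace p (\matrix_(i, k) form_trace p (\matrix_(j, l) (b i j * b k l))).

Definition christoffel p (i j : 'I_n) : 'rV[R]_n :=
  2^-1 *: ((\row_l (pd x i (fun q => gram x q j l) p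
                    + pd x j (fun q => gram x q i l) p
                    - pd x l (fun q => gram x q i j) p))
           *m invmx (gram x p)).

Definition nabla X V : M -> 'rV[R]_n := fun p =>
  \sum_i X p 0 i *: (pdv x i V p + \sum_j V p 0 j *: christoffel p i j).

Definition lie_bracket X Y : M -> 'rV[R]_n := fun p =>
  \sum_i (X p 0 i *: pdv x i Y p - Y p 0 i *: pdv x i X p).

Definition curvature_field X Y Z : M -> 'rV[R]_n := fun p =>
  nabla X (nabla Y Z) p - nabla Y (nabla X Z) p - nabla (lie_bracket X Y) Z p.

(* Vectors at p are extended to fields with constant components. *)
Definition curvature p u v w : 'rV[R]_n :=
  curvature_field (fun=> u) (fun=> v) (fun=> w) p.

Definition sectional p u v : R :=
  inner p (curvature p u v v) u
  / (inner p u u * inner p v v - inner p u v ^+ 2).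

Definition ricci p u : 'rV[R]_n :=
  vec_trace p (fun i j => curvature p u (delta_mx 0 i) (delta_mx 0 j)).

Definition scalar_curvature p : R := \sum_i ricci p (delta_mx 0 i) 0 i.

Definition grad h : M -> 'rV[R]_n := fun p =>
  (\row_i pd x i h p) *m invmx (gram x p).

Definition divergence V : M -> R := fun p =>
  \sum_i nabla (coord_field i) V p 0 i.

(* The geometer's sign: Delta = - div grad. *)
Definition laplacian h : M -> R := fun p => - divergence (grad h) p.

Definition nabla_op (T : M -> 'M[R]_n) X Y : M -> 'rV[R]_n := fun p =>
  nabla X (fun q => Y q *m T q) p - nabla X Y p *m T p.

Definition nabla_op_normsq (T : M -> 'M[R]_n) p : R :=
  let D i j := nabla_op T (coord_field i) (coord_field j) p in
  form_trace p (\matrix_(i, k)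
    form_trace p (\matrix_(j, l) inner p (D i j) (D k l))).

(* <nabla V, T> *)
Definition nabla_contract V (T : M -> 'M[R]_n) p : R :=
  form_trace p (\matrix_(i, j)
    inner p (nabla (coord_field i) V p) (delta_mx 0 j *m T p)).

Let frameK p (E : 'M[R]_n) : E *m gram x p *m E^T = 1%:M ->
  invmx (gram x p) = E^T *m E.
Proof.
move=> hE; have uE : E \in unitmx.
  by have /mulmx1_unit[] : E *m (gram x p *m E^T) = 1%:M by rewrite mulmxA.
have hG : gram x p *m (E^T *m E) = 1%:M.
  apply: (can_inj (mulKmx uE)); rewrite mulmx1 !mulmxA.
  by rewrite hE mul1mx.
have [uG _] := mulmx1_unit hG.
by apply: (can_inj (mulKmx uG)); rewrite mulmxV.
Qed.

Lemma form_traceE p b (E : 'M[R]_n) : E *m gram x p *m E^T = 1%:M ->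
  form_trace p b = \sum_k (row k E *m b *m (row k E)^T) 0 0.
Proof.
move=> /frameK hE; rewrite /form_trace hE -mulmxA mxtrace_mulC.
apply: eq_bigr => k _.
by rewrite -!row_mul tr_row !mxE; apply: eq_bigr => j _; rewrite !mxE.
Qed.

Lemma vec_traceE p (k : nat) (b : 'I_n -> 'I_n -> 'rV[R]_k) (E : 'M[R]_n) :
  E *m gram x p *m E^T = 1%:M ->
  vec_trace p b = \sum_l \sum_i \sum_j (E l i * E l j) *: b i j.
Proof.
move=> /frameK hE; rewrite /vec_trace hE [RHS]exchange_big /=.
apply: eq_bigr => i _; rewrite [RHS]exchange_big /=; apply: eq_bigr => j _.
by rewrite mxE scaler_suml; apply: eq_bigr => l _; rewrite mxE.
Qed.

End LeviCivita.

Definition space_form (R : realType) (n : nat) (c : R) (N : riemannian R n) :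
    Prop :=
  forall (y : chart R n N) (q : N) (u v : 'rV[R]_n),
    atlas y -> chart_dom y q -> row_free (col_mx u v) ->
    sectional y q u v = c.

Section Hypersurface.
Variables (R : realType) (n k : nat).
Variables (M : riemannian R n) (N : riemannian R k) (phi : M -> N).

Definition smooth_map : Prop :=
  continuous phi /\
  forall (x : chart R n M) (y : chart R k N), atlas x -> atlas y ->
    forall a, smooth_in x (phi @^-1` chart_dom y)
                (fun p => coord y (phi p) 0 a).

Variables (x : chart R n M) (y : chart R k N).
Implicit Types (p : M) (X Y : M -> 'rV[R]_n) (V eta : M -> 'rV[R]_k).

(* Sections of the pullback bundle are in components of the chart y of N. *)

Definition dphi_mx p : 'M[R]_(n, k) :=
  \matrix_(i, a) pd x i (fun q => coord y (phi q) 0 a) p.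

Definition dphi X : M -> 'rV[R]_k := fun p => X p *m dphi_mx p.

Definition nabla_phi X V : M -> 'rV[R]_k := fun p =>
  \sum_i X p 0 i *: (pdv x i V p
    + \sum_b \sum_d (dphi_mx p i b * V p 0 d) *: christoffel y (phi p) b d).

(* B = nabla d phi *)
Definition second_fundamental X Y : M -> 'rV[R]_k := fun p =>
  nabla_phi X (dphi Y) p - dphi (nabla x X Y) p.

Definition tension : M -> 'rV[R]_k := fun p =>
  vec_trace x p (fun i j =>
    second_fundamental (@coord_field R n M i) (@coord_field R n M j) p).

Definition rough_laplacian V : M -> 'rV[R]_k := fun p =>
  - vec_trace x p (fun i j =>
      let ei := @coord_field R n M i in let ej := @coord_field R n M j in
      nabla_phi ei (nabla_phi ej V) p - nabla_phi (nabla x ei ej) V p).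

Definition bitension : M -> 'rV[R]_k := fun p =>
  - rough_laplacian tension p
  - vec_trace x p (fun i j =>
      curvature y (phi p) (row i (dphi_mx p)) (tension p) (row j (dphi_mx p))).

(* The vector field T with <T, X> = <bitension, d phi X> for every X. *)
Definition bitension_tan : M -> 'rV[R]_n := fun p =>
  (\row_j inner y (phi p) (bitension p) (row j (dphi_mx p)))
  *m invmx (gram x p).

(* S_2, as the matrix of the bilinear form S_2(X, Y) on coordinate fields. *)
Definition stress_energy p : 'M[R]_n :=
  let D := \matrix_(i, j) inner y (phi p) (row i (dphi_mx p))
             (nabla_phi (@coord_field R n M j) tension p) in
  (2^-1 * inner y (phi p) (tension p) (tension p) + form_trace x p D)
    *: gram x p - D - D^T.

Definition unit_normal (W : set M) eta : Prop :=
  [/\ forall a, smooth_in x W (fun p => eta p 0 a),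
      forall p, W p -> inner y (phi p) (eta p) (eta p) = 1
    & forall p, W p ->
        forall i, inner y (phi p) (row i (dphi_mx p)) (eta p) = 0].

(* The operator A with <A X, Y> = <B(X, Y), eta>. *)
Definition shape_operator eta p : 'M[R]_n :=
  (\matrix_(i, j) inner y (phi p)
     (second_fundamental (@coord_field R n M i) (@coord_field R n M j) p)
     (eta p)) *m invmx (gram x p).

Definition mean_curvature eta p : R := n%:R^-1 * \tr (shape_operator eta p).

End Hypersurface.

(* The immersion property follows from positive definiteness of [gram]. *)
Definition isometric_immersion (R : realType) (n k : nat)
    (M : riemannian R n) (N : riemannian R k) (phi : M -> N) : Prop :=
  smooth_map phi /\
  forall (x : chart R n M) (y : chart R k N) (p : M) (u v : 'rV[R]_n),
    atlas x -> atlas y -> chart_dom x p -> chart_dom y (phi p) ->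
    inner y (phi p) (u *m dphi_mx phi x y p) (v *m dphi_mx phi x y p)
    = inner x p u v.

(* Main.v *)
(* With u = m f = trace A one has S_2 = -(u^2/2) I + 2 u A, hence
   |S_2|^2 = (m/4 - 2) u^4 + 4 u^2 |A|^2, and the tangential bitension field is
   T = -2 A(grad u) - u grad u.  The Laplacian of |S_2|^2 is expanded with the
   product rule; the term (Laplacian of |A|^2) is computed by a Simons identity,
   which follows from the Codazzi equation and from the Ricci identity, the
   curvature being given by the Gauss equation.  The Gauss equation also gives
   Ricci and the scalar curvature in terms of A, and the two sides of the claim
   become polynomials in the same scalar invariants of A and grad u.  The
   structure equations themselves are obtained by differentiating twice the
   frame made of the coordinate tangent vectors and the unit normal. *)
From HB Require Import structures.
Require Import Defs.
From mathcomp Require Import all_boot all_order all_algebra.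
From mathcomp Require Import all_classical all_reals all_analysis.
From mathcomp Require Import perm ring lra.

Set Implicit Arguments.
Unset Strict Implicit.
Unset Printing Implicit Defensive.

Import Order.TTheory GRing.Theory Num.Theory.
Import numFieldNormedType.Exports.

Local Open Scope classical_set_scope.
Local Open Scope ring_scope.

(** * Schwarz's theorem and smooth functions *)

Section MeanValue.
Variable R : realType.

(** The claim is local, so everything happens on an open set [W] inside one chart, and two fields
    that agree on [W] may be exchanged under a derivative there. Derivatives are limits of
    difference quotients of bare functions: smoothness is never automatic and each product rule asks
    for it, whence the calculus built up from partial derivatives.

    The immersion only has to deliver a self-adjoint operator [A] on [M] with the Gauss and Codazzi
    equations, and the formulas for [T] and [|S_2|^2]; the identity is then proved for such an
    operator, without reference to [N]. Working with [u] instead of [f] keeps powers of [1/m]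
    outside the derivatives.

    Two scalars of second order in [u] cannot be simplified. Simons' identity produces
    [<nabla grad u, A>], and the divergence of [f Ricci(grad f)] produces both this one and
    [<nabla (A grad u), A>]. The latter cancels against [<nabla T, A>]; the former balances only
    when the divergences of [f Ricci(grad f)] and of [T] and the term [<nabla T, A>] are taken
    together. This explains the coefficients of the [T] terms in the statement. *)

Lemma mean_value0 (g : R -> R) (s : R) :
  (forall t, `|t| <= `|s| -> derivable g t 1) ->
  exists2 t, `|t| <= `|s| & g s - g 0 = 'D_1 g t * s.
Proof.
move=> dg.
have cg (a b : R) : (forall t, a <= t <= b -> `|t| <= `|s|) ->
    {within `[a, b], continuous g}.
  move=> hab; apply: derivable_within_continuous => t.
  by rewrite in_itv /= => /hab /dg.
have der (a b : R) : (forall t, a <= t <= b -> `|t| <= `|s|) ->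
    forall t, t \in `]a, b[%R -> is_derive t 1 g ('D_1 g t).
  move=> hab t; rewrite in_itv /= => /andP[/ltW a_t /ltW t_b].
  by apply/derivableP/dg/hab; rewrite a_t t_b.
have [s0|/ltW s0] := leP 0 s.
  have hab t : 0 <= t <= s -> `|t| <= `|s|.
    by move=> /andP[t0 ts]; rewrite !ger0_norm.
  have [t + ->] := MVT_segment s0 (der _ _ hab) (cg _ _ hab).
  by rewrite in_itv /= subr0 => /hab; exists t.
have hab t : s <= t <= 0 -> `|t| <= `|s|.
  by move=> /andP[t0 ts]; rewrite !ler0_norm // lerN2.
have [t + e] := MVT_segment s0 (der _ _ hab) (cg _ _ hab).
rewrite in_itv /= => /hab; exists t => //.
by rewrite -opprB e sub0r mulrN opprK.
Qed.

End MeanValue.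

(** * Differentiability from continuous partial derivatives; symmetry of second derivatives *)

Section EuclideanCalculus.
Variables (R : realType) (n : nat).
Implicit Types (f g : 'rV[R]_n -> R) (U : set 'rV[R]_n) (a v : 'rV[R]_n).

Let e (i : 'I_n) : 'rV[R]_n := delta_mx 0 i.

Lemma coord_le_norm v i : `|v 0 i| <= `|v|.
Proof.
rewrite [leRHS]/Num.Def.normr /= mx_normrE.
exact: (le_bigmax _ (fun ij => `|v ij.1 ij.2|) (0, i)).
Qed.

Lemma norm_le_coord v (r : R) : 0 <= r -> (forall i, `|v 0 i| <= r) -> `|v| <= r.
Proof.
move=> r0 vr; rewrite [leLHS]/Num.Def.normr /= mx_normrE.
by apply: bigmax_le => // -[i j] _ /=; rewrite ord1.
Qed.

Lemma norm_delta_le i : `|e i| <= 1.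
Proof.
apply: norm_le_coord => // j; rewrite mxE eqxx /=.
by case: eqVneq; rewrite ?normr1 ?normr0.
Qed.

Lemma derive_line f a v (t : R) :
  'D_1 (fun s : R => f (a + s *: v)) t = 'D_v f (a + t *: v).
Proof.
rewrite /derive; set g1 := fun h => h^-1 *: _; set g2 := fun h => h^-1 *: _.
suff -> : g1 = g2 by [].
apply/funext => h; rewrite /g1 /g2 /= [h%:A]mulr1 scalerDl.
by rewrite addrCA.
Qed.

Lemma derivable_line f a v (t : R) :
  derivable f (a + t *: v) v -> derivable (fun s : R => f (a + s *: v)) t 1.
Proof.
rewrite /derivable; set g1 := fun h => h^-1 *: _; set g2 := fun h => h^-1 *: _.
suff -> : g1 = g2 by [].
apply/funext => h; rewrite /g1 /g2 /= [h%:A]mulr1 scalerDl.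
by rewrite [in RHS]addrCA.
Qed.

Lemma mean_value_line f a v (s : R) :
  (forall t, `|t| <= `|s| -> derivable f (a + t *: v) v) ->
  exists2 t, `|t| <= `|s| & f (a + s *: v) - f a = 'D_v f (a + t *: v) * s.
Proof.
move=> df.
have [t ts] := @mean_value0 R (fun s => f (a + s *: v)) s
  (fun t ht => derivable_line (df t ht)).
by rewrite scale0r addr0 derive_line; exists t.
Qed.

(** The segment from [a] to [a + h] is replaced by a staircase changing one coordinate at a time.
    Each step is a one-variable mean value problem, and the [n] steps account for the factor
    [n%:R]. *)
Lemma first_order_bound f a (r eps : R) :
  (forall v, `|v - a| < r -> forall i, derivable f v (e i)) ->
  (forall v, `|v - a| < r -> forall i, `|partial i f v - partial i f a| <= eps) ->
  forall h, `|h| < r ->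
  `|f (a + h) - f a - \sum_i h 0 i * partial i f a| <= n%:R * (eps * `|h|).
Proof.
move=> df bf h hr.
(* [hk k] keeps the first [k] coordinates of [h]. In the sup norm neither these corners nor the
   edges between them exceed [h], so the staircase stays in the ball. *)
pose hk k : 'rV[R]_n := \row_i (if (i < k)%N then h 0 i else 0).
have hS (i : 'I_n) (t : R) : `|t| <= `|h 0 i| -> `|hk i + t *: e i| <= `|h|.
  move=> ti; apply: norm_le_coord => // j; rewrite !mxE eqxx /=.
  case: eqVneq => [->|ij].
    by rewrite ltnn add0r mulr1 (le_trans ti) // coord_le_norm.
  by rewrite mulr0 addr0; case: ifP => _; rewrite ?normr0 // coord_le_norm.
have hkS (i : 'I_n) : hk i.+1 = hk i + h 0 i *: e i.
  apply/rowP => j; rewrite !mxE eqxx /= ltnS leq_eqVlt.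
  case: (eqVneq j i) => [->|ji]; first by rewrite eqxx ltnn /= mulr1 add0r.
  by rewrite -(inj_eq val_inj) in ji; rewrite (negbTE ji) /= mulr0 addr0.
have h0 : hk 0 = 0 by apply/rowP => j; rewrite !mxE.
have hn : hk n = h by apply/rowP => j; rewrite !mxE ltn_ord.
have -> : f (a + h) - f a = \sum_(i < n) (f (a + hk i.+1) - f (a + hk i)).
  rewrite -(big_mkord xpredT (fun i => f (a + hk i.+1) - f (a + hk i))).
  by rewrite telescope_sumr // hn h0 addr0.
rewrite -sumrB (le_trans (ler_norm_sum _ _ _)) //.
rewrite mulr_natl -[X in _ *+ X]card_ord -sumr_const ler_sum // => i _.
have near_a (t : R) : `|t| <= `|h 0 i| -> `|a + hk i + t *: e i - a| < r.
  by move=> ti; rewrite -[a + _ + _]addrA [a + _]addrC addrK (le_lt_trans (hS _ _ ti)).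
have [t ti] := @mean_value_line f (a + hk i) (e i) (h 0 i)
   (fun t ht => df _ (near_a t ht) i).
rewrite hkS addrA => ->.
rewrite mulrC -mulrBr normrM mulrC ler_pM ?coord_le_norm //.
exact: bf (near_a t ti) i.
Qed.

(** Near [a] the partial derivatives vary as little as desired, so [first_order_bound] is the
    little-o estimate that characterises the differential. *)
Lemma partial_differentiable f a :
  (\forall v \near a, forall i, derivable f v (e i)) ->
  (forall i, {for a, continuous (partial i f)}) ->
  differentiable f a /\ 'd f a = (fun h => \sum_i h 0 i * partial i f a) :> (_ -> _).
Proof.
move=> df cf.
pose d (h : 'rV[R]_n) : R := \sum_i h 0 i * partial i f a.
have lin_d : linear d.
  move=> k u v; rewrite /d scaler_sumr -big_split; apply: eq_bigr => i _ /=.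
  by rewrite !mxE mulrDl -mulrA.
pose dM := GRing.isLinear.Build _ _ _ _ _ lin_d.
pose D : {linear _ -> _} := HB.pack d dM.
have cD : continuous D.
  apply: (@continuous_big _ _ +%R 0 xpredT add_continuous _ _
    (fun i (h : 'rV[R]_n) => h 0 i * partial i f a)) => i _ v.
  apply: (@continuousM _ _ (fun h : 'rV[R]_n => h 0 i) (cst (partial i f a)) v).
    exact: coord_continuous.
  exact: cst_continuous.
have eD : (f \o shift a : 'rV[R]_n -> R^o) = cst (f a) + (D : 'rV[R]_n -> R^o) +o_ (0 : 'rV[R]_n) id.
  apply/eqaddoP => _/posnumP[eps].
  (* Absorbs the factor [n] of [first_order_bound]; with [n.+1] the quotient stays positive for
     [n = 0]. *)
  pose eps' : R := eps%:num / n.+1%:R.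
  have eps'0 : 0 < eps' by rewrite divr_gt0.
  have cf' : \forall v \near a, forall i, `|partial i f a - partial i f v| <= eps'.
    have FF : Filter (nbhs a) by exact: nbhs_filter.
    have := @filter_forall _ 'I_n (fun i v => `|partial i f a - partial i f v| <= eps') _ FF.
    apply => i.
    by have /cvgrPdist_le := cf i; apply.
  have [r /= r0 hr] := (nbhs_ballP a _).1 (filterI df cf').
  have hr' v : `|v - a| < r -> ball a r v.
    by move=> vr; rewrite -ball_normE /= distrC.
  apply/nbhs_ballP; exists r => //= h.
  rewrite -ball_normE /= sub0r normrN => hh.
  rewrite -[X in X <= _]/(`|f (h + a) - (f a + d h)|) opprD addrA [h + a]addrC.
  apply: le_trans (@first_order_bound f a r eps' _ _ h hh) _.
  - by move=> v vr; case: (hr v (hr' _ vr)).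
  - by move=> v vr i; rewrite distrC; case: (hr v (hr' _ vr)).
  rewrite mulrA ler_wpM2r // /eps' mulrCA ler_piMr //.
  by rewrite ler_pdivrMr // mul1r ler_nat.
have dfa := diff_unique cD eD.
split; last by rewrite dfa.
by apply/diff_locallyP; rewrite dfa.
Qed.

(** Two uses of the mean value theorem: along [e i] for the increment of [f] in direction [e j],
    then along [e j] for [partial i f]. Their order decides which mixed derivative appears. *)
Lemma second_difference f v i j (h : R) :
  (forall w, `|w - v| <= 2 * `|h| ->
     derivable f w (e i) /\ derivable (partial i f) w (e j)) ->
  exists2 w, `|w - v| <= 2 * `|h| &
    f (v + h *: e i + h *: e j) - f (v + h *: e i) - f (v + h *: e j) + f v
    = partial j (partial i f) w * h * h.
Proof.
move=> df.
have nr (s t : R) : `|s| <= `|h| -> `|t| <= `|h| ->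
    `|v + s *: e i + t *: e j - v| <= 2 * `|h|.
  move=> sh th; rewrite -[v + _ + _]addrA [v + _]addrC addrK mulr_natl mulr2n.
  rewrite (le_trans (ler_normD _ _)) // lerD // normrZ.
    by rewrite -[leRHS]mulr1 ler_pM ?norm_delta_le.
  by rewrite -[leRHS]mulr1 ler_pM ?norm_delta_le.
have n0 : `|0 : R| <= `|h| by rewrite normr0.
pose g w := f (w + h *: e j) - f w.
have dfi s t : `|s| <= `|h| -> `|t| <= `|h| ->
    derivable f (v + s *: e i + t *: e j) (e i).
  by move=> sh th; exact: (df _ (nr s t sh th)).1.
have dsh w : derivable f (w + h *: e j) (e i) ->
    derivable (fun w => f (w + h *: e j)) w (e i) /\
    partial i (fun w => f (w + h *: e j)) w = partial i f (w + h *: e j).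
  rewrite /partial /derivable /derive; set g1 := fun h => h^-1 *: _.
  set g2 := fun h => h^-1 *: _.
  suff -> : g1 = g2 by [].
  by apply/funext => t; rewrite /g1 /g2 /= addrA.
have dg s : `|s| <= `|h| -> derivable g (v + s *: e i) (e i) /\
   partial i g (v + s *: e i) =
   partial i f (v + s *: e i + h *: e j) - partial i f (v + s *: e i).
  move=> sh; have [d1 e1] := dsh _ (dfi s h sh (lexx _)).
  have d2 := dfi s 0 sh n0; rewrite scale0r addr0 in d2.
  split; first exact: (derivableB d1 d2).
  by rewrite -e1; exact: (deriveB d1 d2).
have [s sh] := @mean_value_line g v (e i) h (fun t ht => (dg t ht).1).
rewrite -/(partial i g _) (dg s sh).2 /g => eq1.
have dfij t : `|t| <= `|h| -> derivable (partial i f) (v + s *: e i + t *: e j) (e j).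
  by move=> th; exact: (df _ (nr s t sh th)).2.
have [t th eq2] := @mean_value_line (partial i f) (v + s *: e i) (e j) h dfij.
exists (v + s *: e i + t *: e j); first exact: nr.
by rewrite /partial -eq2 -eq1; ring.
Qed.

(** The second difference is symmetric in [i] and [j], so the two mixed derivatives take a common
    value at two points near [v]; continuity does the rest. *)
Lemma partialC f v i j :
  (\forall w \near v, forall k l,
     derivable f w (e k) /\ derivable (partial k f) w (e l)) ->
  (forall k l, {for v, continuous (partial k (partial l f))}) ->
  partial i (partial j f) v = partial j (partial i f) v.
Proof.
move=> df cf; apply/eqP; rewrite -subr_eq0 -normr_le0; apply/ler_addgt0Pr => eps eps0.
rewrite add0r.
have e20 : 0 < eps / 2 by rewrite divr_gt0.
have c k l : \forall w \near v,
    `|partial k (partial l f) v - partial k (partial l f) w| <= eps / 2.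
  by have /cvgrPdist_le := cf k l; apply.
have [r /= r0 hr] := (nbhs_ballP v _).1 (filterI df (filterI (c i j) (c j i))).
pose h := r / 4; have h0 : 0 < h by rewrite divr_gt0.
have hr' w : `|w - v| <= 2 * `|h| -> ball v r w.
  move=> wv; rewrite -ball_normE /= distrC (le_lt_trans wv) //.
  by rewrite gtr0_norm // /h; lra.
have [w1 w1v E1] := @second_difference f v i j h
  (fun w wv => (hr _ (hr' _ wv)).1 i j).
have [w2 w2v E2] := @second_difference f v j i h
  (fun w wv => (hr _ (hr' _ wv)).1 j i).
have [_ [_ b1]] := hr _ (hr' _ w1v); have [_ [b2 _]] := hr _ (hr' _ w2v).
rewrite [v + h *: e j + _]addrAC in E2.
have AC (x y z t : R) : x - y - z + t = x - z - y + t by rewrite (addrAC x).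
have := etrans (etrans (esym E1) (AC _ _ _ _)) E2.
move: b1 b2.
move: (partial i (partial j f)) (partial j (partial i f)) => P Q b1 b2 E.
have {}E : Q w1 = P w2.
  by apply: (@mulIf _ h); last apply: (@mulIf _ h); rewrite ?gt_eqF.
rewrite E distrC in b1.
by rewrite (le_trans (ler_distD (P w2) _ _)) // [leRHS]splitr lerD.
Qed.

End EuclideanCalculus.

(** * Chain rule and elementary rules for smooth functions *)

Section ChainRule.
Variables (R : realType) (V : normedModType R) (k : nat).

(** Only derivatives of [phi] in the direction [w] are available. On the line [t *: w + v] it
    becomes a function of a real variable, for which derivability and differentiability agree, and
    the chain rule for differentials applies. *)
Lemma is_derive_chain (h : 'rV[R]_k -> R) (phi : V -> 'rV[R]_k) (v w : V) :
  (\forall z \near phi v, forall b, derivable h z (delta_mx 0 b)) ->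
  (forall b, {for phi v, continuous (partial b h)}) ->
  (forall b, derivable (fun u => phi u 0 b) v w) ->
  is_derive v w (h \o phi)
    (\sum_b 'D_w (fun u => phi u 0 b) v * partial b h (phi v)).
Proof.
move=> dh ch dphi; have [diffh dE] := partial_differentiable dh ch.
have dp : derivable phi v w.
  by apply/derivable_mxP => i j; rewrite ord1; exact: dphi.
pose g (t : R) := phi (t *: w + v).
have dg : differentiable g 0.
  exact: (derivable1_diffP g 0).1 ((derivable1P phi v w).1 dp).
have g0 : g 0 = phi v by rewrite /g scale0r add0r.
have dhg : differentiable h (g 0) by rewrite g0.
have dcomp : differentiable (h \o g) 0 by exact: differentiable_comp.
have dhp : derivable (h \o phi) v w.
  have d1 : derivable (h \o g) 0 1 by exact: (derivable1_diffP (h \o g : R -> R^o) 0).2.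
  exact: (derivable1P (h \o phi : V -> R^o) v w).2.
have shift0 (W : normedModType R) (q : V -> W) : 'D_1 (fun t : R => q (t *: w + v)) 0 = 'D_w q v.
  rewrite /derive; set g1 := fun h => h^-1 *: _; set g2 := fun h => h^-1 *: _.
  suff -> : g1 = g2 by [].
  by apply/funext => t; rewrite /g1 /g2 /= addr0 scale0r add0r [t%:A]mulr1.
apply: DeriveDef => //.
rewrite -(shift0 _ (h \o phi)) -/(h \o g) deriveE // diff_comp //= g0 dE.
rewrite -deriveE // shift0 derive_mx //.
by apply: eq_bigr => b _; rewrite mxE.
Qed.

End ChainRule.

Section SmoothFunctions.
Variables (R : realType) (n : nat).
Implicit Types (f g : 'rV[R]_n -> R) (U : set 'rV[R]_n) (i j : 'I_n).

Lemma smooth_on_continuous U f v : smooth_on U f -> U v -> {for v, continuous f}.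
Proof. by move=> sf Uv; have [] := sf [::] v Uv. Qed.

Lemma smooth_on_derivable U f v i :
  smooth_on U f -> U v -> derivable f v (delta_mx 0 i).
Proof. by move=> sf Uv; have [_] := sf [::] v Uv; exact. Qed.

Lemma smooth_on_partial U f i : smooth_on U f -> smooth_on U (partial i f).
Proof.
move=> sf s v Uv.
by have := sf (rcons s i) v Uv; rewrite /iter_partial foldr_rcons.
Qed.

Lemma smooth_on_subset U W f : U `<=` W -> smooth_on W f -> smooth_on U f.
Proof. by move=> UW sf s v /UW; exact: sf. Qed.

Lemma smooth_on_partialC U f i j v : open U -> smooth_on U f -> U v ->
  partial i (partial j f) v = partial j (partial i f) v.
Proof.
move=> oU sf Uv; apply: partialC => [|k l].
  have Uw : \forall w \near v, U w by exact: open_nbhs_nbhs.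
  apply: filterS Uw => w Uw k l; split; first exact: smooth_on_derivable sf Uw.
  exact: smooth_on_derivable (smooth_on_partial k sf) Uw.
exact: smooth_on_continuous (smooth_on_partial k (smooth_on_partial l sf)) Uv.
Qed.

Lemma partial_ext U f g v i : open U -> U v -> (forall w, U w -> f w = g w) ->
  partial i f v = partial i g v.
Proof.
move=> oU Uv fg; apply: near_eq_derive.
have Uw : \forall w \near v, U w by exact: open_nbhs_nbhs.
exact: filterS Uw.
Qed.

Lemma partialD f g v i :
  derivable f v (delta_mx 0 i) -> derivable g v (delta_mx 0 i) ->
  partial i (fun w => f w + g w) v = partial i f v + partial i g v.
Proof. exact: deriveD. Qed.

Lemma partialM f g v i :
  derivable f v (delta_mx 0 i) -> derivable g v (delta_mx 0 i) ->
  partial i (fun w => f w * g w) v = partial i f v * g v + f v * partial i g v.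
Proof.
move=> df dg; rewrite addrC (mulrC (partial i f v)).
exact: (deriveM df dg).
Qed.

Lemma partialV f v i : f v != 0 -> derivable f v (delta_mx 0 i) ->
  partial i (fun w => (f w)^-1) v = - ((f v)^-1 * (f v)^-1 * partial i f v).
Proof.
move=> f0 df; rewrite /partial deriveV // -mulNr -[_ *: _]/(_ * _).
by rewrite expr2 invfM.
Qed.

Lemma partial_cst (c : R) v i : partial i (fun=> c) v = 0.
Proof. exact: derive_cst. Qed.

Lemma rV_continuous (T : topologicalType) (phi : T -> 'rV[R]_n) v :
  (forall b, {for v, continuous (fun u => phi u 0 b)}) ->
  {for v, continuous phi}.
Proof.
move=> cphi; apply/cvgrPdist_le => _/posnumP[eps].
have FF : Filter (nbhs v) by exact: nbhs_filter.
have := @filter_forall _ 'I_n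
  (fun b u => `|phi v 0 b - phi u 0 b| <= eps%:num) _ FF.
have h b : \forall u \near v, `|phi v 0 b - phi u 0 b| <= eps%:num.
  by have /cvgrPdist_le := cphi b; exact.
move=> /(_ h); apply: filterS => u hu.
by apply: norm_le_coord => // b; rewrite !mxE.
Qed.

End SmoothFunctions.

(** * Stability of smooth functions under algebraic operations and composition *)

Section SmoothClosure.
Variables (R : realType) (n : nat).
Implicit Types (f g : 'rV[R]_n -> R) (U : set 'rV[R]_n) (i j : 'I_n).

Lemma partial_chain k (V : set 'rV[R]_k) (h : 'rV[R]_k -> R)
    (phi : 'rV[R]_n -> 'rV[R]_k) v i :
  open V -> V (phi v) -> smooth_on V h ->
  (forall b, derivable (fun u => phi u 0 b) v (delta_mx 0 i)) ->
  derivable (h \o phi) v (delta_mx 0 i) /\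
  partial i (h \o phi) v
  = \sum_b partial i (fun u => phi u 0 b) v * partial b h (phi v).
Proof.
move=> oV Vv sh dphi.
have [] // : is_derive v (delta_mx 0 i) (h \o phi)
    (\sum_b partial i (fun u => phi u 0 b) v * partial b h (phi v)).
apply: is_derive_chain; last exact: dphi.
  have Vw : \forall w \near phi v, V w by exact: open_nbhs_nbhs.
  apply: filterS Vw => w Vw b; exact: smooth_on_derivable sh Vw.
by move=> b; exact: smooth_on_continuous (smooth_on_partial b sh) Vv.
Qed.

(* The expressions built from smooth functions are stable under partial
   derivatives, which makes a single induction yield all closure properties. *)
Inductive smooth_expr U : ('rV[R]_n -> R) -> Prop :=
| smooth_expr_base f : smooth_on U f -> smooth_expr U f
| smooth_expr_cst c : smooth_expr U (fun=> c)
| smooth_expr_add f g : smooth_expr U f -> smooth_expr U g ->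
    smooth_expr U (fun v => f v + g v)
| smooth_expr_mul f g : smooth_expr U f -> smooth_expr U g ->
    smooth_expr U (fun v => f v * g v)
| smooth_expr_inv f : smooth_expr U f -> (forall v, U v -> f v != 0) ->
    smooth_expr U (fun v => (f v)^-1)
| smooth_expr_comp k (V : set 'rV[R]_k) (h : 'rV[R]_k -> R) phi :
    open V -> smooth_on V h -> (forall v, U v -> V (phi v)) ->
    (forall b, smooth_on U (fun v => phi v 0 b)) -> smooth_expr U (h \o phi)
| smooth_expr_ext f g : smooth_expr U f -> (forall v, U v -> f v = g v) ->
    smooth_expr U g.

Lemma smooth_expr_sum U (I : Type) (r : seq I) (F : I -> 'rV[R]_n -> R) :
  (forall b, smooth_expr U (F b)) -> smooth_expr U (fun v => \sum_(b <- r) F b v).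
Proof.
move=> sF; elim: r => [|b r IH].
  by apply: smooth_expr_ext (smooth_expr_cst _ 0) _ => v _; rewrite big_nil.
by apply: smooth_expr_ext (smooth_expr_add (sF b) IH) _ => v _; rewrite big_cons.
Qed.

(** The induction carries both conclusions at once: regularity of the parts justifies the
    differentiation rule, and the rule exhibits the derivative as an expression again. For a
    composition it involves only derivatives of the coordinates of [phi], which are base
    expressions, and compositions with the same [phi]. *)
Lemma smooth_expr_partial U f : open U -> smooth_expr U f ->
  (forall v, U v -> {for v, continuous f} /\
                    forall i, derivable f v (delta_mx 0 i)) /\
  (forall i, smooth_expr U (partial i f)).
Proof.
move=> oU; elim=> {f}.
- move=> f sf; split=> [v Uv|i].
    split; first exact: smooth_on_continuous sf Uv.
    by move=> i; exact: smooth_on_derivable sf Uv.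
  by apply: smooth_expr_base; exact: smooth_on_partial.
- move=> c; split=> [v Uv|i].
    by split=> [|i]; [exact: cst_continuous|exact: derivable_cst].
  apply: smooth_expr_ext (smooth_expr_cst _ 0) _ => v _.
  by rewrite partial_cst.
- move=> f g _ [cf sf] _ [cg sg]; split=> [v Uv|i].
    have [cfv dfv] := cf v Uv; have [cgv dgv] := cg v Uv.
    by split=> [|i]; [exact: continuousD|exact: derivableD].
  apply: smooth_expr_ext (smooth_expr_add (sf i) (sg i)) _ => v Uv.
  by rewrite (partialD ((cf v Uv).2 i) ((cg v Uv).2 i)).
- move=> f g ef [cf sf] eg [cg sg]; split=> [v Uv|i].
    have [cfv dfv] := cf v Uv; have [cgv dgv] := cg v Uv.
    by split=> [|i]; [exact: continuousM|exact: derivableM].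
  apply: smooth_expr_ext (smooth_expr_add (smooth_expr_mul (sf i) eg)
                           (smooth_expr_mul ef (sg i))) _ => v Uv.
  by rewrite (partialM ((cf v Uv).2 i) ((cg v Uv).2 i)).
- move=> f ef [cf sf] f0; split=> [v Uv|i].
    have [cfv dfv] := cf v Uv.
    by split=> [|i]; [apply: cvgV (f0 v Uv) cfv|exact: derivableV (f0 v Uv) (dfv i)].
  have ei := smooth_expr_inv ef f0.
  apply: smooth_expr_ext (smooth_expr_mul (smooth_expr_cst _ (-1))
    (smooth_expr_mul (smooth_expr_mul ei ei) (sf i))) _ => v Uv.
  by rewrite mulN1r (partialV (f0 v Uv) ((cf v Uv).2 i)).
- move=> k V h phi oV sh phiV sphi; split=> [v Uv|i].
    split=> [|i]; last first.
      have dphi b : derivable (fun u => phi u 0 b) v (delta_mx 0 i).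
        exact: smooth_on_derivable (sphi b) Uv.
      exact: (partial_chain oV (phiV v Uv) sh dphi).1.
    apply: continuous_comp; last exact: smooth_on_continuous sh (phiV v Uv).
    by apply: rV_continuous => b; exact: smooth_on_continuous (sphi b) Uv.
  have e : smooth_expr U (fun v => \sum_b
      partial i (fun u => phi u 0 b) v * (partial b h \o phi) v).
    apply: smooth_expr_sum => b; apply: smooth_expr_mul.
      by apply: smooth_expr_base; exact: smooth_on_partial.
    exact: smooth_expr_comp oV (smooth_on_partial b sh) phiV sphi.
  apply: smooth_expr_ext e _ => v Uv.
  have dphi b : derivable (fun u => phi u 0 b) v (delta_mx 0 i).
    exact: smooth_on_derivable (sphi b) Uv.
  by rewrite (partial_chain oV (phiV v Uv) sh dphi).2.
- move=> f g _ [cf sf] fg; split=> [v Uv|i].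
    have [cfv dfv] := cf v Uv.
    have Uw : \forall w \near v, U w by exact: open_nbhs_nbhs.
    have fgw : \forall w \near v, f w = g w by exact: filterS Uw.
    split=> [|i]; last exact: near_eq_derivable fgw (dfv i).
    rewrite /prop_for /continuous_at -fg //.
    by apply: cvg_trans cfv; exact: near_eq_cvg fgw.
  apply: smooth_expr_ext (sf i) _ => v Uv; exact: (partial_ext i oU Uv fg).
Qed.

Lemma smooth_exprP U f : open U -> smooth_expr U f -> smooth_on U f.
Proof.
move=> oU ef s; have : smooth_expr U (iter_partial s f).
  by elim: s => //= i s IH; exact: (smooth_expr_partial oU IH).2.
by move=> /(smooth_expr_partial oU)[].
Qed.

End SmoothClosure.

(** * Calculus in a chart *)

(** The unit normal is given only on an open piece of a chart; openness is what allows an equality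
    on that piece to be differentiated. *)
Record subdomain (R : realType) (n : nat) (M : topologicalType)
    (x : chart R n M) := Subdomain {
  subdomain_set :> set M;
  subdomain_open : open subdomain_set;
  subdomain_dom : subdomain_set `<=` chart_dom x }.

Definition subdomain_mem (R : realType) (n : nat) (M : topologicalType)
    (x : chart R n M) (W : subdomain x) : M -> Prop := subdomain_set W.
Coercion subdomain_mem : subdomain >-> Funclass.

Section ChartCalculus.
Variables (R : realType) (n : nat) (M : topologicalType) (x : chart R n M).
Variable W : subdomain x.
Implicit Types (u v : M -> R) (p q : M) (i j : 'I_n).

Let img := Defs.coord x @` (W `&` chart_dom x).

Lemma image_subdomain p : W p -> img (Defs.coord x p).
Proof. by move=> Wp; exists p => //; split=> //; exact: (subdomain_dom Wp). Qed.

Let coordK w : img w -> W (chart_inv x w) /\ Defs.coord x (chart_inv x w) = w.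
Proof. by move=> [q [Wq xq] <-]; rewrite chart_invK. Qed.

(** [chart_inv] is continuous only within the chart image; as that image is open, this is ordinary
    continuity at its points, and preimages of open sets are neighbourhoods. *)
Lemma image_subdomain_open : open img.
Proof.
rewrite openE => v iv; have [Wq cq] := coordK iv.
have dv : (Defs.coord x @` chart_dom x) v by case: iv => q [_ xq] <-; exists q.
have oD := @chart_img_open _ _ _ x.
have := @chart_inv_continuous _ _ _ x.
rewrite (continuous_open_subspace _ oD) => /(_ v); rewrite inE => /(_ dv) c.
have WW : nbhs (chart_inv x v) W.
  by apply: open_nbhs_nbhs; split; [exact: (subdomain_open W)|exact: Wq].
have DD : nbhs v (Defs.coord x @` chart_dom x) by exact: open_nbhs_nbhs.
apply: filterS (filterI DD (c _ WW)) => w [[q xq <-]].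
by rewrite /= chart_invK // => Wq'; exists q.
Qed.

Let pd_coord u i w : img w ->
  (pd x i u \o chart_inv x) w = partial i (u \o chart_inv x) w.
Proof. by move=> iw; rewrite /pd /= (coordK iw).2. Qed.

Let der u p i : smooth_in x W u -> W p ->
  derivable (u \o chart_inv x) (Defs.coord x p) (delta_mx 0 i).
Proof. by move=> su Wp; exact: smooth_on_derivable su (image_subdomain Wp). Qed.

Lemma pd_ext u v p i : (forall q, W q -> u q = v q) -> W p ->
  pd x i u p = pd x i v p.
Proof.
move=> uv Wp; apply: partial_ext image_subdomain_open (image_subdomain Wp) _.
by move=> w iw; apply: uv; exact: (coordK iw).1.
Qed.

Lemma pd_cst (c : R) p i : pd x i (fun=> c) p = 0.
Proof. exact: partial_cst. Qed.

Lemma pdD u v p i : smooth_in x W u -> smooth_in x W v -> W p ->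
  pd x i (fun q => u q + v q) p = pd x i u p + pd x i v p.
Proof.
by move=> su sv Wp; have := partialD (@der u p i su Wp) (@der v p i sv Wp).
Qed.

Lemma pdM u v p i : smooth_in x W u -> smooth_in x W v -> W p ->
  pd x i (fun q => u q * v q) p = pd x i u p * v p + u p * pd x i v p.
Proof.
move=> su sv Wp; have := partialM (@der u p i su Wp) (@der v p i sv Wp).
by rewrite /= chart_invK //; exact: subdomain_dom Wp.
Qed.

Lemma pdC u p i j : smooth_in x W u -> W p ->
  pd x i (pd x j u) p = pd x j (pd x i u) p.
Proof.
move=> su Wp; have ip := image_subdomain Wp; have oi := image_subdomain_open.
transitivity (partial i (partial j (u \o chart_inv x)) (Defs.coord x p)).
  by apply: (partial_ext i oi ip) => w iw; exact: pd_coord.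
rewrite (smooth_on_partialC i j oi su ip); apply: (partial_ext j oi ip) => w iw.
exact/esym/pd_coord.
Qed.

Let expr u := @smooth_expr R n img (u \o chart_inv x).

Let exprP u : expr u -> smooth_in x W u.
Proof. exact: smooth_exprP image_subdomain_open. Qed.

Lemma smooth_in_ext u v : (forall q, W q -> u q = v q) ->
  smooth_in x W u -> smooth_in x W v.
Proof.
move=> uv su; apply: exprP.
apply: smooth_expr_ext (smooth_expr_base su) _ => w iw.
by apply: uv; exact: (coordK iw).1.
Qed.

Lemma smooth_in_cst (c : R) : smooth_in x W (fun=> c).
Proof. by apply: exprP; exact: smooth_expr_cst. Qed.

Lemma smooth_inD u v : smooth_in x W u -> smooth_in x W v ->
  smooth_in x W (fun q => u q + v q).
Proof.
by move=> su sv; apply: exprP; exact: (smooth_expr_add (smooth_expr_base su) (smooth_expr_base sv)).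
Qed.

Lemma smooth_inM u v : smooth_in x W u -> smooth_in x W v ->
  smooth_in x W (fun q => u q * v q).
Proof.
by move=> su sv; apply: exprP; exact: (smooth_expr_mul (smooth_expr_base su) (smooth_expr_base sv)).
Qed.

Lemma smooth_inV u : smooth_in x W u -> (forall q, W q -> u q != 0) ->
  smooth_in x W (fun q => (u q)^-1).
Proof.
move=> su u0; apply: exprP; apply: smooth_expr_inv; first exact: smooth_expr_base.
by move=> w iw; apply: u0; exact: (coordK iw).1.
Qed.

Lemma smooth_in_pd u i : smooth_in x W u -> smooth_in x W (pd x i u).
Proof.
move=> su; apply: exprP.
apply: smooth_expr_ext (smooth_expr_base (smooth_on_partial i su)) _ => w iw.
exact/esym/pd_coord.
Qed.

Lemma smooth_in_sum (I : Type) (r : seq I) (u : I -> M -> R) :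
  (forall b, smooth_in x W (u b)) ->
  smooth_in x W (fun q => \sum_(b <- r) u b q).
Proof.
move=> su; elim: r => [|b r IH].
  by apply: smooth_in_ext (smooth_in_cst 0) => q _; rewrite big_nil.
by apply: smooth_in_ext (smooth_inD (su b) IH) => q _; rewrite big_cons.
Qed.

Lemma smooth_in_prod (I : Type) (r : seq I) (u : I -> M -> R) :
  (forall b, smooth_in x W (u b)) ->
  smooth_in x W (fun q => \prod_(b <- r) u b q).
Proof.
move=> su; elim: r => [|b r IH].
  by apply: smooth_in_ext (smooth_in_cst 1) => q _; rewrite big_nil.
by apply: smooth_in_ext (smooth_inM (su b) IH) => q _; rewrite big_cons.
Qed.

Lemma pd_sum (I : Type) (r : seq I) (u : I -> M -> R) p i :
  (forall b, smooth_in x W (u b)) -> W p ->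
  pd x i (fun q => \sum_(b <- r) u b q) p = \sum_(b <- r) pd x i (u b) p.
Proof.
move=> su Wp; elim: r => [|b r IH].
  rewrite big_nil -[RHS](pd_cst 0 p i).
  by apply: pd_ext => // q _; rewrite big_nil.
rewrite big_cons -IH -pdD //; last exact: smooth_in_sum.
by apply: pd_ext => // q _; rewrite big_cons.
Qed.

Lemma smooth_inN u : smooth_in x W u -> smooth_in x W (fun q => - u q).
Proof.
move=> su; apply: smooth_in_ext (smooth_inM (smooth_in_cst (-1)) su) => q _.
by rewrite mulN1r.
Qed.

Lemma pdN u p i : smooth_in x W u -> W p ->
  pd x i (fun q => - u q) p = - pd x i u p.
Proof.
move=> su Wp; rewrite -mulN1r.
rewrite -[RHS]add0r -[X in X + _](mul0r (u p)) -{1}(pd_cst (-1) p i).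
rewrite -(pdM i (smooth_in_cst (-1)) su Wp).
by apply: pd_ext => // q _; rewrite mulN1r.
Qed.

Lemma smooth_in_comp k (N : topologicalType) (y : chart R k N) (Y : subdomain y)
    (phi : M -> N) (h : N -> R) :
  (forall p, W p -> Y (phi p)) ->
  (forall a, smooth_in x W (fun p => Defs.coord y (phi p) 0 a)) ->
  smooth_in y Y h -> smooth_in x W (h \o phi).
Proof.
move=> WY sphi sh; have oY : open (Defs.coord y @` (Y `&` chart_dom y)).
  rewrite openE => v [q [Yq yq] <-].
  have dv : (Defs.coord y @` chart_dom y) (Defs.coord y q) by exists q.
  have oD := @chart_img_open _ _ _ y.
  have := @chart_inv_continuous _ _ _ y.
  rewrite (continuous_open_subspace _ oD) => /(_ (Defs.coord y q)).
  rewrite inE => /(_ dv) c.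
  have YY : nbhs (chart_inv y (Defs.coord y q)) Y.
    by apply: open_nbhs_nbhs; split; [exact: (subdomain_open Y)|rewrite chart_invK].
  have DD : nbhs (Defs.coord y q) (Defs.coord y @` chart_dom y).
    exact: open_nbhs_nbhs.
  apply: filterS (filterI DD (c _ YY)) => w [[q' xq <-]].
  by rewrite /= chart_invK // => Wq'; exists q'.
apply: exprP.
have e : smooth_expr img ((h \o chart_inv y) \o
    ((fun p => Defs.coord y (phi p)) \o chart_inv x)).
  apply: smooth_expr_comp oY sh _ _ => [v iv|b]; last exact: sphi.
  have Yp := WY _ (coordK iv).1; exists (phi (chart_inv x v)) => //.
  by split=> //; exact: (subdomain_dom Yp).
apply: smooth_expr_ext e _ => v iv /=; congr h.
by apply: chart_invK; exact: (subdomain_dom (WY _ (coordK iv).1)).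
Qed.

End ChartCalculus.

Section ChainRuleCharts.
Variables (R : realType) (n k : nat) (M N : topologicalType).
Variables (x : chart R n M) (y : chart R k N).
Variables (W : subdomain x) (Y : subdomain y) (phi : M -> N) (h : N -> R).
Hypothesis WY : forall p, W p -> Y (phi p).
Hypothesis sphi : forall a, smooth_in x W (fun p => Defs.coord y (phi p) 0 a).
Hypothesis sh : smooth_in y Y h.

Lemma pd_chain p i : W p ->
  pd x i (h \o phi) p =
  \sum_b pd x i (fun q => Defs.coord y (phi q) 0 b) p * pd y b h (phi p).
Proof.
move=> Wp; have ip := image_subdomain Wp; have oi := @image_subdomain_open _ _ _ _ W.
have Yp := WY Wp; have iY := image_subdomain Yp; 
have oY := @image_subdomain_open _ _ _ _ Y.
have yp := subdomain_dom Yp; have xp := subdomain_dom Wp.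
pose psi := (fun q => Defs.coord y (phi q)) \o chart_inv x.
have psip : psi (Defs.coord x p) = Defs.coord y (phi p) by rewrite /psi /= chart_invK.
transitivity (partial i ((h \o chart_inv y) \o psi) (Defs.coord x p)).
  apply: (partial_ext i oi ip) => w [q [Wq xq] <-] /=.
  by rewrite /psi /= (chart_invK xq) (chart_invK (subdomain_dom (WY Wq))).
have Yv : (Defs.coord y @` (Y `&` chart_dom y)) (psi (Defs.coord x p)).
  by rewrite psip.
have dpsi b : derivable (fun w => psi w 0 b) (Defs.coord x p) (delta_mx 0 i).
  exact: smooth_on_derivable (sphi b) ip.
by rewrite (partial_chain oY Yv sh dpsi).2 psip.
Qed.

End ChainRuleCharts.

(* Sealed, because a failing comparison of two derivatives would unfold them
   down to limits of difference quotients. *)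
HB.lock Definition pdm (R : realType) (n : nat) (M : topologicalType)
    (x : chart R n M) a b (i : 'I_n) (T : M -> 'M[R]_(a, b)) (p : M) : 'M[R]_(a, b) :=
  \matrix_(k, l) pd x i (fun q => T q k l) p.
Arguments pdm {R n M} x {a b} i T p.

(** * Calculus of matrix-valued fields *)

Section MatrixCalculus.
Variables (R : realType) (n : nat) (M : topologicalType) (x : chart R n M).
Variable W : subdomain x.
Implicit Types (p q : M) (i j : 'I_n) (u : M -> R).

Definition smooth_mx a b (T : M -> 'M[R]_(a, b)) :=
  forall k l, smooth_in x W (fun p => T p k l).

Lemma pdmE a b i (T : M -> 'M[R]_(a, b)) p k l :
  pdm x i T p k l = pd x i (fun q => T q k l) p.
Proof. by rewrite pdm.unlock mxE. Qed.

Lemma pdm_ext a b (S T : M -> 'M[R]_(a, b)) i p :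
  (forall q, W q -> S q = T q) -> W p -> pdm x i S p = pdm x i T p.
Proof.
move=> ST Wp; apply/matrixP => k l; rewrite !(pdmE, mxE).
by apply: (pd_ext i _ Wp) => q /ST ->.
Qed.

Lemma smooth_mx_ext a b (S T : M -> 'M[R]_(a, b)) :
  (forall q, W q -> S q = T q) -> smooth_mx S -> smooth_mx T.
Proof. by move=> ST sS k l; apply: smooth_in_ext (sS k l) => q /ST ->. Qed.

Lemma smooth_mx_pdm a b (T : M -> 'M[R]_(a, b)) i :
  smooth_mx T -> smooth_mx (pdm x i T).
Proof.
move=> sT k l; apply: smooth_in_ext (smooth_in_pd i (sT k l)) => q _.
by rewrite pdmE.
Qed.

Lemma smooth_mx_cst a b (T : 'M[R]_(a, b)) : smooth_mx (fun=> T).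
Proof. by move=> k l; exact: smooth_in_cst. Qed.

Lemma pdm_cst a b (T : 'M[R]_(a, b)) i p : pdm x i (fun=> T) p = 0.
Proof. by apply/matrixP => k l; rewrite pdmE pd_cst mxE. Qed.

Lemma smooth_mxD a b (S T : M -> 'M[R]_(a, b)) :
  smooth_mx S -> smooth_mx T -> smooth_mx (fun p => S p + T p).
Proof.
move=> sS sT k l; apply: smooth_in_ext (smooth_inD (sS k l) (sT k l)) => q _.
by rewrite mxE.
Qed.

Lemma pdmD a b (S T : M -> 'M[R]_(a, b)) i p : smooth_mx S -> smooth_mx T ->
  W p -> pdm x i (fun q => S q + T q) p = pdm x i S p + pdm x i T p.
Proof.
move=> sS sT Wp; apply/matrixP => k l; rewrite !(pdmE, mxE).
rewrite -(pdD i (sS k l) (sT k l) Wp); apply: (pd_ext i _ Wp) => q _.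
by rewrite mxE.
Qed.

Lemma smooth_mxN a b (T : M -> 'M[R]_(a, b)) :
  smooth_mx T -> smooth_mx (fun p => - T p).
Proof.
move=> sT k l; apply: smooth_in_ext (smooth_inN (sT k l)) => q _.
by rewrite mxE.
Qed.

Lemma pdmN a b (T : M -> 'M[R]_(a, b)) i p : smooth_mx T ->
  W p -> pdm x i (fun q => - T q) p = - pdm x i T p.
Proof.
move=> sT Wp; apply/matrixP => k l; rewrite !(pdmE, mxE).
rewrite -(pdN i (sT k l) Wp); apply: (pd_ext i _ Wp) => q _.
by rewrite mxE.
Qed.

Lemma smooth_mxB a b (S T : M -> 'M[R]_(a, b)) :
  smooth_mx S -> smooth_mx T -> smooth_mx (fun p => S p - T p).
Proof. by move=> sS sT; exact: smooth_mxD sS (smooth_mxN sT). Qed.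

Lemma pdmB a b (S T : M -> 'M[R]_(a, b)) i p : smooth_mx S -> smooth_mx T ->
  W p -> pdm x i (fun q => S q - T q) p = pdm x i S p - pdm x i T p.
Proof.
by move=> sS sT Wp; rewrite (pdmD i sS (smooth_mxN sT) Wp) (pdmN i sT Wp).
Qed.

Lemma smooth_mxM a b c (S : M -> 'M[R]_(a, b)) (T : M -> 'M[R]_(b, c)) :
  smooth_mx S -> smooth_mx T -> smooth_mx (fun p => S p *m T p).
Proof.
move=> sS sT k l.
have s e : smooth_in x W (fun q => S q k e * T q e l) by exact: smooth_inM.
by apply: smooth_in_ext (smooth_in_sum (index_enum _) s) => q _; rewrite mxE.
Qed.

Lemma pdmM a b c (S : M -> 'M[R]_(a, b)) (T : M -> 'M[R]_(b, c)) i p :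
  smooth_mx S -> smooth_mx T -> W p ->
  pdm x i (fun q => S q *m T q) p = pdm x i S p *m T p + S p *m pdm x i T p.
Proof.
move=> sS sT Wp; apply/matrixP => k l; rewrite !(pdmE, mxE).
have s e : smooth_in x W (fun q => S q k e * T q e l) by exact: smooth_inM.
rewrite -big_split /=.
transitivity (pd x i (fun q => \sum_e S q k e * T q e l) p).
  by apply: (pd_ext i _ Wp) => q _; rewrite mxE.
rewrite (pd_sum _ _ s Wp); apply: eq_bigr => e _.
by rewrite (pdM i (sS k e) (sT e l) Wp) !pdmE.
Qed.

Lemma smooth_mxZ a b u (T : M -> 'M[R]_(a, b)) :
  smooth_in x W u -> smooth_mx T -> smooth_mx (fun p => u p *: T p).
Proof.
move=> su sT k l; apply: smooth_in_ext (smooth_inM su (sT k l)) => q _.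
by rewrite mxE.
Qed.

Lemma pdmZ a b u (T : M -> 'M[R]_(a, b)) i p :
  smooth_in x W u -> smooth_mx T -> W p ->
  pdm x i (fun q => u q *: T q) p = pd x i u p *: T p + u p *: pdm x i T p.
Proof.
move=> su sT Wp; apply/matrixP => k l; rewrite !(pdmE, mxE).
rewrite -(pdM i su (sT k l) Wp); apply: (pd_ext i _ Wp) => q _.
by rewrite mxE.
Qed.

Lemma smooth_mx_sum a b (I : Type) (r : seq I) (T : I -> M -> 'M[R]_(a, b)) :
  (forall e, smooth_mx (T e)) -> smooth_mx (fun p => \sum_(e <- r) T e p).
Proof.
move=> sT k l; apply: smooth_in_ext (smooth_in_sum r (fun e => sT e k l)) => q _.
by rewrite summxE.
Qed.

Lemma pdm_sum a b (I : Type) (r : seq I) (T : I -> M -> 'M[R]_(a, b)) i p :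
  (forall e, smooth_mx (T e)) -> W p ->
  pdm x i (fun q => \sum_(e <- r) T e q) p = \sum_(e <- r) pdm x i (T e) p.
Proof.
move=> sT Wp; apply/matrixP => k l; rewrite pdmE summxE.
transitivity (pd x i (fun q => \sum_(e <- r) T e q k l) p).
  by apply: (pd_ext i _ Wp) => q _; rewrite summxE.
rewrite (pd_sum _ _ (fun e => sT e k l) Wp); apply: eq_bigr => e _.
by rewrite pdmE.
Qed.

Lemma smooth_mx_tr a b (T : M -> 'M[R]_(a, b)) :
  smooth_mx T -> smooth_mx (fun p => (T p)^T).
Proof. by move=> sT k l; apply: smooth_in_ext (sT l k) => q _; rewrite mxE. Qed.

Lemma pdm_tr a b (T : M -> 'M[R]_(a, b)) i p :
  pdm x i (fun q => (T q)^T) p = (pdm x i T p)^T.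
Proof.
apply/matrixP => k l; rewrite !(pdmE, mxE).
by congr pd; apply/funext => q; rewrite mxE.
Qed.

Lemma smooth_mx_row a b (T : M -> 'M[R]_(a, b)) k :
  smooth_mx T -> smooth_mx (fun p => row k (T p)).
Proof. by move=> sT e l; apply: smooth_in_ext (sT k l) => q _; rewrite mxE. Qed.

Lemma pdm_row a b (T : M -> 'M[R]_(a, b)) i k p :
  pdm x i (fun q => row k (T q)) p = row k (pdm x i T p).
Proof.
apply/matrixP => e l; rewrite !(pdmE, mxE).
by congr pd; apply/funext => q; rewrite mxE.
Qed.

Lemma smooth_in_trace a (T : M -> 'M[R]_a) :
  smooth_mx T -> smooth_in x W (fun p => \tr (T p)).
Proof. by move=> sT; apply: smooth_in_sum => k; exact: sT. Qed.

Lemma pd_trace a (T : M -> 'M[R]_a) i p : smooth_mx T -> W p ->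
  pd x i (fun q => \tr (T q)) p = \tr (pdm x i T p).
Proof.
move=> sT Wp; rewrite /mxtrace (pd_sum _ _ (fun k => sT k k) Wp).
by apply: eq_bigr => k _; rewrite pdmE.
Qed.

Lemma pdmC a b (T : M -> 'M[R]_(a, b)) i j p : smooth_mx T -> W p ->
  pdm x i (pdm x j T) p = pdm x j (pdm x i T) p.
Proof.
have e i' j' : pdm x i' (pdm x j' T) p = \matrix_(k, l) pd x i' (pd x j' (fun q => T q k l)) p.
  apply/matrixP => k l; rewrite !(pdmE, mxE).
  suff -> : (fun q => pdm x j' T q k l) = pd x j' (fun q => T q k l) by [].
  by apply/funext => q; rewrite pdmE.
move=> sT Wp; rewrite (e i j) (e j i); apply: eq_mx => k l.
exact: (pdC i j (sT k l) Wp).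
Qed.

Lemma smooth_in_det a (T : M -> 'M[R]_a) :
  smooth_mx T -> smooth_in x W (fun p => \det (T p)).
Proof.
move=> sT.
have sm (s : 'S_a) :
    smooth_in x W (fun p => ((-1) ^+ odd_perm s : R) * \prod_(k < a) T p k (s k)).
  have sp := smooth_in_prod (index_enum 'I_a) (fun k => sT k (s k)).
  exact: smooth_inM (smooth_in_cst ((-1) ^+ odd_perm s)) sp.
exact: (smooth_in_sum (index_enum _) sm).
Qed.

(** Cramer's rule: the entries are cofactors divided by the determinant, both polynomial in the
    entries of [T]. *)
Lemma smooth_mx_invmx a (T : M -> 'M[R]_a) : smooth_mx T ->
  (forall p, W p -> T p \in unitmx) -> smooth_mx (fun p => invmx (T p)).
Proof.
move=> sT uT k l.
have sd : smooth_in x W (fun p => (\det (T p))^-1).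
  apply: smooth_inV; first exact: smooth_in_det.
  by move=> q /uT; rewrite unitmxE unitfE.
have sm : smooth_mx (fun p => row' l (col' k (T p))).
  move=> e f; apply: smooth_in_ext (sT (lift l e) (lift k f)) => q _.
  by rewrite !(pdmE, mxE).
have sc : smooth_in x W (fun p => cofactor (T p) l k).
  exact: smooth_inM (smooth_in_cst ((-1) ^+ (l + k))) (smooth_in_det sm).
apply: smooth_in_ext (smooth_inM sd sc) => q Wq.
by rewrite /invmx uT // !mxE.
Qed.

(** Obtained by differentiating [invmx (T q) *m T q = 1]. *)
Lemma pdm_invmx a (T : M -> 'M[R]_a) i p : smooth_mx T ->
  (forall q, W q -> T q \in unitmx) -> W p ->
  pdm x i (fun q => invmx (T q)) p = - (invmx (T p) *m pdm x i T p *m invmx (T p)).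
Proof.
move=> sT uT Wp; have sI := smooth_mx_invmx sT uT.
have : pdm x i (fun q => invmx (T q) *m T q) p = 0.
  by rewrite -(pdm_cst 1%:M i p); apply: pdm_ext => // q Wq; rewrite mulVmx ?uT.
rewrite (pdmM i sI sT Wp) => /eqP; rewrite addr_eq0 => /eqP e.
by rewrite -[LHS](mulmxK (uT _ Wp)) e mulNmx.
Qed.

End MatrixCalculus.

(** * The Levi-Civita connection in matrix form *)

(* The library's rules, restated so that all products they create carry
   syntactically the same ring instance. *)
Section RealMatrixRules.
Variables (R : realType) (a b c d : nat).
Implicit Types (S : 'M[R]_(a, b)) (T : 'M[R]_(b, c)) (U : 'M[R]_(c, d)).

Lemma rmulmxDl S S' T : (S + S') *m T = S *m T + S' *m T.
Proof. exact: mulmxDl. Qed.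
Lemma rmulmxDr S T T' : S *m (T + T') = S *m T + S *m T'.
Proof. exact: mulmxDr. Qed.
Lemma rmulmxBl S S' T : (S - S') *m T = S *m T - S' *m T.
Proof. exact: mulmxBl. Qed.
Lemma rmulmxBr S T T' : S *m (T - T') = S *m T - S *m T'.
Proof. exact: mulmxBr. Qed.
Lemma rmulNmx S T : - S *m T = - (S *m T).
Proof. exact: mulNmx. Qed.
Lemma rmulmxN S T : S *m - T = - (S *m T).
Proof. exact: mulmxN. Qed.
Lemma rmulZmx k S T : (k *: S) *m T = k *: (S *m T).
Proof. exact/esym/scalemxAl. Qed.
Lemma rmulmxZ k S T : S *m (k *: T) = k *: (S *m T).
Proof. exact/esym/scalemxAr. Qed.
Lemma rmulmxA S T U : S *m (T *m U) = S *m T *m U.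
Proof. exact: mulmxA. Qed.
Lemma trmxM S T : (S *m T)^T = T^T *m S^T.
Proof. exact: trmx_mul. Qed.

End RealMatrixRules.

Definition rmulmxE := (rmulmxDl, rmulmxDr, rmulmxBl, rmulmxBr, rmulNmx, rmulmxN,
  rmulZmx, rmulmxZ, rmulmxA).

(* Proves identities between sums of matrix products: once distributed, each
   product is an atom and the identity holds entrywise. *)
Ltac mx_atoms e :=
  lazymatch e with
  | (?a + ?b)%R => mx_atoms a; mx_atoms b
  | (- ?a)%R => mx_atoms a
  | (_ *: ?a)%R => mx_atoms a
  | (0)%R => idtac
  | ?a => tryif is_var a then idtac else (let X := fresh in set X := a; clearbody X)
  end.

Ltac mx_abel :=
  rewrite ?rmulmxE;
  repeat match goal with |- ?l = ?r => progress (mx_atoms l; mx_atoms r) end;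
  apply/matrixP => ? ?; rewrite !mxE; ring.

Section MatrixAdditivity.
Variables (R : pzRingType) (a b : nat).
Implicit Types (S T : 'M[R]_(a, b)).

Lemma trmxD S T : (S + T)^T = S^T + T^T. Proof. exact: linearD. Qed.
Lemma trmxN T : (- T)^T = - T^T. Proof. exact: linearN. Qed.
Lemma trmxB S T : (S - T)^T = S^T - T^T. Proof. exact: linearB. Qed.
Lemma trmxZ (k : R) T : (k *: T)^T = k *: T^T. Proof. exact: linearZ. Qed.
Lemma rowmxD k S T : row k (S + T) = row k S + row k T. Proof. exact: linearD. Qed.
Lemma rowmxN k T : row k (- T) = - row k T. Proof. exact: linearN. Qed.
Lemma rowmxB k S T : row k (S - T) = row k S - row k T. Proof. exact: linearB. Qed.

End MatrixAdditivity.

(** The connection matrix: row [j] is the derivative of the [j]-th coordinate field along the [i]-th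
    one. Since vectors are rows, it acts on components from the right. *)
HB.lock Definition christoffel_mx (R : realType) (n : nat) (M : riemannian R n)
    (x : chart R n M) (i : 'I_n) (p : M) : 'M[R]_n := \matrix_j christoffel x p i j.
Arguments christoffel_mx {R n M} x i p.

HB.lock Definition differential (R : realType) (n : nat) (M : topologicalType)
    (x : chart R n M) (h : M -> R) (p : M) : 'rV[R]_n := \row_i pd x i h p.
Arguments differential {R n M} x h p.

Lemma differentialE (R : realType) (n : nat) (M : topologicalType)
    (x : chart R n M) h p k i : differential x h p k i = pd x i h p.
Proof. by rewrite differential.unlock mxE. Qed.

Section LeviCivitaMatrix.
Variables (R : realType) (n : nat) (M : riemannian R n) (x : chart R n M).
Hypothesis x_atlas : atlas x.
Variable W : subdomain x.
Implicit Types (p q : M) (i j k : 'I_n) (u v w : 'rV[R]_n) (V : M -> 'rV[R]_n).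

Definition cov i V p : 'rV[R]_n := pdm x i V p + V p *m christoffel_mx x i p.

(** The sign of the commutator is dictated by the right action: it makes the Leibniz rule hold for
    [V *m T], as [cov_mul] shows. *)
Definition cov_op i (T : M -> 'M[R]_n) p : 'M[R]_n :=
  pdm x i T p + T p *m christoffel_mx x i p - christoffel_mx x i p *m T p.

(** The curvature operator of the [i]-th and [j]-th coordinate fields, acting on rows; the right
    action reverses the usual order of the quadratic terms. *)
Definition riemann i j p : 'M[R]_n :=
  pdm x i (christoffel_mx x j) p - pdm x j (christoffel_mx x i) p
  + christoffel_mx x j p *m christoffel_mx x i p
  - christoffel_mx x i p *m christoffel_mx x j p.

Lemma row_christoffel p i j : row j (christoffel_mx x i p) = christoffel x p i j.
Proof. by rewrite christoffel_mx.unlock rowK. Qed.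

Lemma christoffel_mxE p i j k : christoffel_mx x i p j k = christoffel x p i j 0 k.
Proof. by rewrite christoffel_mx.unlock mxE. Qed.

Let dom p : W p -> chart_dom x p. Proof. exact: subdomain_dom. Qed.

Lemma smooth_gram : smooth_mx W (gram x).
Proof.
move=> i j; apply: smooth_on_subset (gram_smooth x_atlas i j).
by move=> _ [q [_ xq] <-]; exists q.
Qed.

Lemma gram_unit p : W p -> gram x p \in unitmx.
Proof.
move=> Wp; rewrite -row_free_unit -kermx_eq0; apply/rowV0P => u /sub_kermxP uG.
apply/eqP; apply: contraT => /(gram_posdef x_atlas (dom Wp)).
by rewrite uG mul0mx mxE ltxx.
Qed.

Lemma gram_tr p : W p -> (gram x p)^T = gram x p.
Proof. by move=> Wp; exact: gram_sym x_atlas (dom Wp). Qed.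

Lemma gramC p i j : W p -> gram x p i j = gram x p j i.
Proof. by move=> Wp; rewrite -[in LHS](gram_tr Wp) mxE. Qed.

Lemma pd_gramC p i j k : W p ->
  pd x k (fun q => gram x q i j) p = pd x k (fun q => gram x q j i) p.
Proof. by move=> Wp; apply: (pd_ext k _ Wp) => q Wq; exact: gramC. Qed.

Lemma smooth_invgram : smooth_mx W (fun p => invmx (gram x p)).
Proof. exact: smooth_mx_invmx smooth_gram gram_unit. Qed.

Lemma christoffel_gram p i j k : W p ->
  (christoffel_mx x i p *m gram x p) j k =
  2^-1 * (pd x i (fun q => gram x q j k) p + pd x j (fun q => gram x q i k) p
          - pd x k (fun q => gram x q i j) p).
Proof.
move=> Wp; transitivity ((row j (christoffel_mx x i p *m gram x p)) 0 k); first by rewrite [RHS]mxE.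
rewrite row_mul row_christoffel /christoffel -scalemxAl mulmxKV ?gram_unit //.
by rewrite !mxE.
Qed.

(** Compatibility of the connection with the metric: symmetrising the Koszul formula
    [christoffel_gram] leaves a single derivative of the metric. *)
Lemma pdm_gram p i : W p ->
  pdm x i (gram x) p
  = christoffel_mx x i p *m gram x p + gram x p *m (christoffel_mx x i p)^T.
Proof.
move=> Wp; rewrite -{2}(gram_tr Wp) -trmxM; apply/matrixP => j k.
rewrite pdmE [in RHS]mxE [X in _ + X]mxE !christoffel_gram //.
by rewrite (pd_gramC k j i Wp); field.
Qed.

Lemma christoffelC p i j : W p -> christoffel x p i j = christoffel x p j i.
Proof.
move=> Wp.
have e : \row_l (pd x i (fun q => gram x q j l) p + pd x j (fun q => gram x q i l) p
             - pd x l (fun q => gram x q i j) p)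
       = \row_l (pd x j (fun q => gram x q i l) p + pd x i (fun q => gram x q j l) p
             - pd x l (fun q => gram x q j i) p).
  by apply: eq_mx => _ l; rewrite (pd_gramC i j l Wp) (addrC (pd x i _ p)).
by rewrite /christoffel e.
Qed.

Lemma row_christoffel_mx p i j : W p ->
  row j (christoffel_mx x i p) = row i (christoffel_mx x j p).
Proof. by move=> Wp; rewrite !row_christoffel; exact: christoffelC. Qed.

Lemma christoffel_mxC p i j k : W p ->
  christoffel_mx x i p j k = christoffel_mx x j p i k.
Proof. by move=> Wp; rewrite !christoffel_mxE (christoffelC i j Wp). Qed.

Lemma smooth_christoffel i : smooth_mx W (christoffel_mx x i).
Proof.
have sG j k l : smooth_in x W (pd x l (fun q => gram x q j k)).
  by apply: smooth_in_pd; exact: smooth_gram.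
pose B q : 'M[R]_n := \matrix_(j, k) (2^-1 *
  (pd x i (fun q => gram x q j k) q + pd x j (fun q => gram x q i k) q
          - pd x k (fun q => gram x q i j) q)).
have sB : smooth_mx W B.
  move=> j k.
  have s := smooth_inM (smooth_in_cst 2^-1)
    (smooth_inD (smooth_inD (sG j k i) (sG i k j)) (smooth_inN (sG i j k))).
  by apply: smooth_in_ext s => q _; rewrite mxE.
apply: smooth_mx_ext (smooth_mxM sB smooth_invgram) => q Wq.
rewrite -[RHS](mulmxK (gram_unit Wq)); congr (_ *m _).
by apply/matrixP => j k; rewrite christoffel_gram // mxE.
Qed.

Lemma smooth_cov_op i (T : M -> 'M[R]_n) : smooth_mx W T -> smooth_mx W (cov_op i T).
Proof.
move=> sT; have sC := smooth_christoffel i.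
exact: smooth_mxB (smooth_mxD (smooth_mx_pdm i sT) (smooth_mxM sT sC)) (smooth_mxM sC sT).
Qed.

Lemma smooth_differential (h : M -> R) : smooth_in x W h -> smooth_mx W (differential x h).
Proof.
by move=> sh k i; apply: smooth_in_ext (smooth_in_pd i sh) => q _; rewrite differentialE.
Qed.

Lemma nablaE X V p : nabla x X V p = \sum_i X p 0 i *: cov i V p.
Proof.
apply: eq_bigr => i _; rewrite /cov.
suff -> : pdv x i V p = pdm x i V p.
  by rewrite mulmx_sum_row; congr (_ *: (_ + _)); apply: eq_bigr => j _; rewrite row_christoffel.
by apply/rowP => a; rewrite pdmE mxE.
Qed.

Lemma nabla_coord i V p : nabla x (@coord_field R n M i) V p = cov i V p.
Proof.
rewrite nablaE (bigD1 i) //= big1 => [|j ji]; rewrite /coord_field mxE !eqxx /=.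
  by rewrite scale1r addr0.
by rewrite (negbTE ji) scale0r.
Qed.

Lemma nabla_opE (T : M -> 'M[R]_n) i j p : smooth_mx W T -> W p ->
  nabla_op x T (@coord_field R n M i) (@coord_field R n M j) p
  = row j (cov_op i T p).
Proof.
move=> sT Wp; rewrite /nabla_op !nabla_coord /cov /cov_op.
have sj : smooth_mx W (@coord_field R n M j) by exact: smooth_mx_cst.
rewrite (pdmM i sj sT Wp) /coord_field pdm_cst mul0mx !add0r.
by rewrite !rowE mulmxBr mulmxDr !mulmxA.
Qed.

Lemma divergenceE V p : W p ->
  divergence x V p
  = \sum_i (pdm x i V p 0 i + \tr (christoffel_mx x i p) * V p 0 i).
Proof.
move=> Wp; rewrite /divergence big_split /=.
transitivity (\sum_i (pdm x i V p 0 i + (V p *m christoffel_mx x i p) 0 i)).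
  by apply: eq_bigr => i _; rewrite nabla_coord /cov mxE.
rewrite big_split /=; congr (_ + _).
under eq_bigr do rewrite mxE.
rewrite exchange_big; apply: eq_bigr => i _ /=.
rewrite -mulr_sumr mulrC; congr (_ * _).
by apply: eq_bigr => j _; exact: christoffel_mxC.
Qed.

Lemma curvatureE u v w p : W p ->
  curvature x p u v w = \sum_i \sum_j (u 0 i * v 0 j) *: (w *m riemann i j p).
Proof.
move=> Wp.
have n1 a q : nabla x (fun=> a) (fun=> w) q
    = \sum_i a 0 i *: (w *m christoffel_mx x i q).
  rewrite nablaE; apply: eq_bigr => i _.
  by rewrite /cov pdm_cst add0r.
have sw i : smooth_mx W (fun q => w *m christoffel_mx x i q).
  exact: smooth_mxM (smooth_mx_cst w) (smooth_christoffel i).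
have sz a i : smooth_mx W (fun q => a *: (w *m christoffel_mx x i q)).
  exact: smooth_mxZ (smooth_in_cst a) (sw i).
have n2 a b : nabla x (fun=> a) (nabla x (fun=> b) (fun=> w)) p =
    \sum_i \sum_j (a 0 i * b 0 j) *: (w *m (pdm x i (christoffel_mx x j) p
       + christoffel_mx x j p *m christoffel_mx x i p)).
  rewrite nablaE; apply: eq_bigr => i _; rewrite /cov n1.
  rewrite (pdm_ext i (fun q _ => n1 b q) Wp).
  rewrite (pdm_sum _ i (fun j => sz (b 0 j) j) Wp) mulmx_suml -big_split /=.
  rewrite scaler_sumr; apply: eq_bigr => j _.
  rewrite (pdmZ i (smooth_in_cst _) (sw j) Wp) pd_cst scale0r add0r.
  rewrite (pdmM i (smooth_mx_cst w) (smooth_christoffel j) Wp) pdm_cst mul0mx add0r.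
  by rewrite -scalemxAl -scalerDr scalerA mulmxDr mulmxA.
have n3 X : X p = 0 -> nabla x X (fun=> w) p = 0.
  by move=> X0; rewrite nablaE big1 // => i _; rewrite X0 mxE scale0r.
have lie0 : lie_bracket x (fun=> u) (fun=> v) p = 0.
  apply: big1 => i _; have z a : pdv x i (fun=> a) p = 0 :> 'rV[R]_n.
    by apply/rowP => b; rewrite !mxE pd_cst.
  by rewrite !z !scaler0 subr0.
rewrite /curvature /curvature_field !n2 n3 // subr0.
rewrite [X in _ - X]exchange_big -sumrB; apply: eq_bigr => i _.
rewrite -sumrB; apply: eq_bigr => j _.
rewrite [v 0 j * _]mulrC -scalerBr -mulmxBr; congr (_ *: (_ *m _)).
by rewrite /riemann; mx_abel.
Qed.

Lemma riemannN i j p : riemann j i p = - riemann i j p.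
Proof. by rewrite /riemann; mx_abel. Qed.

(** The integrability condition of [pdm_gram]: equality of the mixed second derivatives of the
    metric makes curvature operators skew-adjoint. *)
Lemma riemann_gram i j p : W p ->
  riemann i j p *m gram x p + gram x p *m (riemann i j p)^T = 0.
Proof.
move=> Wp; have sG := smooth_gram; have sC := smooth_christoffel.
have e a b : pdm x a (pdm x b (gram x)) p =
    pdm x a (christoffel_mx x b) p *m gram x p
    + christoffel_mx x b p *m pdm x a (gram x) p
    + (pdm x a (gram x) p *m (christoffel_mx x b p)^T
    + gram x p *m (pdm x a (christoffel_mx x b) p)^T).
  rewrite (pdm_ext a (fun q Wq => pdm_gram b Wq) Wp).
  rewrite (pdmD a (smooth_mxM (sC b) sG) (smooth_mxM sG (smooth_mx_tr (sC b))) Wp).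
  rewrite (pdmM a (sC b) sG Wp) (pdmM a sG (smooth_mx_tr (sC b)) Wp).
  by rewrite pdm_tr.
have := pdmC i j sG Wp; rewrite !e (pdm_gram i Wp) (pdm_gram j Wp) => /eqP.
rewrite -subr_eq0 => /eqP <-.
by rewrite /riemann !trmxB !trmxD !trmxN !trmxM; mx_abel.
Qed.

Lemma pdm_christoffelC i j k p : W p ->
  row k (pdm x i (christoffel_mx x j) p) = row j (pdm x i (christoffel_mx x k) p).
Proof.
move=> Wp; rewrite -!pdm_row; apply: (pdm_ext i _ Wp) => q Wq.
exact: row_christoffel_mx.
Qed.

(** The first Bianchi identity, a consequence of the symmetry of the Christoffel symbols and of that
    of their derivatives. *)
Lemma riemann_bianchi i j k p : W p ->
  row k (riemann i j p) + row i (riemann j k p) + row j (riemann k i p) = 0.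
Proof.
move=> Wp; rewrite /riemann !rowmxB !rowmxD !rowmxN !row_mul.
rewrite (pdm_christoffelC i j k Wp) (pdm_christoffelC j i k Wp).
rewrite (pdm_christoffelC k i j Wp).
rewrite (row_christoffel_mx i k Wp) (row_christoffel_mx j k Wp).
by rewrite (row_christoffel_mx i j Wp); mx_abel.
Qed.

(** The derivative index of [cov_op] is treated as a mere label. The Christoffel term it would
    contribute to a second covariant derivative is symmetric in [i] and [j], so the commutator is
    the same. *)
Lemma ricci_identity (T : M -> 'M[R]_n) i j p : smooth_mx W T -> W p ->
  pdm x i (cov_op j T) p + cov_op j T p *m christoffel_mx x i p
    - christoffel_mx x i p *m cov_op j T p
  - (pdm x j (cov_op i T) p + cov_op i T p *m christoffel_mx x j p
    - christoffel_mx x j p *m cov_op i T p)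
  = T p *m riemann i j p - riemann i j p *m T p.
Proof.
move=> sT Wp; have sC := smooth_christoffel.
have e a b : pdm x a (cov_op b T) p = pdm x a (pdm x b T) p
   + (pdm x a T p *m christoffel_mx x b p + T p *m pdm x a (christoffel_mx x b) p)
   - (pdm x a (christoffel_mx x b) p *m T p + christoffel_mx x b p *m pdm x a T p).
  rewrite (pdmB a (smooth_mxD (smooth_mx_pdm b sT) (smooth_mxM sT (sC b)))
    (smooth_mxM (sC b) sT) Wp).
  rewrite (pdmD a (smooth_mx_pdm b sT) (smooth_mxM sT (sC b)) Wp).
  by rewrite (pdmM a sT (sC b) Wp) (pdmM a (sC b) sT Wp).
by rewrite !e (pdmC j i sT Wp) /cov_op /riemann; mx_abel.
Qed.

End LeviCivitaMatrix.

(** * Curvature of space forms *)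

(** Polarisation in the outer arguments, then in the inner ones, makes [E] alternating in its second
    and third arguments as well; the Bianchi identity then reads [3 E = 0]. Additivity suffices for
    this. *)
Lemma curvature_like_eq0 (R : realFieldType) (V : zmodType)
    (E : V -> V -> V -> V -> R) :
  (forall u u' v w z, E (u + u') v w z = E u v w z + E u' v w z) ->
  (forall u v w z, E v u w z = - E u v w z) ->
  (forall u v w z, E u v z w = - E u v w z) ->
  (forall u v w z, E u v w z + E v w u z + E w u v z = 0) ->
  (forall u v, E u v v u = 0) ->
  forall u v w z, E u v w z = 0.
Proof.
move=> E1D E12 E34 EB E0.
(* Pair symmetry is a linear consequence of the Bianchi identity at the four cyclic shifts of the
   arguments. *)
have pair u v w z : E u v w z = E w z u v.
  have := EB u v w z; have := EB v w z u; have := EB w z u v; have := EB z u v w.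
  rewrite ?(E34 _ _ u v) ?(E34 _ _ u w) ?(E34 _ _ u z) ?(E34 _ _ v w).
  rewrite ?(E34 _ _ v z) ?(E34 _ _ w z).
  rewrite ?(E12 u v) ?(E12 u w) ?(E12 u z) ?(E12 v w) ?(E12 v z) ?(E12 w z).
  by move=> *; lra.
have E2D u v v' w z : E u (v + v') w z = E u v w z + E u v' w z.
  by rewrite E12 E1D (E12 u v) (E12 u v') opprD !opprK.
have E3D u v w w' z : E u v (w + w') z = E u v w z + E u v w' z.
  by rewrite pair E1D -!(pair u v).
have E4D u v w z z' : E u v w (z + z') = E u v w z + E u v w z'.
  by rewrite E34 E3D (E34 _ _ w z) (E34 _ _ w z') opprD !opprK.
have E23 u v z : E u v v z = 0.
  have := E0 (u + z) v; rewrite E1D !E4D !E0 add0r addr0.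
  have -> : E z v v u = E u v v z by rewrite pair E12 E34 opprK.
  by move=> ?; lra.
have alt u v w z : E u w v z = - E u v w z.
  by have := E23 u (v + w) z; rewrite E2D !E3D !E23 add0r addr0 => ?; lra.
move=> u v w z; have := EB u v w z.
rewrite (alt v u w) (E12 u v) (E12 u w) (alt u v w) !opprK => ?; lra.
Qed.

Section ConstantCurvature.
Variables (R : realType) (n : nat) (c : R) (N : riemannian R n).
Hypothesis N_space_form : space_form c N.
Variable y : chart R n N.
Hypothesis y_atlas : atlas y.
Variable Y : subdomain y.
Implicit Types (u v w z : 'rV[R]_n) (p : N).

Let e (i : 'I_n) : 'rV[R]_n := delta_mx 0 i.
Let dom p : Y p -> chart_dom y p. Proof. exact: subdomain_dom. Qed.

Lemma innerDl p u u' v : inner y p (u + u') v = inner y p u v + inner y p u' v.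
Proof. by rewrite /inner !mulmxDl mxE. Qed.

Lemma innerZl p k u v : inner y p (k *: u) v = k * inner y p u v.
Proof. by rewrite /inner -!scalemxAl mxE. Qed.

Lemma innerDr p u v v' : inner y p u (v + v') = inner y p u v + inner y p u v'.
Proof. by rewrite /inner trmxD mulmxDr mxE. Qed.

Lemma innerZr p k u v : inner y p u (k *: v) = k * inner y p u v.
Proof. by rewrite /inner linearZ -scalemxAr mxE. Qed.

Lemma innerNl p u v : inner y p (- u) v = - inner y p u v.
Proof. by rewrite -scaleN1r innerZl mulN1r. Qed.

Lemma innerNr p u v : inner y p u (- v) = - inner y p u v.
Proof. by rewrite -scaleN1r innerZr mulN1r. Qed.

Lemma inner0l p u : inner y p 0 u = 0.
Proof. by rewrite /inner !mul0mx mxE. Qed.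

Lemma inner0r p u : inner y p u 0 = 0.
Proof. by rewrite /inner trmx0 mulmx0 mxE. Qed.

Definition innerE := (innerDl, innerDr, innerZl, innerZr, innerNl, innerNr, inner0l, inner0r).

Lemma innerC p u v : Y p -> inner y p u v = inner y p v u.
Proof.
move=> Yp; rewrite /inner -[in LHS](gram_tr y_atlas Yp) -[u in LHS]trmxK.
by rewrite -!trmx_mul mulmxA mxE.
Qed.

Lemma inner_gt0 p u : Y p -> u != 0 -> 0 < inner y p u u.
Proof. by move=> Yp u0; exact: (@gram_posdef _ _ N y p y_atlas (dom Yp) u u0). Qed.

Lemma inner_eq0 p u : Y p -> (forall v, inner y p u v = 0) -> u = 0.
Proof.
move=> Yp u0; apply/eqP; apply: contraT => /(inner_gt0 Yp).
by rewrite u0 ltxx.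
Qed.

Definition riemann_op u v p : 'M[R]_n :=
  \sum_i \sum_j (u 0 i * v 0 j) *: riemann y i j p.

Lemma curvature_op u v w p : Y p -> curvature y p u v w = w *m riemann_op u v p.
Proof.
move=> Yp; rewrite (curvatureE y_atlas _ _ _ Yp) mulmx_sumr; apply: eq_bigr => i _.
by rewrite mulmx_sumr; apply: eq_bigr => j _; rewrite scalemxAr.
Qed.

Lemma riemann_opN u v p : riemann_op v u p = - riemann_op u v p.
Proof.
rewrite /riemann_op exchange_big -sumrN; apply: eq_bigr => i _ /=.
rewrite -sumrN; apply: eq_bigr => j _.
by rewrite riemannN scalerN mulrC.
Qed.

Lemma riemann_opD u u' v p :
  riemann_op (u + u') v p = riemann_op u v p + riemann_op u' v p.
Proof.
rewrite /riemann_op -big_split; apply: eq_bigr => i _ /=.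
rewrite -big_split; apply: eq_bigr => j _ /=.
by rewrite mxE mulrDl scalerDl.
Qed.

Lemma riemann_opZ k u v p : riemann_op (k *: u) v p = k *: riemann_op u v p.
Proof.
rewrite /riemann_op scaler_sumr; apply: eq_bigr => i _ /=.
rewrite scaler_sumr; apply: eq_bigr => j _ /=.
by rewrite mxE scalerA mulrA.
Qed.

Lemma riemann_op_gram u v p : Y p ->
  gram y p *m (riemann_op u v p)^T = - (riemann_op u v p *m gram y p).
Proof.
move=> Yp; apply/eqP; rewrite -addr_eq0 addrC; apply/eqP.
have -> : (riemann_op u v p)^T
    = \sum_i \sum_j (u 0 i * v 0 j) *: (riemann y i j p)^T.
  rewrite [LHS]linear_sum; apply: eq_bigr => i _.
  by rewrite linear_sum; apply: eq_bigr => j _; exact: linearZ.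
rewrite mulmx_suml mulmx_sumr -big_split /=; apply: big1 => i _.
rewrite mulmx_suml mulmx_sumr -big_split /=; apply: big1 => j _.
by rewrite -scalemxAl -scalemxAr -scalerDr (riemann_gram y_atlas i j Yp) scaler0.
Qed.

Lemma riemann_op_bianchi u v w p : Y p ->
  w *m riemann_op u v p + u *m riemann_op v w p + v *m riemann_op w u p = 0.
Proof.
move=> Yp.
have op_e (a b d : 'rV[R]_n) : d *m riemann_op a b p = \sum_i \sum_j \sum_k
    (a 0 i * b 0 j * d 0 k) *: row k (riemann y i j p).
  rewrite mulmx_sumr; apply: eq_bigr => i _; rewrite mulmx_sumr.
  apply: eq_bigr => j _; rewrite -scalemxAr mulmx_sum_row scaler_sumr.
  by apply: eq_bigr => k _; rewrite scalerA.
rewrite !op_e.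
rewrite [X in _ + X + _](_ : _ = \sum_i \sum_j \sum_k
    (u 0 i * v 0 j * w 0 k) *: row i (riemann y j k p)); last first.
  rewrite [RHS]exchange_big /=; apply: eq_bigr => j _.
  rewrite [RHS]exchange_big /=; apply: eq_bigr => k _; apply: eq_bigr => i _.
  by congr (_ *: _); ring.
rewrite [X in _ + _ + X](_ : _ = \sum_i \sum_j \sum_k
    (u 0 i * v 0 j * w 0 k) *: row j (riemann y k i p)); last first.
  rewrite [LHS]exchange_big /=; apply: eq_bigr => i _.
  rewrite [LHS]exchange_big /=; apply: eq_bigr => j _; apply: eq_bigr => k _.
  by congr (_ *: _); ring.
rewrite -!big_split big1 // => i _ /=; rewrite -!big_split big1 // => j _ /=.
rewrite -!big_split big1 // => k _ /=.
by rewrite -!scalerDr (riemann_bianchi y_atlas i j k Yp) scaler0.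
Qed.

(** Strict Cauchy-Schwarz: [<v,v> u - <u,v> v] is nonzero by independence, and its squared length is
    [<v,v>] times the Gram determinant. *)
Lemma gram_det_gt0 p u v : Y p -> row_free (col_mx u v) ->
  0 < inner y p u u * inner y p v v - inner y p u v ^+ 2.
Proof.
move=> Yp uv.
have v0 : v != 0.
  apply: contraTneq uv => ->; apply/row_freePn.
  exists (rshift 1 0); rewrite rowKd row_id; exact: sub0mx.
have vv := inner_gt0 Yp v0.
have w0 : inner y p v v *: u - inner y p u v *: v != 0.
  apply/eqP => E; have /row_free_inj inj := uv.
  have /inj : row_mx (inner y p v v)%:M (- inner y p u v)%:M *m col_mx u v
      = 0 *m col_mx u v.
    by rewrite mul_row_col !mul_scalar_mx mul0mx scaleNr E.
  move=> /(congr1 (@lsubmx _ _ _ _)); rewrite row_mxKl linear0 => /matrixP/(_ 0 0).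
  by rewrite !mxE eqxx mulr1n => vv0; rewrite vv0 ltxx in vv.
have := inner_gt0 Yp w0.
rewrite !innerE (innerC v u Yp).
set a := inner y p u u; set b := inner y p v v; set d := inner y p u v.
move=> h; rewrite -(pmulr_rgt0 _ vv) -/b.
by apply: lt_le_trans h _; rewrite le_eqVlt; apply/orP; left; apply/eqP; ring.
Qed.

(** The hypothesis on sectional curvature, freed of its denominator. Polarisation needs it for all
    pairs; for dependent ones both sides vanish. *)
Lemma sectional_inner p u v : Y p ->
  inner y p (v *m riemann_op u v p) u
  = c * (inner y p u u * inner y p v v - inner y p u v ^+ 2).
Proof.
move=> Yp; have [uv|] := boolP (row_free (col_mx u v)).
  have := N_space_form y_atlas (dom Yp) uv.
  rewrite /sectional (curvature_op _ _ _ Yp) => <-.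
  by rewrite divfK // gt_eqF // gram_det_gt0.
rewrite -kermx_eq0 => /rowV0Pn[r /sub_kermxP].
rewrite -[r]hsubmxK mul_row_col => E r0.
move: E r0; rewrite [lsubmx r]mx11_scalar [rsubmx r]mx11_scalar !mul_scalar_mx.
move: (lsubmx r 0 0) (rsubmx r 0 0) => a b E r0.
have op0 w : riemann_op w w p = 0.
  apply/matrixP => i j; have := congr1 (fun T : 'M[R]_n => T i j) (riemann_opN w w p).
  by rewrite /= !mxE => ?; lra.
have [b0|b0] := eqVneq b 0.
  have a0 : a != 0.
    apply: contraNneq r0 => a0; rewrite a0 b0; apply/eqP.
    have -> : 0%:M = 0 :> 'M[R]_1 by apply/matrixP => i j; rewrite !mxE mul0rn.
    by rewrite row_mx0.
  have -> : u = 0.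
    have := congr1 (fun t : 'rV[R]_n => a^-1 *: t) E.
    by rewrite /= b0 scale0r addr0 scalerA (mulVf a0) scale1r scaler0.
  have -> : riemann_op 0 v p = 0.
    by apply: big1 => i _; apply: big1 => j _; rewrite mxE mul0r scale0r.
  by rewrite mulmx0 !innerE; ring.
have -> : v = (- (a / b)) *: u.
  have := congr1 (fun t : 'rV[R]_n => b^-1 *: t) E.
  rewrite /= scalerDr !scalerA (mulVf b0) scale1r scaler0 mulrC => /eqP.
  by rewrite addrC addr_eq0 scaleNr => /eqP.
rewrite riemann_opN riemann_opZ op0 scaler0 oppr0 mulmx0.
by rewrite !innerE; ring.
Qed.

(* The difference between the curvature of N and that of the model space has
   the symmetries of a curvature tensor and vanishing sectional curvatures. *)
Lemma space_form_curvature u v w p : Y p ->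
  w *m riemann_op u v p = c *: (inner y p v w *: u - inner y p u w *: v).
Proof.
move=> Yp; pose E u v w z := inner y p (w *m riemann_op u v p) z
  - c * (inner y p v w * inner y p u z - inner y p u w * inner y p v z).
suff E0 z : E u v w z = 0.
  apply/eqP; rewrite -subr_eq0; apply/eqP; apply: (inner_eq0 Yp) => z.
  have := E0 z; rewrite /E => {}E0.
  by rewrite !innerE -[RHS]E0; ring.
apply: (@curvature_like_eq0 R _ E) => {u v w z}.
- by move=> u u' v w z; rewrite /E riemann_opD mulmxDr !innerE; ring.
- by move=> u v w z; rewrite /E riemann_opN mulmxN innerE; ring.
- move=> u v w z; rewrite /E.
  have -> : inner y p (z *m riemann_op u v p) w = - inner y p (w *m riemann_op u v p) z.
    rewrite innerC // /inner trmx_mul mulmxA -(mulmxA w) riemann_op_gram //.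
    by rewrite mulmxN mulNmx mxE mulmxA.
  by rewrite (innerC v z) // (innerC u z) // (innerC u w) // (innerC v w) //; ring.
- move=> u v w z; rewrite /E.
  have := congr1 (fun t => inner y p t z) (riemann_op_bianchi u v w Yp).
  rewrite !innerE => h.
  by rewrite (innerC w u) // (innerC w v) // (innerC v u) // -[RHS]h; ring.
- move=> u v; rewrite /E sectional_inner // (innerC v u) //; ring.
Qed.

End ConstantCurvature.

(** * Structure equations of a hypersurface *)

(* In terms of phi: [h] is the metric of N along phi, [Phi] the matrix of the
   differential, [Om i] the connection matrix of the pullback bundle. *)
Record immersion_data (R : realType) (n : nat) (c : R) (M : riemannian R n)
    (x : chart R n M) (W : subdomain x) (h : M -> 'M[R]_n.+1)
    (Phi : M -> 'M[R]_(n, n.+1)) (Om : 'I_n -> M -> 'M[R]_n.+1)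
    (eta : M -> 'rV[R]_n.+1) : Prop := ImmersionData {
  immersion_h_smooth : smooth_mx W h;
  immersion_Phi_smooth : smooth_mx W Phi;
  immersion_Om_smooth : forall i, smooth_mx W (Om i);
  immersion_eta_smooth : smooth_mx W eta;
  immersion_h_tr : forall p, W p -> (h p)^T = h p;
  immersion_pdm_h : forall i p, W p ->
    pdm x i h p = Om i p *m h p + h p *m (Om i p)^T;
  immersion_isometric : forall p, W p -> Phi p *m h p *m (Phi p)^T = gram x p;
  immersion_torsion : forall i j p, W p ->
    row j (pdm x i Phi p + Phi p *m Om i p) = row i (pdm x j Phi p + Phi p *m Om j p);
  immersion_eta_unit : forall p, W p -> eta p *m h p *m (eta p)^T = 1%:M;
  immersion_eta_normal : forall p, W p -> Phi p *m h p *m (eta p)^T = 0;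
  immersion_curvature : forall i j p, W p ->
    pdm x i (Om j) p - pdm x j (Om i) p + Om j p *m Om i p - Om i p *m Om j p
    = c *: (h p *m (row j (Phi p))^T *m row i (Phi p)
            - h p *m (row i (Phi p))^T *m row j (Phi p)) }.

Section StructureEquations.
Variables (R : realType) (n : nat) (c : R) (M : riemannian R n) (x : chart R n M).
Hypothesis x_atlas : atlas x.
Variable W : subdomain x.
Variables (h : M -> 'M[R]_n.+1) (Phi : M -> 'M[R]_(n, n.+1)).
Variables (Om : 'I_n -> M -> 'M[R]_n.+1) (eta : M -> 'rV[R]_n.+1).
Hypothesis data : immersion_data c W h Phi Om eta.
Let smooth_h := immersion_h_smooth data.
Let smooth_Phi := immersion_Phi_smooth data.
Let smooth_Om := immersion_Om_smooth data.
Let smooth_eta := immersion_eta_smooth data.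
Let h_tr := immersion_h_tr data.
Let pdm_h := immersion_pdm_h data.
Let Phi_isometric := immersion_isometric data.
Let Phi_torsion := immersion_torsion data.
Let eta_unit := immersion_eta_unit data.
Let eta_normal := immersion_eta_normal data.
Let ambient_curvature := immersion_curvature data.
Implicit Types (p q : M) (i j k : 'I_n).

Local Notation G := (gram x).
Local Notation Gam := (christoffel_mx x).

(** Row [j] is the vector-valued second fundamental form on the [i]-th and [j]-th coordinate fields,
    in components of [N]; [sff] is its normal coefficient. *)
Definition sff_mx i p : 'M[R]_(n, n.+1) :=
  pdm x i Phi p + Phi p *m Om i p - Gam i p *m Phi p.

Definition sff p : 'M[R]_n := \matrix_(i, j) (row j (sff_mx i p) *m h p *m (eta p)^T) 0 0.

Definition shape p : 'M[R]_n := sff p *m invmx (G p).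

Lemma smooth_sff_mx i : smooth_mx W (sff_mx i).
Proof.
have sC : smooth_mx W (Gam i) := smooth_christoffel x_atlas i.
exact: smooth_mxB (smooth_mxD (smooth_mx_pdm i smooth_Phi)
  (smooth_mxM smooth_Phi (smooth_Om i))) (smooth_mxM sC smooth_Phi).
Qed.

Lemma smooth_sff : smooth_mx W sff.
Proof.
move=> i j.
have := smooth_mxM (smooth_mxM (smooth_mx_row j (smooth_sff_mx i)) smooth_h)
  (smooth_mx_tr smooth_eta).
by move=> /(_ 0 0); apply: smooth_in_ext => q _; rewrite [RHS]mxE.
Qed.

Lemma smooth_shape : smooth_mx W shape.
Proof.
have sI : smooth_mx W (fun p => invmx (G p)) := @smooth_invgram _ _ _ _ x_atlas W.
exact: smooth_mxM smooth_sff sI.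
Qed.

Lemma eta_normal_tr p : W p -> eta p *m h p *m (Phi p)^T = 0.
Proof.
move=> Wp; transitivity ((Phi p *m h p *m (eta p)^T)^T).
  by rewrite !trmxM trmxK h_tr // mulmxA.
by rewrite eta_normal // trmx0.
Qed.

(** The rows of [Phi p] and [eta p] form a frame of the ambient space: paired with themselves
    through [h] they give a block triangular matrix with blocks [gram x p] and 1. Hence [P], which
    collects the products with the frame, is injective, and both sides have the same products. *)
Lemma normal_span a (X : 'M[R]_(a, n.+1)) p : W p ->
  X *m h p *m (Phi p)^T = 0 -> X = X *m h p *m (eta p)^T *m eta p.
Proof.
move=> Wp X0; pose P := row_mx (h p *m (Phi p)^T) (h p *m (eta p)^T).
have freeP : row_free P.
  have : col_mx (Phi p) (eta p) *m P \in unitmx.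
    rewrite mul_col_row !mulmxA Phi_isometric // eta_normal // eta_unit //.
    rewrite unitmxE det_lblock det1 mulr1.
    by have := gram_unit x_atlas Wp; rewrite unitmxE.
  rewrite -row_full_unit => /eqP full.
  rewrite /row_free eqn_leq rank_leq_row -[X in (X <= _)%N]addn1 -[X in (X <= _)%N]full.
  exact: mxrankM_maxr.
apply: (row_free_inj freeP).
rewrite !mul_mx_row !mulmxA X0 -[X in row_mx _ X]mulmx1 -(eta_unit Wp).
congr row_mx; last by rewrite !mulmxA.
apply/esym; rewrite -!mulmxA.
by rewrite (mulmxA (eta p)) eta_normal_tr // !mulmx0.
Qed.

Lemma row_sff_mxC p i j : W p -> row j (sff_mx i p) = row i (sff_mx j p).
Proof.
move=> Wp; rewrite /sff_mx !(rowmxB _ (_ + _)) Phi_torsion // !row_mul.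
by rewrite (row_christoffel_mx x_atlas i j Wp).
Qed.

Lemma sffC p i j : W p -> sff p i j = sff p j i.
Proof. by move=> Wp; rewrite !mxE row_sff_mxC. Qed.

Lemma sff_tr p : W p -> (sff p)^T = sff p.
Proof. by move=> Wp; apply/matrixP => i j; rewrite mxE sffC. Qed.

(** The second fundamental form is normal. Its tangential components [t i j k] are symmetric in the
    first two indices, both connections being torsion-free, and skew in the last two, both being
    metric; such an array is zero. *)
Lemma sff_mx_tangent p i : W p -> sff_mx i p *m h p *m (Phi p)^T = 0.
Proof.
move=> Wp.
pose t i' := sff_mx i' p *m h p *m (Phi p)^T.
have skew i' : t i' + (t i')^T = 0.
  have : pdm x i' (fun q => Phi q *m h q *m (Phi q)^T) p = pdm x i' G p.
    by apply: (pdm_ext i' _ Wp) => q Wq; exact: Phi_isometric.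
  rewrite (pdm_gram x_atlas i' Wp) -(Phi_isometric Wp).
  rewrite (pdmM i' (smooth_mxM smooth_Phi smooth_h) (smooth_mx_tr smooth_Phi) Wp).
  rewrite (pdmM i' smooth_Phi smooth_h Wp) pdm_tr pdm_h // => /eqP.
  rewrite -subr_eq0 => /eqP <-; rewrite /t !trmxM trmxK h_tr // /sff_mx.
  by rewrite trmxB trmxD !trmxM; mx_abel.
have tC i' j k : t i' j k = t j i' k.
  transitivity ((row j (t i')) 0 k); first by rewrite [RHS]mxE.
  by rewrite !row_mul row_sff_mxC // -!row_mul mxE.
have tN i' j k : t i' j k = - t i' k j.
  have := congr1 (fun T : 'M[R]_n => T j k) (skew i').
  by rewrite /= [LHS]mxE [X in _ + X]mxE [RHS]mxE => /eqP; rewrite addr_eq0 => /eqP.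
apply/matrixP => j k; rewrite -/(t i) [RHS]mxE.
(* Alternating the symmetry and the skewness six times restores the indices; three of the swaps
   change the sign. *)
have E : t i j k = - t i j k.
  by rewrite {1}(tC i j k) (tN j i k) (tC j k i) (tN k j i) opprK (tC k i j) (tN i k j).
by lra.
Qed.

Lemma sff_mxE p i : W p -> sff_mx i p = (row i (sff p))^T *m eta p.
Proof.
move=> Wp; rewrite [LHS](normal_span Wp (sff_mx_tangent i Wp)); congr (_ *m _).
apply/matrixP => j k; rewrite ord1 [RHS]mxE [RHS]mxE [RHS]mxE.
by rewrite -!row_mul [RHS]mxE.
Qed.

Lemma shape_gram p : W p -> shape p *m G p = sff p.
Proof. by move=> Wp; rewrite /shape mulmxKV // (gram_unit x_atlas Wp). Qed.

Lemma gram_shape_tr p : W p -> G p *m (shape p)^T = shape p *m G p.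
Proof.
by move=> Wp; rewrite -{1}(gram_tr x_atlas Wp) -trmxM shape_gram // sff_tr.
Qed.

Lemma pdm_Phi p i : W p ->
  pdm x i Phi p = Gam i p *m Phi p - Phi p *m Om i p + (row i (sff p))^T *m eta p.
Proof. by move=> Wp; rewrite -sff_mxE // /sff_mx; mx_abel. Qed.

(** Differentiating [<eta, eta> = 1] and [<Phi, eta> = 0] gives all products of the covariant
    derivative of [eta] with the frame, and [normal_span] recovers the vector from them. *)
Lemma weingarten p i : W p ->
  pdm x i eta p = - (eta p *m Om i p) - row i (shape p) *m Phi p.
Proof.
move=> Wp.
(* The covariant derivative of [eta] in the pullback bundle, kept opaque so that matrix algebra sees
   it as one atom. *)
have [Ni NiE] : exists T, T = pdm x i eta p + eta p *m Om i p by eexists.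
have N1 : Ni *m h p *m (eta p)^T = 0.
  have : pdm x i (fun q => eta q *m h q *m (eta q)^T) p = 0.
    by rewrite -(pdm_cst x 1%:M i p); apply: (pdm_ext i _ Wp) => q Wq; exact: eta_unit.
  rewrite (pdmM i (smooth_mxM smooth_eta smooth_h) (smooth_mx_tr smooth_eta) Wp).
  rewrite (pdmM i smooth_eta smooth_h Wp) pdm_tr pdm_h // => E.
  have : Ni *m h p *m (eta p)^T + (Ni *m h p *m (eta p)^T)^T = 0.
    by rewrite -[RHS]E !trmxM trmxK h_tr // NiE trmxD !trmxM; mx_abel.
  move=> /matrixP/(_ 0 0); rewrite [LHS]mxE [X in _ + X]mxE [RHS]mxE => E0.
  by apply/matrixP => a b; rewrite !ord1 [RHS]mxE; lra.
have N2 : Ni *m h p *m (Phi p)^T = - row i (sff p).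
  have : pdm x i (fun q => Phi q *m h q *m (eta q)^T) p = 0.
    by rewrite -(pdm_cst x 0 i p); apply: (pdm_ext i _ Wp) => q Wq; exact: eta_normal.
  rewrite (pdmM i (smooth_mxM smooth_Phi smooth_h) (smooth_mx_tr smooth_eta) Wp).
  rewrite (pdmM i smooth_Phi smooth_h Wp) pdm_tr pdm_h // pdm_Phi // => E.
  apply/eqP; rewrite -addr_eq0; apply/eqP.
  rewrite -[LHS]trmxK -[RHS]trmxK trmx0; congr (_^T).
  have e1 : (row i (sff p))^T *m (eta p *m h p *m (eta p)^T) = (row i (sff p))^T.
    by rewrite eta_unit // mulmx1.
  have e2 : Gam i p *m (Phi p *m h p *m (eta p)^T) = 0.
    by rewrite eta_normal // mulmx0.
  rewrite trmxD -e1 -[RHS]E -[LHS](addr0) -e2 !trmxM trmxK h_tr // NiE trmxD !trmxM.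
  by mx_abel.
have V0 : (Ni + row i (shape p) *m Phi p) *m h p *m (Phi p)^T = 0.
  rewrite !mulmxDl N2 -!(mulmxA (row i _)) Phi_isometric //.
  by rewrite -row_mul shape_gram // addNr.
have V1 : (Ni + row i (shape p) *m Phi p) *m h p *m (eta p)^T = 0.
  rewrite !mulmxDl N1 -!(mulmxA (row i _)) eta_normal //.
  by rewrite mulmx0 addr0.
have := normal_span Wp V0; rewrite V1 mul0mx NiE => /eqP.
by rewrite addr_eq0 => /eqP E; rewrite -E; mx_abel.
Qed.

(** Equality of the mixed second derivatives of [Phi], with all first derivatives eliminated by
    [pdm_Phi] and [weingarten]. It is grouped as a tangential part times [Phi] plus a normal part
    times [eta], which must vanish separately: these are the Gauss and Codazzi equations. *)
Lemma compatibility p i j : W p ->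
  riemann x i j p *m Phi p
  - Phi p *m (c *: (h p *m (row j (Phi p))^T *m row i (Phi p)
          - h p *m (row i (Phi p))^T *m row j (Phi p)))
  - ((row j (sff p))^T *m row i (shape p) - (row i (sff p))^T *m row j (shape p))
      *m Phi p
  + ((row j (pdm x i sff p))^T - (row i (pdm x j sff p))^T
     + Gam j p *m (row i (sff p))^T - Gam i p *m (row j (sff p))^T) *m eta p = 0.
Proof.
move=> Wp; rewrite -ambient_curvature //.
have sC a : smooth_mx W (Gam a) := smooth_christoffel x_atlas a.
have e a b : pdm x a (pdm x b Phi) p =
   pdm x a (Gam b) p *m Phi p + Gam b p *m pdm x a Phi p
   - (pdm x a Phi p *m Om b p + Phi p *m pdm x a (Om b) p)
   + ((row b (pdm x a sff p))^T *m eta p + (row b (sff p))^T *m pdm x a eta p).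
  have s1 := smooth_mxM (sC b) smooth_Phi.
  have s2 := smooth_mxM smooth_Phi (smooth_Om b).
  have s3 := smooth_mx_tr (smooth_mx_row b smooth_sff).
  rewrite (pdm_ext a (fun q Wq => pdm_Phi b Wq) Wp).
  rewrite (pdmD a (smooth_mxB s1 s2) (smooth_mxM s3 smooth_eta) Wp).
  rewrite (pdmB a s1 s2 Wp) (pdmM a (sC b) smooth_Phi Wp).
  rewrite (pdmM a smooth_Phi (smooth_Om b) Wp) (pdmM a s3 smooth_eta Wp).
  by rewrite pdm_tr pdm_row.
have := pdmC i j smooth_Phi Wp; rewrite !e !weingarten // !pdm_Phi // => /eqP.
rewrite -subr_eq0 => /eqP <-; rewrite /riemann.
by mx_abel.
Qed.

Lemma frame_free a (X : 'M[R]_(a, n)) (Z : 'M[R]_(a, 1)) p : W p ->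
  X *m Phi p + Z *m eta p = 0 -> X = 0 /\ Z = 0.
Proof.
move=> Wp E; split.
  have := congr1 (fun T => T *m h p *m (Phi p)^T) E.
  rewrite /= !mulmxDl !mul0mx -!(mulmxA Z) (eta_normal_tr Wp) mulmx0 addr0.
  rewrite -!(mulmxA X) (Phi_isometric Wp) => /(congr1 (mulmx^~ (invmx (G p)))).
  by rewrite /= mul0mx mulmxK // (gram_unit x_atlas Wp).
have := congr1 (fun T => T *m h p *m (eta p)^T) E.
rewrite /= !mulmxDl !mul0mx -!(mulmxA X) (eta_normal Wp) mulmx0 add0r.
by rewrite -!(mulmxA Z) (eta_unit Wp) mulmx1.
Qed.

Lemma gauss_codazzi p i j : W p ->
  riemann x i j p = c *: (G p *m (delta_mx j 0 : 'cV_n) *m delta_mx 0 i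
                          - G p *m (delta_mx i 0 : 'cV_n) *m delta_mx 0 j)
   + ((row j (sff p))^T *m row i (shape p) - (row i (sff p))^T *m row j (shape p))
  /\ (row j (pdm x i sff p))^T - (row i (pdm x j sff p))^T
     + Gam j p *m (row i (sff p))^T - Gam i p *m (row j (sff p))^T = 0.
Proof.
move=> Wp; have := compatibility i j Wp.
have cur a b : Phi p *m (h p *m (row a (Phi p))^T *m row b (Phi p))
    = G p *m (delta_mx a 0 : 'cV_n) *m delta_mx 0 b *m Phi p.
  by rewrite !rowE trmxM trmx_delta !mulmxA Phi_isometric.
rewrite -scalemxAr mulmxBr !cur -mulmxBl scalemxAl -!mulmxBl.
move=> /(frame_free Wp)[X0 ->]; split=> //.
by move/eqP: X0; rewrite -addrA -opprD subr_eq0 => /eqP.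
Qed.

Lemma gauss p i j : W p ->
  riemann x i j p = c *: (G p *m (delta_mx j 0 : 'cV_n) *m delta_mx 0 i
                          - G p *m (delta_mx i 0 : 'cV_n) *m delta_mx 0 j)
   + ((row j (sff p))^T *m row i (shape p) - (row i (sff p))^T *m row j (shape p)).
Proof. by move=> /(gauss_codazzi i j)[]. Qed.

(** The normal part of [compatibility] speaks of the bilinear form [sff]. It passes to the operator
    because [sff] is [shape] times the metric, and the metric is parallel. *)
Lemma codazzi p i j : W p ->
  row j (cov_op x i shape p) = row i (cov_op x j shape p).
Proof.
move=> Wp; have sA := smooth_shape.
have sG : smooth_mx W G by exact: smooth_gram.
have e a : pdm x a sff p = pdm x a shape p *m G p
    + shape p *m (Gam a p *m G p + G p *m (Gam a p)^T).
  rewrite -(pdm_gram x_atlas a Wp) -(pdmM a sA sG Wp).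
  by apply: (pdm_ext a _ Wp) => q Wq; rewrite shape_gram.
have [_ /(congr1 trmx) E] := gauss_codazzi i j Wp.
rewrite trmx0 !trmxB trmxD trmxB !trmxK !trmxM !trmxK !e -(shape_gram Wp) in E.
rewrite !rowmxD !row_mul !mulmxDr in E.
have : (row j (cov_op x i shape p) - row i (cov_op x j shape p)) *m G p = 0.
  rewrite -[RHS]E /cov_op !rowmxB !rowmxD !row_mul.
  by rewrite (row_christoffel_mx x_atlas i j Wp); mx_abel.
move=> /(congr1 (mulmx^~ (invmx (G p)))); rewrite /= mul0mx.
by rewrite (mulmxK (gram_unit x_atlas Wp)) => /eqP; rewrite subr_eq0 => /eqP.
Qed.

End StructureEquations.

(** * Gradients, divergences and covariant derivatives of vector fields *)

HB.lock Definition dir_deriv (R : realType) (n : nat) (M : topologicalType)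
    (x : chart R n M) (v : 'rV[R]_n) (h : M -> R) (p : M) : R :=
  (v *m (differential x h p)^T) 0 0.
Arguments dir_deriv {R n M} x v h p.

Lemma dir_derivE (R : realType) (n : nat) (M : topologicalType)
    (x : chart R n M) v h p : dir_deriv x v h p = (v *m (differential x h p)^T) 0 0.
Proof. by rewrite dir_deriv.unlock. Qed.

HB.lock Definition divg (R : realType) (n : nat) (M : riemannian R n)
    (x : chart R n M) (V : M -> 'rV[R]_n) (p : M) : R := divergence x V p.
Arguments divg {R n M} x V p.

Lemma divgE (R : realType) (n : nat) (M : riemannian R n) (x : chart R n M) V p :
  divergence x V p = divg x V p.
Proof. by rewrite divg.unlock. Qed.

Section VectorCalculus.
Variables (R : realType) (n : nat) (M : riemannian R n) (x : chart R n M).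
Hypothesis x_atlas : atlas x.
Variable W : subdomain x.
Implicit Types (p q : M) (h : M -> R) (V : M -> 'rV[R]_n).

Definition cov_mx V p : 'M[R]_n := \matrix_i cov x i V p.

Lemma row_cov_mx i V p : row i (cov_mx V p) = cov x i V p.
Proof. exact: rowK. Qed.

Lemma differential_ext h h' p : (forall q, W q -> h q = h' q) -> W p ->
  differential x h p = differential x h' p.
Proof. by move=> E Wp; apply/rowP => i; rewrite !differentialE (pd_ext i E Wp). Qed.

Lemma differential_cst (k : R) p : differential x (fun=> k) p = 0.
Proof. by apply/rowP => i; rewrite differentialE pd_cst mxE. Qed.

Lemma differentialD h h' p : smooth_in x W h -> smooth_in x W h' -> W p ->
  differential x (fun q => h q + h' q) p = differential x h p + differential x h' p.
Proof.
move=> sh sh' Wp; apply/rowP => i.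
by rewrite differentialE [RHS]mxE !differentialE (pdD i sh sh' Wp).
Qed.

Lemma differentialM h h' p : smooth_in x W h -> smooth_in x W h' -> W p ->
  differential x (fun q => h q * h' q) p
  = h' p *: differential x h p + h p *: differential x h' p.
Proof.
move=> sh sh' Wp; apply/rowP => i; rewrite differentialE (pdM i sh sh' Wp) mulrC.
by rewrite [RHS]mxE [X in _ = X + _]mxE [X in _ = _ + X]mxE !differentialE.
Qed.

Lemma gradE h p : grad x h p = differential x h p *m invmx (gram x p).
Proof. by rewrite differential.unlock. Qed.

Lemma smooth_grad h : smooth_in x W h -> smooth_mx W (grad x h).
Proof.
move=> sh; have sI : smooth_mx W (fun p => invmx (gram x p)).
  exact: smooth_invgram x_atlas _.
by apply: smooth_mx_ext (smooth_mxM (smooth_differential sh) sI) => q _; rewrite gradE.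
Qed.

Lemma invgram_tr p : W p -> (invmx (gram x p))^T = invmx (gram x p).
Proof. by move=> Wp; rewrite trmx_inv (gram_tr x_atlas Wp). Qed.

Lemma inner_grad v h p : W p -> inner x p v (grad x h p) = dir_deriv x v h p.
Proof.
move=> Wp; rewrite /inner gradE trmxM invgram_tr // -mulmxA.
by rewrite (mulKVmx (gram_unit x_atlas Wp)) dir_derivE.
Qed.

Lemma divergence_ext V V' p : (forall q, W q -> V q = V' q) -> W p ->
  divg x V p = divg x V' p.
Proof.
move=> E Wp; rewrite -!divgE !(divergenceE x_atlas _ Wp).
by apply: eq_bigr => i _; rewrite (pdm_ext i E Wp) E.
Qed.

Lemma divergence_tr V p : divg x V p = \tr (cov_mx V p).
Proof. by rewrite -divgE; apply: eq_bigr => i _; rewrite nabla_coord [RHS]mxE. Qed.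

Lemma divergenceD V V' p : smooth_mx W V -> smooth_mx W V' -> W p ->
  divg x (fun q => V q + V' q) p = divg x V p + divg x V' p.
Proof.
move=> sV sV' Wp; rewrite -!divgE !(divergenceE x_atlas _ Wp) -big_split /=.
apply: eq_bigr => i _; rewrite (pdmD i sV sV' Wp) [X in X + _]mxE.
by rewrite [X in _ * X]mxE; ring.
Qed.

Lemma divergenceZ h V p : smooth_in x W h -> smooth_mx W V -> W p ->
  divg x (fun q => h q *: V q) p = dir_deriv x (V p) h p + h p * divg x V p.
Proof.
move=> sh sV Wp; rewrite -!divgE !(divergenceE x_atlas _ Wp) mulr_sumr dir_derivE.
rewrite [X in X + _]mxE -big_split /=; apply: eq_bigr => i _.
have sc (k : R) (v : 'rV[R]_n) : (k *: v) 0 i = k * v 0 i by rewrite mxE.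
rewrite (pdmZ i sh sV Wp) [X in X + _]mxE !sc.
have -> : (differential x h p)^T i 0 = pd x i h p by rewrite mxE differentialE.
ring.
Qed.

Lemma cov_mxZ h V p : smooth_in x W h -> smooth_mx W V -> W p ->
  cov_mx (fun q => h q *: V q) p
  = (differential x h p)^T *m V p + h p *: cov_mx V p.
Proof.
move=> sh sV Wp; apply/row_matrixP => i.
have -> : row i ((differential x h p)^T *m V p + h p *: cov_mx V p)
    = row i (differential x h p)^T *m V p + h p *: cov x i V p.
  by rewrite rowmxD row_mul -row_cov_mx linearZ.
rewrite row_cov_mx /cov (pdmZ i sh sV Wp) -scalemxAl -addrA -scalerDr.
have -> : row i (differential x h p)^T = (pd x i h p)%:M.
  by apply/rowP => j; rewrite !ord1 !mxE differentialE mulr1n.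
by rewrite mul_scalar_mx.
Qed.

Lemma cov_mxD V V' p : smooth_mx W V -> smooth_mx W V' -> W p ->
  cov_mx (fun q => V q + V' q) p = cov_mx V p + cov_mx V' p.
Proof.
move=> sV sV' Wp; apply/row_matrixP => i.
by rewrite rowmxD !row_cov_mx /cov (pdmD i sV sV' Wp) mulmxDl addrACA.
Qed.

Lemma cov_mx_ext V V' p : (forall q, W q -> V q = V' q) -> W p ->
  cov_mx V p = cov_mx V' p.
Proof.
move=> E Wp; apply/row_matrixP => i.
by rewrite !row_cov_mx /cov (pdm_ext i E Wp) E.
Qed.

Lemma cov_mul (V : M -> 'rV[R]_n) (T : M -> 'M[R]_n) i p :
  smooth_mx W V -> smooth_mx W T -> W p ->
  cov x i (fun q => V q *m T q) p = cov x i V p *m T p + V p *m cov_op x i T p.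
Proof. by move=> sV sT Wp; rewrite /cov /cov_op (pdmM i sV sT Wp); mx_abel. Qed.

Lemma trace_cov_op (T : M -> 'M[R]_n) i p : smooth_mx W T -> W p ->
  \tr (cov_op x i T p) = pd x i (fun q => \tr (T q)) p.
Proof.
move=> sT Wp; rewrite /cov_op linearB /= mxtraceD (pd_trace i sT Wp).
by rewrite (mxtrace_mulC (T p)) addrK.
Qed.

Lemma cov_opM (S T : M -> 'M[R]_n) i p : smooth_mx W S -> smooth_mx W T -> W p ->
  cov_op x i (fun q => S q *m T q) p = cov_op x i S p *m T p + S p *m cov_op x i T p.
Proof. by move=> sS sT Wp; rewrite /cov_op (pdmM i sS sT Wp); mx_abel. Qed.

Lemma pdm_invgram p i : W p ->
  pdm x i (fun q => invmx (gram x q)) p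
  = - (invmx (gram x p) *m christoffel_mx x i p)
    - (christoffel_mx x i p)^T *m invmx (gram x p).
Proof.
move=> Wp; have uG q : W q -> gram x q \in unitmx by exact: gram_unit.
have sG : smooth_mx W (gram x) by exact: smooth_gram.
rewrite (pdm_invmx i sG uG Wp) (pdm_gram x_atlas i Wp) mulmxDr mulmxDl !mulmxA.
rewrite (mulmxK (uG _ Wp)) (mulVmx (uG _ Wp)) mul1mx.
by rewrite opprD.
Qed.

Lemma trace_christoffel p (X : 'I_n -> 'rV[R]_n) : W p ->
  \sum_i \sum_l christoffel_mx x i p l i *: X l
  = \sum_l \tr (christoffel_mx x l p) *: X l.
Proof.
move=> Wp; rewrite exchange_big; apply: eq_bigr => l _ /=.
rewrite -scaler_suml; congr (_ *: _); apply: eq_bigr => i _.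
exact: (christoffel_mxC x_atlas i l i Wp).
Qed.

End VectorCalculus.

(** * The Simons identity for a Codazzi tensor *)

Section DeltaSums.
Variables (R : pzRingType) (n : nat).
Implicit Types (X Y : 'M[R]_n).

Lemma row_mul_delta X Y i k l :
  row i (X *m (delta_mx k 0 : 'cV_n) *m delta_mx 0 l *m Y) = X i k *: row l Y.
Proof.
rewrite -mulmxA -(rowE l) row_mul -colE.
have -> : row i (col k X) = (X i k)%:M by apply/rowP => j; rewrite !ord1 !mxE mulr1n.
by rewrite mul_scalar_mx.
Qed.

Lemma sum_row_delta_tr X Y k :
  \sum_i row i (X *m (delta_mx k 0 : 'cV_n) *m delta_mx 0 i *m Y) = row k (X^T *m Y).
Proof.
rewrite [RHS]row_mul mulmx_sum_row; apply: eq_bigr => i _.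
by rewrite row_mul_delta !mxE.
Qed.

Lemma sum_row_delta_trace X Y k :
  \sum_i row i (X *m (delta_mx i 0 : 'cV_n) *m delta_mx 0 k *m Y) = \tr X *: row k Y.
Proof. by rewrite scaler_suml; apply: eq_bigr => i _; exact: row_mul_delta. Qed.

(** Contracts a curvature in the form given by the Gauss equation: the part with factor [a] comes
    from the ambient curvature, the other from the second fundamental form. *)
Lemma sum_row_delta_alt (a : R) X Y X' Y' k :
  \sum_i (a *: (row i (X *m (delta_mx k 0 : 'cV_n) *m delta_mx 0 i *m Y)
               - row i (X *m (delta_mx i 0 : 'cV_n) *m delta_mx 0 k *m Y))
    + (row i (X' *m (delta_mx k 0 : 'cV_n) *m delta_mx 0 i *m Y')
       - row i (X' *m (delta_mx i 0 : 'cV_n) *m delta_mx 0 k *m Y')))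
  = a *: (row k (X^T *m Y) - \tr X *: row k Y)
    + (row k (X'^T *m Y') - \tr X' *: row k Y').
Proof.
rewrite big_split -scaler_sumr !sumrB /=.
congr (_ *: (_ - _) + (_ - _)).
- exact: sum_row_delta_tr.
- exact: sum_row_delta_trace.
- exact: sum_row_delta_tr.
- exact: sum_row_delta_trace.
Qed.

End DeltaSums.

Lemma mul_row_tr_row (R : pzRingType) a b d (S : 'M[R]_(a, b)) (T : 'M[R]_(d, b)) i j :
  (row i S *m (row j T)^T) 0 0 = (S *m T^T) i j.
Proof. by rewrite !mxE; apply: eq_bigr => k _; rewrite !mxE. Qed.

Definition trace_fun (R : pzRingType) (n : nat) (S : Type) (A : S -> 'M[R]_n)
  (q : S) : R := \tr (A q).

Section CodazziTensor.
Variables (R : realType) (n : nat) (c : R) (M : riemannian R n) (x : chart R n M).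
Hypothesis x_atlas : atlas x.
Variable W : subdomain x.
Variable A : M -> 'M[R]_n.
Hypothesis smooth_A : smooth_mx W A.
Hypothesis selfadj : forall p, W p -> gram x p *m (A p)^T = A p *m gram x p.
Hypothesis codazzi_A : forall p i j, W p ->
  row j (cov_op x i A p) = row i (cov_op x j A p).
Hypothesis gauss_A : forall p i j, W p ->
  riemann x i j p = c *: (gram x p *m (delta_mx j 0 : 'cV_n) *m delta_mx 0 i
                          - gram x p *m (delta_mx i 0 : 'cV_n) *m delta_mx 0 j)
   + (A p *m gram x p *m (delta_mx j 0 : 'cV_n) *m delta_mx 0 i *m A p
      - A p *m gram x p *m (delta_mx i 0 : 'cV_n) *m delta_mx 0 j *m A p).
Implicit Types (p q : M) (i j k : 'I_n) (V : M -> 'rV[R]_n).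

Local Notation G := (gram x).
Local Notation g p := (invmx (gram x p)).
Local Notation Gam := (christoffel_mx x).
Local Notation Q k := (cov_op x k A).

Local Notation u := (trace_fun A).

Let smooth_g : smooth_mx W (fun p => g p). Proof. exact: smooth_invgram. Qed.

Let uG p : W p -> G p \in unitmx. Proof. exact: gram_unit. Qed.

Lemma A_tr p : W p -> (A p)^T = g p *m A p *m G p.
Proof. by move=> Wp; rewrite -mulmxA -selfadj // mulKmx // uG. Qed.

Lemma codazziE p i j k : W p -> cov_op x i A p j k = cov_op x j A p i k.
Proof.
move=> Wp; have := congr1 (fun r : 'rV[R]_n => r 0 k) (codazzi_A i j Wp).
by rewrite /= ![row _ _ _ _]mxE.
Qed.

Lemma cov_op_selfadj p i : W p ->
  G p *m (cov_op x i A p)^T = cov_op x i A p *m G p.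
Proof.
move=> Wp; have sG : smooth_mx W G by exact: smooth_gram.
have : pdm x i (fun q => G q *m (A q)^T) p = pdm x i (fun q => A q *m G q) p.
  by apply: (pdm_ext i _ Wp) => q Wq; exact: selfadj.
rewrite (pdmM i sG (smooth_mx_tr smooth_A) Wp) (pdmM i smooth_A sG Wp) pdm_tr.
rewrite (pdm_gram x_atlas i Wp) => E.
move/eqP: E; rewrite -subr_eq0 => /eqP; set D := _ - _ => D0.
pose Z1 := Gam i p *m (G p *m (A p)^T) - Gam i p *m (A p *m G p).
pose Z2 := G p *m (A p)^T *m (Gam i p)^T - A p *m G p *m (Gam i p)^T.
apply/eqP; rewrite -subr_eq0; apply/eqP; transitivity (D - Z1 - Z2).
  by rewrite /D /Z1 /Z2 /cov_op trmxB trmxD !trmxM; mx_abel.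
by rewrite D0 /Z1 /Z2 selfadj // !subrr.
Qed.

(** The Codazzi equation moves the derivative index off the contracted one, so that the derivative
    of [A] enters only through its trace. *)
Lemma divergence_mulA V p : smooth_mx W V -> W p ->
  divg x (fun q => V q *m A q) p
  = \tr (cov_mx x V p *m A p) + dir_deriv x (V p) u p.
Proof.
move=> sV Wp; rewrite divergence_tr.
have -> : cov_mx x (fun q => V q *m A q) p
    = cov_mx x V p *m A p + \matrix_i (V p *m cov_op x i A p).
  apply/row_matrixP => i; rewrite rowmxD row_mul !row_cov_mx rowK.
  exact: (cov_mul i sV smooth_A Wp).
rewrite mxtraceD; congr (_ + _); rewrite dir_derivE [RHS]mxE.
transitivity (\sum_i \sum_k V p 0 k * cov_op x k A p i i).
  apply: eq_bigr => i _; rewrite !mxE; apply: eq_bigr => k _.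
  by rewrite (codazziE i k i Wp).
rewrite exchange_big; apply: eq_bigr => k _ /=.
rewrite -mulr_sumr; congr (_ * _); rewrite [RHS]mxE differentialE.
exact: (trace_cov_op k smooth_A Wp).
Qed.

(** Lowered with the metric, the covariant derivative of [A] is totally symmetric: in two indices by
    Codazzi, in two by self-adjointness. *)
Lemma cov_op_gramC p i j k : W p ->
  (cov_op x i A p *m G p) j k = (cov_op x k A p *m G p) i j.
Proof.
move=> Wp.
have sym l : (cov_op x l A p *m G p)^T = cov_op x l A p *m G p.
  by rewrite trmxM (gram_tr x_atlas Wp) cov_op_selfadj.
have cod l : (cov_op x i A p *m G p) l j = (cov_op x l A p *m G p) i j.
  have := congr1 (fun r => (r *m G p) 0 j) (codazzi_A i l Wp).
  by rewrite /= -!row_mul mxE [RHS]mxE.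
by rewrite -cod -[in LHS]sym mxE.
Qed.

(** The divergence of [A] is the gradient of its trace: all contractions of a totally symmetric
    tensor agree. *)
Lemma sum_row_cov_op p : W p -> \sum_i row i (g p *m Q i p) = grad x u p.
Proof.
move=> Wp; rewrite gradE -[LHS](mulmxK (uG Wp)); congr (_ *m _); apply/rowP => k.
rewrite differentialE -(trace_cov_op k smooth_A Wp) mulmx_suml summxE.
rewrite -[Q k p in RHS](mulmxK (uG Wp)); apply: eq_bigr => i _.
rewrite -row_mul -(mulmxA (g p)) [LHS]mxE [LHS]mxE [RHS]mxE; apply: eq_bigr => j _.
by rewrite (cov_op_gramC i j k Wp) mulrC -[in LHS](invgram_tr x_atlas Wp) [X in _ * X = _]mxE.
Qed.

Lemma row_cov_opC p i k : W p ->
  row k (\sum_j g p i j *: Q j p) = row i (g p *m Q k p).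
Proof.
move=> Wp; rewrite linear_sum row_mul mulmx_sum_row; apply: eq_bigr => j _ /=.
by rewrite linearZ /= (codazzi_A j k Wp) !mxE.
Qed.

(* The rough Laplacian of A: its k-th row only involves the second derivatives
   of A contracted with the first index, so that the Codazzi equation and the
   Ricci identity turn it into the Hessian of the trace plus curvature. *)
Definition laplace_op p : 'M[R]_n :=
  \sum_i (cov_op x i (fun q => \sum_j g q i j *: Q j q) p
          + \tr (Gam i p) *: \sum_j g p i j *: Q j p).

(** The commutator of the Ricci identity for [A], contracted as the two derivatives of the rough
    Laplacian are exchanged. *)
Definition curv_op p : 'M[R]_n :=
  \matrix_k \sum_i row i (g p *m (A p *m riemann x i k p - riemann x i k p *m A p)).

Lemma sum_row_christoffel p k (X : 'I_n -> 'M[R]_n) :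
  \sum_i row i ((Gam k p)^T *m X i) = \sum_i \sum_l Gam k p i l *: row i (X l).
Proof.
rewrite exchange_big; apply: eq_bigr => i _ /=.
rewrite row_mul mulmx_sum_row; apply: eq_bigr => l _.
by rewrite !mxE.
Qed.

Lemma sum_row_christoffel_tr p (X : 'M[R]_n) : W p ->
  \sum_i row i ((Gam i p)^T *m X) = \sum_i \tr (Gam i p) *: row i X.
Proof.
move=> Wp; rewrite -(trace_christoffel x_atlas (fun l => row l X) Wp).
apply: eq_bigr => i _; rewrite row_mul mulmx_sum_row; apply: eq_bigr => l _.
by rewrite !mxE.
Qed.

Lemma smooth_Q k : smooth_mx W (Q k).
Proof. exact: smooth_cov_op. Qed.

Lemma smooth_gQ i : smooth_mx W (fun q => \sum_j g q i j *: Q j q).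
Proof.
apply: smooth_mx_sum => j; apply: smooth_mxZ (smooth_Q j).
exact: (smooth_g i j).
Qed.

Lemma cov_gradE p k : W p ->
  cov x k (grad x u) p = \sum_i row i (g p *m cov_op x k (Q i) p)
    - \sum_i \sum_l Gam k p i l *: row i (g p *m Q l p).
Proof.
move=> Wp; rewrite -sum_row_christoffel -sumrB /cov.
have s i : smooth_mx W (fun q => g q *m Q i q) := smooth_mxM smooth_g (smooth_Q i).
have -> : pdm x k (grad x u) p = pdm x k (fun q => \sum_i row i (g q *m Q i q)) p.
  by apply: (pdm_ext k _ Wp) => q Wq; rewrite sum_row_cov_op.
rewrite (pdm_sum (index_enum _) k (fun i => smooth_mx_row i (s i)) Wp).
rewrite -sum_row_cov_op // mulmx_suml -big_split; apply: eq_bigr => i _ /=.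
rewrite pdm_row (pdmM k smooth_g (smooth_Q i) Wp) (pdm_invgram x_atlas k Wp).
rewrite -row_mul -rowmxD -rowmxB; congr (row i _).
by rewrite /cov_op; mx_abel.
Qed.

(** The Christoffel sum is put in the same shape as in [cov_gradE]. Subtracting the two formulas
    leaves only the Ricci commutator, which is [laplace_opE]. *)
Lemma row_laplace_op p k : W p ->
  row k (laplace_op p) = \sum_i row i (g p *m cov_op x i (Q k) p)
    - \sum_i \sum_l Gam k p i l *: row i (g p *m Q l p).
Proof.
move=> Wp; rewrite /laplace_op big_split linearD /= !linear_sum /=.
(* The trace terms become terms in [(Gam i p)^T], which cancel against those in the derivative of
   the inverse metric. *)
have -> : \sum_i row k (\tr (Gam i p) *: \sum_j g p i j *: Q j p)
    = \sum_i row i ((Gam i p)^T *m (g p *m Q k p)).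
  rewrite sum_row_christoffel_tr //; apply: eq_bigr => i _.
  by rewrite -(row_cov_opC i k Wp) linearZ.
rewrite -!big_split; apply: eq_bigr => i _ /=.
have s : smooth_mx W (fun q => g q *m Q k q) := smooth_mxM smooth_g (smooth_Q k).
rewrite [in LHS]/cov_op rowmxB rowmxD row_mul (row_cov_opC i k Wp).
have -> : row k (pdm x i (fun q => \sum_j g q i j *: Q j q) p)
    = row i (pdm x i (fun q => g q *m Q k q) p).
  by rewrite -!pdm_row; apply: (pdm_ext i _ Wp) => q Wq; exact: row_cov_opC.
have -> : row k (Gam i p *m \sum_j g p i j *: Q j p)
    = \sum_l Gam k p i l *: row i (g p *m Q l p).
  rewrite row_mul mulmx_sum_row; apply: eq_bigr => l _.
  by rewrite (row_cov_opC i l Wp) mxE (christoffel_mxC x_atlas i k l Wp).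
rewrite (pdmM i smooth_g (smooth_Q k) Wp) (pdm_invgram x_atlas i Wp).
rewrite addrAC -row_mul -!rowmxD; congr (row i _ - _).
by rewrite /cov_op; mx_abel.
Qed.

Lemma laplace_opE p : W p -> laplace_op p = cov_mx x (grad x u) p + curv_op p.
Proof.
move=> Wp; apply/row_matrixP => k.
rewrite rowmxD row_cov_mx rowK cov_gradE // row_laplace_op // addrAC.
congr (_ - _); rewrite -big_split; apply: eq_bigr => i _ /=.
rewrite -rowmxD -mulmxDr; congr (row i (_ *m _)).
apply/eqP; rewrite addrC -subr_eq; apply/eqP.
exact: (ricci_identity x_atlas i k smooth_A Wp).
Qed.

Lemma A_tr_sq p : W p -> g p *m A p *m A p *m G p = (A p *m A p)^T.
Proof.
by move=> Wp; rewrite trmxM A_tr // !mulmxA (mulmxK (uG Wp)).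
Qed.

(** Traced Gauss equation; with this order of indices it is minus the Ricci operator. *)
Lemma sum_row_riemann p k : W p ->
  \sum_i row i (g p *m riemann x i k p)
  = c *: ((1 - n%:R) *: delta_mx 0 k) + row k (A p *m A p) - u p *: row k (A p).
Proof.
move=> Wp.
have e i : row i (g p *m riemann x i k p)
   = c *: (row i (1%:M *m (delta_mx k 0 : 'cV_n) *m delta_mx 0 i *m 1%:M)
           - row i (1%:M *m (delta_mx i 0 : 'cV_n) *m delta_mx 0 k *m 1%:M))
   + (row i ((A p)^T *m (delta_mx k 0 : 'cV_n) *m delta_mx 0 i *m A p)
      - row i ((A p)^T *m (delta_mx i 0 : 'cV_n) *m delta_mx 0 k *m A p)).
  rewrite gauss_A // A_tr // -!rowmxB -[c *: row i _]linearZ -rowmxD.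
  by rewrite mulmxDr -scalemxAr !mulmxBr !mulmxA (mulVmx (uG Wp)) !mulmx1.
rewrite (eq_bigr _ (fun i _ => e i)) sum_row_delta_alt trmx1 mxtrace1 trmxK mxtrace_tr.
rewrite !mulmx1 row1 scalerBl scale1r.
by rewrite addrA.
Qed.

Lemma sum_row_A_riemann p k : W p ->
  \sum_i row i (g p *m (A p *m riemann x i k p))
  = c *: (row k (A p) - u p *: delta_mx 0 k)
    + row k (A p *m A p *m A p) - \tr (A p *m A p) *: row k (A p).
Proof.
move=> Wp.
have e i : row i (g p *m (A p *m riemann x i k p))
   = c *: (row i ((A p)^T *m (delta_mx k 0 : 'cV_n) *m delta_mx 0 i *m 1%:M)
           - row i ((A p)^T *m (delta_mx i 0 : 'cV_n) *m delta_mx 0 k *m 1%:M))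
   + (row i ((A p *m A p)^T *m (delta_mx k 0 : 'cV_n) *m delta_mx 0 i *m A p)
      - row i ((A p *m A p)^T *m (delta_mx i 0 : 'cV_n) *m delta_mx 0 k *m A p)).
  rewrite gauss_A // -A_tr_sq // A_tr // -!rowmxB -[c *: row i _]linearZ -rowmxD.
  by rewrite !mulmxDr -!scalemxAr !mulmxBr !mulmxA mulmxN !mulmxA !mulmx1.
rewrite (eq_bigr _ (fun i _ => e i)) sum_row_delta_alt !trmxK !mxtrace_tr.
by rewrite !mulmx1 row1 addrA.
Qed.

(** Both contractions of the commutator contain the cube of [A]; it cancels, and [A p *m A p]
    survives with the factor [u p]. *)
Lemma curv_opE p : W p ->
  curv_op p = (c * n%:R - \tr (A p *m A p)) *: A p - (c * u p)%:M + u p *: (A p *m A p).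
Proof.
move=> Wp; apply/row_matrixP => k; rewrite rowK.
rewrite (eq_bigr (fun i => row i (g p *m (A p *m riemann x i k p))
    - row i (g p *m riemann x i k p) *m A p)); last first.
  by move=> i _; rewrite mulmxBr rowmxB -row_mul -[in RHS]mulmxA.
rewrite sumrB -mulmx_suml sum_row_A_riemann // sum_row_riemann //.
have rZ (a : R) (X : 'M[R]_n) : row k (a *: X) = a *: row k X.
  by apply/rowP => j; rewrite !mxE.
rewrite rowmxD rowmxB !rZ mulmxBl mulmxDl -!scalemxAl -!row_mul.
have -> : delta_mx 0 k *m A p = row k (A p) by rewrite -rowE.
have -> : row k (c * u p)%:M = (c * u p) *: (delta_mx 0 k : 'rV_n).
  by rewrite -scalemx1 rZ row1.
move: (delta_mx 0 k : 'rV_n) (row k (A p)) (row k (A p *m A p)) (row k (A p *m A p *m A p)).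
by move=> d r1 r2 r3; apply/rowP => j; rewrite !mxE; ring.
Qed.

Lemma curvature_ricci p (v : 'rV[R]_n) : W p ->
  ricci x p v = v *m ((c * (n%:R - 1))%:M + u p *: A p - A p *m A p).
Proof.
move=> Wp; rewrite /ricci /vec_trace.
transitivity (\sum_k v 0 k *: (- \sum_i row i (g p *m riemann x i k p))).
  have e1 i j : curvature x p v (delta_mx 0 i) (delta_mx 0 j)
      = \sum_k v 0 k *: row j (riemann x k i p).
    rewrite (curvatureE x_atlas _ _ _ Wp); apply: eq_bigr => k _.
    rewrite (bigD1 i) //= big1 ?addr0 => [|l li]; rewrite mxE !eqxx /=.
      by rewrite mulr1 -rowE.
    by rewrite (negbTE li) mulr0 scale0r.
  transitivity (\sum_i \sum_k v 0 k *: row i (g p *m riemann x k i p)).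
    apply: eq_bigr => i _; rewrite (eq_bigr _ (fun j _ => congr1 _ (e1 i j))).
    rewrite (eq_bigr _ (fun j _ => scaler_sumr _ _ _ _)) exchange_big.
    apply: eq_bigr => k _ /=; rewrite row_mul mulmx_sum_row scaler_sumr.
    by apply: eq_bigr => j _; rewrite !scalerA mulrC mxE.
  rewrite exchange_big; apply: eq_bigr => k _ /=; rewrite -scaler_sumr -sumrN.
  congr (_ *: _); apply: eq_bigr => i _.
  by rewrite riemannN mulmxN rowmxN.
rewrite mulmx_sum_row; apply: eq_bigr => k _; congr (_ *: _).
rewrite sum_row_riemann // rowmxB rowmxD linearZ /=.
have -> : row k (c * (n%:R - 1))%:M = (c * (n%:R - 1)) *: (delta_mx 0 k : 'rV[R]_n).
  by rewrite -scalemx1 linearZ /= row1.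
by apply/rowP => j; rewrite !mxE; ring.
Qed.

Lemma curvature_scalar p : W p ->
  scalar_curvature x p = c * (n%:R * (n%:R - 1)) + u p ^+ 2 - \tr (A p *m A p).
Proof.
move=> Wp; rewrite /scalar_curvature.
rewrite (eq_bigr (fun i => ((c * (n%:R - 1))%:M + u p *: A p - A p *m A p) i i)).
  rewrite -/(\tr _) linearB /= mxtraceD linearZ /= mxtrace_scalar -mulr_natr /trace_fun.
  by ring.
by move=> i _; rewrite (curvature_ricci _ Wp) -rowE mxE.
Qed.

Lemma nabla_op_normsqE p : W p ->
  nabla_op_normsq x A p = \sum_i \tr (Q i p *m \sum_j g p i j *: Q j p).
Proof.
move=> Wp; rewrite /nabla_op_normsq.
have e1 i k : form_trace x p (\matrix_(j, l) inner x p
      (nabla_op x A (@coord_field R n M i) (@coord_field R n M j) p)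
      (nabla_op x A (@coord_field R n M k) (@coord_field R n M l) p))
    = \tr (Q i p *m Q k p).
  have -> : (\matrix_(j, l) inner x p
      (nabla_op x A (@coord_field R n M i) (@coord_field R n M j) p)
      (nabla_op x A (@coord_field R n M k) (@coord_field R n M l) p))
    = Q i p *m G p *m (Q k p)^T.
    apply/matrixP => j l; rewrite mxE !(nabla_opE _ _ smooth_A Wp) /inner.
    by rewrite -row_mul; exact: mul_row_tr_row.
  rewrite /form_trace -mulmxA cov_op_selfadj // !mulmxA mxtrace_mulC !mulmxA.
  by rewrite (mulmxV (uG Wp)) mul1mx.
rewrite /form_trace.
have -> : (\matrix_(i, k) form_trace x p (\matrix_(j, l) inner x p
      (nabla_op x A (@coord_field R n M i) (@coord_field R n M j) p)
      (nabla_op x A (@coord_field R n M k) (@coord_field R n M l) p)))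
   = \matrix_(i, k) \tr (Q i p *m Q k p) by apply: eq_mx => i k; exact: e1.
apply: eq_bigr => i _; rewrite mulmx_sumr linear_sum mxE; apply: eq_bigr => k _ /=.
by rewrite mxE -scalemxAr mxtraceZ mxtrace_mulC.
Qed.

Lemma grad_trace_sq p i : W p ->
  grad x (fun q => \tr (A q *m A q)) p 0 i
  = 2 * \tr (A p *m \sum_j g p i j *: Q j p).
Proof.
move=> Wp; rewrite gradE mxE mulmx_sumr linear_sum mulr_sumr; apply: eq_bigr => j _ /=.
rewrite differentialE -(trace_cov_op j (smooth_mxM smooth_A smooth_A) Wp).
rewrite (cov_opM j smooth_A smooth_A Wp) mxtraceD (mxtrace_mulC (Q j p)).
rewrite -scalemxAr mxtraceZ -[in LHS](invgram_tr x_atlas Wp) mxE /=; ring.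
Qed.

(** A Bochner formula. The terms in [\tr (Gam i p)] from the coordinate expression of the divergence
    are those built into [laplace_op]. *)
Lemma laplacian_trace_sq p : W p ->
  divg x (grad x (fun q => \tr (A q *m A q))) p
  = 2 * (nabla_op_normsq x A p + \tr (A p *m laplace_op p)).
Proof.
move=> Wp; rewrite -divgE (divergenceE x_atlas _ Wp) nabla_op_normsqE //.
rewrite /laplace_op mulmx_sumr linear_sum -big_split mulr_sumr /=.
apply: eq_bigr => i _; rewrite grad_trace_sq //.
have sAP : smooth_mx W (fun q => A q *m \sum_j g q i j *: Q j q).
  exact: smooth_mxM smooth_A (smooth_gQ i).
have -> : pdm x i (grad x (fun q => \tr (A q *m A q))) p 0 i
    = 2 * \tr (cov_op x i (fun q => A q *m \sum_j g q i j *: Q j q) p).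
  rewrite pdmE (trace_cov_op i sAP Wp).
  transitivity (pd x i (fun q => 2 * \tr (A q *m \sum_j g q i j *: Q j q)) p).
    by apply: (pd_ext i _ Wp) => q Wq; exact: grad_trace_sq.
  rewrite (pdM i (smooth_in_cst 2) (smooth_in_trace sAP) Wp) pd_cst.
  by rewrite mul0r add0r.
rewrite (cov_opM i smooth_A (smooth_gQ i) Wp) mxtraceD [in RHS]mulmxDr [in RHS]mxtraceD.
rewrite -scalemxAr mxtraceZ; ring.
Qed.

Lemma simons_identity p : W p ->
  divg x (grad x (fun q => \tr (A q *m A q))) p
  = 2 * (nabla_op_normsq x A p + \tr (cov_mx x (grad x u) p *m A p)
         + (c * n%:R - \tr (A p *m A p)) * \tr (A p *m A p) - c * u p ^+ 2
         + u p * \tr (A p *m A p *m A p)).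
Proof.
move=> Wp; rewrite laplacian_trace_sq // laplace_opE // curv_opE // mulmxDr mxtraceD.
rewrite (mxtrace_mulC (A p) (cov_mx _ _ _)) mulmxDr mulmxBr -!scalemxAr.
have trN (X : 'M[R]_n) : \tr (- X) = - \tr X by rewrite linearN.
rewrite mul_mx_scalar !mxtraceD trN !mxtraceZ mulmxA -/(u p); ring.
Qed.

End CodazziTensor.

(** * Product rules for gradients and for the divergence of a gradient *)

Section GradientCalculus.
Variables (R : realType) (n : nat) (M : riemannian R n) (x : chart R n M).
Hypothesis x_atlas : atlas x.
Variable W : subdomain x.
Implicit Types (p q : M) (h : M -> R) (v : 'rV[R]_n).

Lemma grad_ext h h' p : (forall q, W q -> h q = h' q) -> W p ->
  grad x h p = grad x h' p.
Proof. by move=> E Wp; rewrite !gradE (differential_ext E Wp). Qed.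

Lemma grad_cst (k : R) p : grad x (fun=> k) p = 0.
Proof. by rewrite gradE differential_cst mul0mx. Qed.

Lemma gradD h h' p : smooth_in x W h -> smooth_in x W h' -> W p ->
  grad x (fun q => h q + h' q) p = grad x h p + grad x h' p.
Proof. by move=> sh sh' Wp; rewrite !gradE (differentialD sh sh' Wp) mulmxDl. Qed.

Lemma gradM h h' p : smooth_in x W h -> smooth_in x W h' -> W p ->
  grad x (fun q => h q * h' q) p = h' p *: grad x h p + h p *: grad x h' p.
Proof.
move=> sh sh' Wp; rewrite !gradE (differentialM sh sh' Wp) mulmxDl.
by rewrite -!scalemxAl.
Qed.

Lemma gradZ (k : R) h p : smooth_in x W h -> W p ->
  grad x (fun q => k * h q) p = k *: grad x h p.
Proof.
move=> sh Wp; rewrite (gradM (smooth_in_cst k) sh Wp) grad_cst.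
by rewrite scaler0 add0r.
Qed.

Lemma dir_derivDl v v' h p :
  dir_deriv x (v + v') h p = dir_deriv x v h p + dir_deriv x v' h p.
Proof. by rewrite !dir_derivE mulmxDl mxE. Qed.

Lemma dir_derivZl (k : R) v h p : dir_deriv x (k *: v) h p = k * dir_deriv x v h p.
Proof. by rewrite !dir_derivE -scalemxAl mxE. Qed.

Lemma dir_derivNl v h p : dir_deriv x (- v) h p = - dir_deriv x v h p.
Proof. by rewrite -scaleN1r dir_derivZl mulN1r. Qed.

Lemma dir_derivM v h h' p : smooth_in x W h -> smooth_in x W h' -> W p ->
  dir_deriv x v (fun q => h q * h' q) p
  = h' p * dir_deriv x v h p + h p * dir_deriv x v h' p.
Proof.
move=> sh sh' Wp; rewrite !dir_derivE (differentialM sh sh' Wp) trmxD mulmxDr.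
by rewrite !trmxZ -!scalemxAr mxE [X in X + _]mxE [X in _ + X]mxE.
Qed.

Lemma dir_deriv_cst v (k : R) p : dir_deriv x v (fun=> k) p = 0.
Proof. by rewrite dir_derivE differential_cst trmx0 mulmx0 mxE. Qed.

Lemma dir_derivZr v (k : R) h p : smooth_in x W h -> W p ->
  dir_deriv x v (fun q => k * h q) p = k * dir_deriv x v h p.
Proof.
move=> sh Wp; rewrite (dir_derivM v (smooth_in_cst k) sh Wp).
by rewrite dir_deriv_cst mulr0 add0r.
Qed.

Lemma dir_grad v h p : W p -> dir_deriv x v h p = inner x p v (grad x h p).
Proof. by move=> Wp; rewrite (inner_grad x_atlas v h Wp). Qed.

Lemma dir_gradC h h' p : W p ->
  dir_deriv x (grad x h p) h' p = dir_deriv x (grad x h' p) h p.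
Proof.
move=> Wp; rewrite (dir_grad _ h' Wp) (dir_grad _ h Wp).
exact: (innerC x_atlas _ _ Wp).
Qed.

Local Notation Lap h p := (divg x (grad x h) p).

Lemma lap_ext h h' p : (forall q, W q -> h q = h' q) -> W p -> Lap h p = Lap h' p.
Proof.
by move=> E Wp; apply: (divergence_ext x_atlas _ Wp) => q Wq; exact: grad_ext E Wq.
Qed.

Lemma lapD h h' p : smooth_in x W h -> smooth_in x W h' -> W p ->
  Lap (fun q => h q + h' q) p = Lap h p + Lap h' p.
Proof.
move=> sh sh' Wp.
rewrite -(divergenceD x_atlas (smooth_grad x_atlas sh) (smooth_grad x_atlas sh') Wp).
by apply: (divergence_ext x_atlas _ Wp) => q Wq; exact: gradD.
Qed.

Lemma lapZ (k : R) h p : smooth_in x W h -> W p ->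
  Lap (fun q => k * h q) p = k * Lap h p.
Proof.
move=> sh Wp; have sg := smooth_grad x_atlas sh.
have := divergenceZ x_atlas (smooth_in_cst k) sg Wp.
rewrite dir_deriv_cst add0r => <-.
by apply: (divergence_ext x_atlas _ Wp) => q Wq; exact: gradZ.
Qed.

Lemma lapM h h' p : smooth_in x W h -> smooth_in x W h' -> W p ->
  Lap (fun q => h q * h' q) p
  = h' p * Lap h p + h p * Lap h' p + 2 * dir_deriv x (grad x h p) h' p.
Proof.
move=> sh sh' Wp; have sg := smooth_grad x_atlas sh; have sg' := smooth_grad x_atlas sh'.
transitivity (divg x (fun q => h' q *: grad x h q + h q *: grad x h' q) p).
  by apply: (divergence_ext x_atlas _ Wp) => q Wq; exact: gradM.
rewrite (divergenceD x_atlas (smooth_mxZ sh' sg) (smooth_mxZ sh sg') Wp).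
rewrite (divergenceZ x_atlas sh' sg Wp) (divergenceZ x_atlas sh sg' Wp).
rewrite (dir_gradC h' h Wp).
move: (divg x (grad x h) p) (divg x (grad x h') p) (dir_deriv x (grad x h p) h' p).
by move=> *; ring.
Qed.

End GradientCalculus.

(** * The identity for a Codazzi operator subject to the Gauss equation *)

Section MainIdentity.
Variables (R : realType) (n : nat) (c : R) (M : riemannian R n) (x : chart R n M).
Hypothesis n_gt0 : (0 < n)%N.
Hypothesis x_atlas : atlas x.
Variable W : subdomain x.
Variable A : M -> 'M[R]_n.
Hypothesis smooth_A : smooth_mx W A.
Hypothesis selfadj : forall p, W p -> gram x p *m (A p)^T = A p *m gram x p.
Hypothesis codazzi_A : forall p i j, W p ->
  row j (cov_op x i A p) = row i (cov_op x j A p).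
Hypothesis gauss_A : forall p i j, W p ->
  riemann x i j p = c *: (gram x p *m (delta_mx j 0 : 'cV_n) *m delta_mx 0 i
                          - gram x p *m (delta_mx i 0 : 'cV_n) *m delta_mx 0 j)
   + (A p *m gram x p *m (delta_mx j 0 : 'cV_n) *m delta_mx 0 i *m A p
      - A p *m gram x p *m (delta_mx i 0 : 'cV_n) *m delta_mx 0 j *m A p).
Implicit Types (p q : M).

Local Notation u := (trace_fun A).
Local Notation A2 := (trace_fun (fun q => A q *m A q)).
Local Notation gu := (grad x u).
Local Notation a := (fun q => grad x u q *m A q).
Variables (T : M -> 'rV[R]_n) (S2 : M -> R).
Hypothesis TE : forall q, W q -> T q = - (2 *: (gu q *m A q)) - u q *: gu q.
Hypothesis S2E : forall q, W q ->
  S2 q = (n%:R / 4 - 2) * (u q * u q * (u q * u q)) + 4 * (u q * u q * A2 q).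

Let su : smooth_in x W u. Proof. exact: smooth_in_trace. Qed.
Let suu : smooth_in x W (fun q => u q * u q). Proof. exact: smooth_inM su su. Qed.
Let suuuu : smooth_in x W (fun q => u q * u q * (u q * u q)).
Proof. exact: smooth_inM suu suu. Qed.
Let sA2 : smooth_in x W A2.
Proof. exact: smooth_in_trace (smooth_mxM smooth_A smooth_A). Qed.
Let sgu : smooth_mx W gu. Proof. exact: smooth_grad. Qed.
Let sa : smooth_mx W a. Proof. exact: smooth_mxM sgu smooth_A. Qed.

Lemma nabla_contractE p : W p -> nabla_contract x T A p = \tr (cov_mx x T p *m A p).
Proof.
move=> Wp; rewrite /nabla_contract /form_trace.
have -> : (\matrix_(i, j) inner x p (nabla x (@coord_field R n M i) T p)
     (delta_mx 0 j *m A p)) = cov_mx x T p *m gram x p *m (A p)^T.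
  apply/matrixP => i j; rewrite mxE nabla_coord /inner -rowE -(row_cov_mx x i).
  by rewrite -row_mul; exact: mul_row_tr_row.
rewrite -mulmxA selfadj // !mulmxA mxtrace_mulC !mulmxA.
by rewrite (mulmxV (gram_unit x_atlas Wp)) mul1mx.
Qed.

(** Each term becomes a polynomial in traces of powers of [A], [|nabla A|^2] and seven opaque
    scalars. With [a = A grad u] these are [L = div grad u], [Q = |grad u|^2], [P = <a, grad u>],
    [K = |a|^2], [X = <grad u, grad |A|^2>], [HA = <nabla grad u, A>] and [HB = <nabla a, A>].
    Simons' identity enters only through [|A|^2]. The [K] of the Ricci divergence cancels that of
    [|T|^2]. *)
Lemma codazzi_tensor_identity p : W p ->
  let mR : R := n%:R in
  let f := fun q => mR^-1 * u q in
  let s := scalar_curvature x in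
  2^-1 * laplacian x S2 p =
    4 * c * mR ^+ 4 * f p ^+ 4
    - 4 * mR ^+ 3 * f p ^+ 3 * \tr (A p *m A p *m A p)
    - 4 * mR ^+ 2 * f p ^+ 2 * A2 p * (c * mR - A2 p)
    - 8 * mR ^+ 4 * f p ^+ 2 * inner x p (grad x f p) (grad x f p)
    - 4 * mR ^+ 2 * f p ^+ 2 * nabla_op_normsq x A p
    + 4 * mR ^+ 2 * f p * inner x p (grad x s p) (grad x f p)
    - 8 * mR ^+ 2 * divergence x (fun q => f q *: ricci x q (grad x f q)) p
    - 2 * mR ^+ 2
        * divergence x (fun q => A2 q *: grad x (fun r => f r ^+ 2) q) p
    + mR ^+ 5 / 8 * laplacian x (fun q => f q ^+ 4) p
    - 4 * c * mR ^+ 2 * (mR - 1) * laplacian x (fun q => f q ^+ 2) p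
    - 10 * mR ^+ 2 * f p * inner x p (T p) (grad x f p)
    - 4 * mR ^+ 2 * f p ^+ 2 * divergence x T p
    - 2 * inner x p (T p) (T p)
    + 4 * mR * f p * nabla_contract x T A p.
Proof.
move=> Wp mR f s; rewrite /laplacian !divgE.
have m0 : mR != 0 by rewrite pnatr_eq0 -lt0n.
have [L LE] : exists t, t = divg x gu p by eexists.
have [Q QE] : exists t, t = dir_deriv x (gu p) u p by eexists.
have [P PE] : exists t, t = dir_deriv x (a p) u p by eexists.
have [K KE] : exists t, t = inner x p (a p) (a p) by eexists.
have [X XE] : exists t, t = dir_deriv x (gu p) A2 p by eexists.
have [HA HAE] : exists t, t = \tr (cov_mx x gu p *m A p) by eexists.
have [HB HBE] : exists t, t = \tr (cov_mx x a p *m A p) by eexists.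
have lap2 : divg x (grad x (fun q => u q * u q)) p = 2 * u p * L + 2 * Q.
  by rewrite (lapM x_atlas su su Wp) -LE -QE; ring.
have guu : grad x (fun q => u q * u q) p = (2 * u p) *: gu p.
  by rewrite (gradM su su Wp) -scalerDl; congr (_ *: _); ring.
have lap4 : divg x (grad x (fun q => u q * u q * (u q * u q))) p
    = 4 * u p ^+ 3 * L + 12 * u p ^+ 2 * Q.
  rewrite (lapM x_atlas suu suu Wp) lap2 guu dir_derivZl (dir_derivM _ su su Wp) -QE.
  ring.
have fE q : f q = mR^-1 * u q by [].
have gf q : W q -> grad x f q = mR^-1 *: gu q by move=> Wq; exact: (gradZ mR^-1 su Wq).
have diva : divg x a p = HA + Q.
  rewrite HAE QE. exact: (divergence_mulA smooth_A codazzi_A sgu Wp).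
have divaA : divg x (fun q => a q *m A q) p = HB + P.
  rewrite HBE PE; exact: (divergence_mulA smooth_A codazzi_A sa Wp).
have aAu : dir_deriv x (a p *m A p) u p = K.
  rewrite (dir_grad x_atlas _ _ Wp) KE /inner (trmxM (gu p) (A p)) !mulmxA.
  by rewrite -(mulmxA _ (gram x p) (A p)^T) selfadj // !mulmxA.
have au : inner x p (a p) (gu p) = P by rewrite (inner_grad x_atlas _ _ Wp) PE.
have guu' : inner x p (gu p) (gu p) = Q by rewrite (inner_grad x_atlas _ _ Wp) QE.
have t0 : divg x (grad x S2) p = ((mR / 4 - 2) * (4 * u p ^+ 3 * L + 12 * u p ^+ 2 * Q)
   + 4 * (A2 p * (2 * u p * L + 2 * Q) + u p ^+ 2 * divg x (grad x A2) p
          + 4 * u p * X)).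
  rewrite (lap_ext x_atlas S2E Wp).
  have s1 := smooth_inM (smooth_in_cst (mR / 4 - 2)) suuuu.
  have s2 := smooth_inM suu sA2.
  rewrite (lapD x_atlas s1 (smooth_inM (smooth_in_cst 4) s2) Wp).
  rewrite (lapZ x_atlas _ suuuu Wp) (lapZ x_atlas _ s2 Wp) lap4.
  rewrite (lapM x_atlas suu sA2 Wp) lap2 guu dir_derivZl -XE.
  ring.
have t5 : inner x p (grad x s p) (grad x f p) = mR^-1 * (2 * u p * Q - X).
  rewrite (inner_grad x_atlas _ _ Wp) (dir_derivZr _ _ su Wp); congr (_ * _).
  have -> : grad x s p = (2 * u p) *: gu p - grad x A2 p.
    transitivity (grad x (fun q => c * (n%:R * (n%:R - 1)) + (u q * u q + -1 * A2 q)) p).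
      apply: (grad_ext _ Wp) => q Wq.
      rewrite /s (curvature_scalar x_atlas selfadj gauss_A Wq); ring.
    have sB := smooth_inM (smooth_in_cst (-1)) sA2.
    rewrite (gradD (smooth_in_cst _) (smooth_inD suu sB) Wp) grad_cst add0r.
    by rewrite (gradD suu sB Wp) (gradZ _ sA2 Wp) guu scaleN1r.
  by rewrite dir_derivDl dir_derivNl dir_derivZl (dir_gradC x_atlas A2 u Wp) QE XE.
have t6 : divg x (fun q => f q *: ricci x q (grad x f q)) p = mR^-1 ^+ 2 *
   (c * (mR - 1) * (Q + u p * L) + 2 * u p * P + u p ^+ 2 * (HA + Q) - K - u p * (HB + P)).
  (* The Ricci operator is [c (m - 1) I + u A - A^2], so the field combines [u grad u],
     [u^2 A grad u] and [u A^2 grad u], to which the product rule and [divergence_mulA] apply. *)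
  transitivity (divg x (fun q => (mR^-1 ^+ 2 * c * (mR - 1)) *: (u q *: gu q)
     + (mR^-1 ^+ 2 *: ((u q * u q) *: a q) + (- mR^-1 ^+ 2) *: (u q *: (a q *m A q)))) p).
    apply: (divergence_ext x_atlas _ Wp) => q Wq.
    rewrite (curvature_ricci x_atlas selfadj gauss_A _ Wq) gf // fE.
    rewrite mulmxBr mulmxDr mul_mx_scalar -!scalemxAl -scalemxAr mulmxA.
    move: (gu q) (a q) (a q *m A q) => v1 v2 v3.
    by apply/rowP => j; rewrite !mxE; ring.
  have s1 := smooth_mxZ su sgu; have s2 := smooth_mxZ suu sa.
  have s3 := smooth_mxZ su (smooth_mxM sa smooth_A).
  have dZ (k : R) V : smooth_mx W V -> divg x (fun q => k *: V q) p = k * divg x V p.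
    move=> sV; rewrite (divergenceZ x_atlas (smooth_in_cst k) sV Wp).
    by rewrite dir_deriv_cst add0r.
  have sz (k : R) V : smooth_mx W V -> smooth_mx W (fun q => k *: V q).
    by move=> sV; exact: smooth_mxZ (smooth_in_cst k) sV.
  rewrite (divergenceD x_atlas (sz _ _ _ _ s1) (smooth_mxD (sz _ _ _ _ s2) (sz _ _ _ _ s3)) Wp).
  rewrite (divergenceD x_atlas (sz _ _ _ _ s2) (sz _ _ _ _ s3) Wp) (dZ _ _ s1) (dZ _ _ s2) (dZ _ _ s3).
  rewrite (divergenceZ x_atlas su sgu Wp) (divergenceZ x_atlas suu sa Wp).
  rewrite (divergenceZ x_atlas su (smooth_mxM sa smooth_A) Wp).
  rewrite (dir_derivM _ su su Wp) diva divaA aAu -LE -QE -PE.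
  ring.
have t7 : divg x (fun q => A2 q *: grad x (fun r => f r ^+ 2) q) p
   = mR^-1 ^+ 2 * 2 * (u p * X + A2 p * Q + A2 p * u p * L).
  transitivity (divg x (fun q => (mR^-1 ^+ 2 * 2 * (A2 q * u q)) *: gu q) p).
    apply: (divergence_ext x_atlas _ Wp) => q Wq.
    have -> : grad x (fun r => f r ^+ 2) q = grad x (fun r => mR^-1 ^+ 2 * (u r * u r)) q.
      by apply: (grad_ext _ Wq) => r Wr; rewrite fE; ring.
    rewrite (gradZ _ suu Wq) (gradM su su Wq) -scalerDl !scalerA; congr (_ *: _); ring.
  have sAu := smooth_inM sA2 su.
  rewrite (divergenceZ x_atlas (smooth_inM (smooth_in_cst _) sAu) sgu Wp).
  rewrite (dir_derivZr _ _ sAu Wp) (dir_derivM _ sA2 su Wp) -LE -QE -XE.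
  ring.
have t8 : divg x (grad x (fun q => f q ^+ 4)) p
    = mR^-1 ^+ 4 * (4 * u p ^+ 3 * L + 12 * u p ^+ 2 * Q).
  rewrite -lap4 -(lapZ x_atlas _ suuuu Wp).
  by apply: (lap_ext x_atlas _ Wp) => q _; rewrite fE; ring.
have t9 : divg x (grad x (fun q => f q ^+ 2)) p = mR^-1 ^+ 2 * (2 * u p * L + 2 * Q).
  rewrite -lap2 -(lapZ x_atlas _ suu Wp).
  by apply: (lap_ext x_atlas _ Wp) => q _; rewrite fE; ring.
have t10 : inner x p (T p) (grad x f p) = mR^-1 * (- 2 * P - u p * Q).
  rewrite (inner_grad x_atlas _ _ Wp) (dir_derivZr _ _ su Wp) TE //.
  by rewrite dir_derivDl !dir_derivNl !dir_derivZl -PE -QE; ring.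
have sT1 := smooth_mxZ (smooth_in_cst (- 2)) sa.
have sT2 := smooth_mxZ (smooth_inM (smooth_in_cst (-1)) su) sgu.
have TE' q : W q -> T q = (- 2) *: a q + (-1 * u q) *: gu q.
  by move=> Wq; rewrite TE // scaleNr mulN1r scaleNr.
have t11 : divg x T p = - 2 * (HA + Q) - (Q + u p * L).
  rewrite (divergence_ext x_atlas TE' Wp) (divergenceD x_atlas sT1 sT2 Wp).
  rewrite (divergenceZ x_atlas (smooth_in_cst (- 2)) sa Wp) diva.
  rewrite (divergenceZ x_atlas (smooth_inM (smooth_in_cst (-1)) su) sgu Wp).
  rewrite (dir_derivZr _ _ su Wp) -LE -QE dir_deriv_cst.
  ring.
have t12 : inner x p (T p) (T p) = 4 * K + 4 * u p * P + u p ^+ 2 * Q.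
  rewrite TE' // !innerE (innerC x_atlas (gu p) (a p) Wp) au guu' -KE.
  ring.
have t13 : nabla_contract x T A p = - 2 * HB - P - u p * HA.
  rewrite nabla_contractE // (cov_mx_ext TE' Wp) (cov_mxD sT1 sT2 Wp).
  rewrite (cov_mxZ (smooth_in_cst (- 2)) sa Wp) differential_cst trmx0 mul0mx add0r.
  rewrite (cov_mxZ (smooth_inM (smooth_in_cst (-1)) su) sgu Wp).
  rewrite !mulmxDl !mxtraceD -!scalemxAl !mxtraceZ -HAE -HBE.
  have -> : \tr ((differential x (fun q => -1 * u q) p)^T *m gu p *m A p) = - P.
    rewrite -mulmxA mxtrace_mulC [LHS]big_ord1 -dir_derivE.
    by rewrite (dir_derivZr _ _ su Wp) mulN1r PE.
  ring.
rewrite t0 t5 t6 t7 t8 t9 t10 t11 t12 t13 gf // !innerE guu'.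
rewrite (simons_identity x_atlas smooth_A selfadj codazzi_A gauss_A Wp) -HAE.
rewrite !fE /trace_fun; move: (nabla_op_normsq x A p) (\tr (A p *m A p *m A p)) (\tr (A p *m A p)) (\tr (A p)).
by move=> N2 S3 B2 v; field.
Qed.

End MainIdentity.

(** * The data of an isometric immersion *)

HB.lock Definition immersion_mx (R : realType) (n k : nat) (M : riemannian R n)
    (N : riemannian R k) (phi : M -> N) (x : chart R n M) (y : chart R k N) (p : M) :
  'M[R]_(n, k) := dphi_mx phi x y p.
Arguments immersion_mx {R n k M N} phi x y p.

HB.lock Definition pulled_gram (R : realType) (n k : nat) (M : riemannian R n)
    (N : riemannian R k) (phi : M -> N) (y : chart R k N) (p : M) : 'M[R]_k :=
  gram y (phi p).
Arguments pulled_gram {R n k M N} phi y p.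

HB.lock Definition pulled_christoffel (R : realType) (n k : nat) (M : riemannian R n)
    (N : riemannian R k) (phi : M -> N) (x : chart R n M) (y : chart R k N)
    (i : 'I_n) (p : M) : 'M[R]_k :=
  \sum_b immersion_mx phi x y p i b *: christoffel_mx y b (phi p).
Arguments pulled_christoffel {R n k M N} phi x y i p.

Section Immersion.
Variables (R : realType) (n : nat) (c : R).
Variables (M : riemannian R n) (N : riemannian R n.+1) (phi : M -> N).
Hypothesis N_space_form : space_form c N.
Hypothesis phi_isometric : isometric_immersion phi.
Variables (x : chart R n M) (y : chart R n.+1 N).
Hypothesis (x_atlas : atlas x) (y_atlas : atlas y).
Variables (W : subdomain x) (Y : subdomain y).
Hypothesis WY : forall p, W p -> Y (phi p).
Variable eta : M -> 'rV[R]_n.+1.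
Hypothesis eta_normal : unit_normal phi x y W eta.
Implicit Types (p q : M) (i j : 'I_n) (V : M -> 'rV[R]_n.+1).

Local Notation Phi := (immersion_mx phi x y).
Local Notation Om := (pulled_christoffel phi x y).
Local Notation h := (pulled_gram phi y).

Lemma immersion_mxE p i b : Phi p i b = pd x i (fun q => Defs.coord y (phi q) 0 b) p.
Proof. by rewrite immersion_mx.unlock mxE. Qed.

Lemma pulled_christoffelE i p : Om i p = \sum_b Phi p i b *: christoffel_mx y b (phi p).
Proof. by rewrite pulled_christoffel.unlock. Qed.

Lemma pulled_gramE p : h p = gram y (phi p).
Proof. by rewrite pulled_gram.unlock. Qed.

Let smooth_coord b : smooth_in x W (fun p => Defs.coord y (phi p) 0 b).
Proof.
have [[_ sphi] _] := phi_isometric.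
apply: smooth_on_subset (sphi x y x_atlas y_atlas b).
move=> _ [p [Wp xp] <-]; exists p => //; split=> //.
exact: (subdomain_dom (WY Wp)).
Qed.

Let smooth_Phi_entry i b : smooth_in x W (fun p => Phi p i b).
Proof.
apply: smooth_in_ext (smooth_in_pd i (smooth_coord b)) => q _.
by rewrite immersion_mxE.
Qed.

Lemma smooth_immersion_mx : smooth_mx W Phi.
Proof. by move=> i b; exact: smooth_Phi_entry. Qed.

Lemma smooth_mx_comp a b (T : N -> 'M[R]_(a, b)) :
  smooth_mx Y T -> smooth_mx W (fun p => T (phi p)).
Proof. by move=> sT k l; exact: (smooth_in_comp WY smooth_coord (sT k l)). Qed.

Lemma pdm_chain a b (T : N -> 'M[R]_(a, b)) i p : smooth_mx Y T -> W p ->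
  pdm x i (fun q => T (phi q)) p = \sum_d Phi p i d *: pdm y d T (phi p).
Proof.
move=> sT Wp; apply/matrixP => k l; rewrite pdmE summxE.
have := pd_chain WY smooth_coord (sT k l) i Wp; rewrite /comp => ->.
by apply: eq_bigr => d _; rewrite mxE pdmE immersion_mxE.
Qed.

Let smooth_gam b : smooth_mx W (fun p => christoffel_mx y b (phi p)).
Proof. by apply: smooth_mx_comp; exact: smooth_christoffel. Qed.

Lemma smooth_pulled_gram : smooth_mx W h.
Proof.
have sG : smooth_mx Y (gram y) by exact: smooth_gram.
by apply: smooth_mx_ext (smooth_mx_comp sG) => q _; rewrite pulled_gramE.
Qed.

Let smooth_term i b : smooth_mx W (fun p => Phi p i b *: christoffel_mx y b (phi p)).
Proof. exact: smooth_mxZ (smooth_Phi_entry i b) (smooth_gam b). Qed.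

Lemma smooth_pulled_christoffel i : smooth_mx W (Om i).
Proof.
have s := smooth_mx_sum (index_enum _) (smooth_term i).
by apply: smooth_mx_ext s => q _; rewrite pulled_christoffelE.
Qed.

Lemma pdm_pulled_gram i p : W p ->
  pdm x i h p = Om i p *m h p + h p *m (Om i p)^T.
Proof.
move=> Wp; have sG : smooth_mx Y (gram y) by exact: smooth_gram.
rewrite (pdm_ext i (fun q _ => pulled_gramE q) Wp) (pdm_chain i sG Wp).
rewrite pulled_christoffelE pulled_gramE mulmx_suml.
have -> : (\sum_b Phi p i b *: christoffel_mx y b (phi p))^T
    = \sum_b Phi p i b *: (christoffel_mx y b (phi p))^T.
  by rewrite linear_sum; apply: eq_bigr => b _; exact: trmxZ.
rewrite mulmx_sumr -big_split; apply: eq_bigr => b _ /=.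
by rewrite (pdm_gram y_atlas b (WY Wp)) scalerDr scalemxAl scalemxAr.
Qed.

Lemma immersion_mx_isometric p : W p -> Phi p *m h p *m (Phi p)^T = gram x p.
Proof.
move=> Wp; have [_ iso] := phi_isometric.
apply/matrixP => i j.
have := iso x y p (delta_mx 0 i) (delta_mx 0 j) x_atlas y_atlas
  (subdomain_dom Wp) (subdomain_dom (WY Wp)).
rewrite /inner -!rowE -row_mul mul_row_tr_row pulled_gramE.
rewrite immersion_mx.unlock => ->; rewrite trmx_delta -colE.
by rewrite [LHS]mxE [LHS]mxE.
Qed.

Lemma row_mul_pulled_christoffel (v : 'rV[R]_n.+1) i p :
  v *m Om i p = \sum_b \sum_d (Phi p i b * v 0 d) *: christoffel y (phi p) b d.
Proof.
rewrite pulled_christoffelE mulmx_sumr; apply: eq_bigr => b _.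
rewrite -scalemxAr mulmx_sum_row scaler_sumr; apply: eq_bigr => d _.
by rewrite scalerA row_christoffel.
Qed.

Lemma pdm_row_immersion_mx p i j : W p ->
  row j (pdm x i Phi p) = row i (pdm x j Phi p).
Proof.
move=> Wp; apply/rowP => b; rewrite ![row _ _ _ _]mxE !pdmE.
have e k : (fun q => Phi q k b) = pd x k (fun q => Defs.coord y (phi q) 0 b).
  by apply/funext => q; rewrite immersion_mxE.
by rewrite !e; exact: (pdC i j (smooth_coord b) Wp).
Qed.

(** Symmetry of the second derivatives of [phi] handles the first summand, that of the Christoffel
    symbols of [N] the second. *)
Lemma immersion_mx_torsion i j p : W p ->
  row j (pdm x i Phi p + Phi p *m Om i p) = row i (pdm x j Phi p + Phi p *m Om j p).
Proof.
move=> Wp; rewrite !rowmxD (pdm_row_immersion_mx i j Wp); congr (_ + _).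
rewrite !row_mul !row_mul_pulled_christoffel exchange_big /=.
apply: eq_bigr => d _; apply: eq_bigr => b _.
rewrite (christoffelC y_atlas b d (WY Wp)) ![row _ _ _ _]mxE.
by rewrite mulrC.
Qed.

(** The curvature of the pullback connection is the pullback of the curvature of [N]: the terms with
    second derivatives of [phi] are symmetric in [i] and [j] and drop out. *)
Lemma pulled_curvature i j p : W p ->
  pdm x i (Om j) p - pdm x j (Om i) p + Om j p *m Om i p - Om i p *m Om j p
  = riemann_op y (row i (Phi p)) (row j (Phi p)) (phi p).
Proof.
move=> Wp.
have sC b : smooth_mx Y (christoffel_mx y b) by exact: smooth_christoffel.
have dOm k l : pdm x k (Om l) p =
    \sum_d pd x k (fun q => Phi q l d) p *: christoffel_mx y d (phi p)
    + \sum_b \sum_d (Phi p k b * Phi p l d) *: pdm y b (christoffel_mx y d) (phi p).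
  rewrite (pdm_ext k (fun q _ => pulled_christoffelE l q) Wp).
  rewrite (pdm_sum (index_enum _) k (smooth_term l) Wp).
  rewrite [X in _ = _ + X]exchange_big -big_split; apply: eq_bigr => d _ /=.
  rewrite (pdmZ k (smooth_Phi_entry l d) (smooth_gam d) Wp); congr (_ + _).
  rewrite (pdm_chain k (sC d) Wp) scaler_sumr; apply: eq_bigr => b _.
  by rewrite scalerA mulrC.
have prod k l : Om k p *m Om l p = \sum_b \sum_d (Phi p k b * Phi p l d)
     *: (christoffel_mx y b (phi p) *m christoffel_mx y d (phi p)).
  rewrite !pulled_christoffelE mulmx_suml; apply: eq_bigr => b _.
  rewrite mulmx_sumr; apply: eq_bigr => d _.
  by rewrite -scalemxAl -scalemxAr scalerA.
have first : \sum_d pd x i (fun q => Phi q j d) p *: christoffel_mx y d (phi p)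
    = \sum_d pd x j (fun q => Phi q i d) p *: christoffel_mx y d (phi p).
  apply: eq_bigr => d _; congr (_ *: _).
  have := congr1 (fun r : 'rV[R]_n.+1 => r 0 d) (pdm_row_immersion_mx i j Wp).
  by rewrite /= ![row _ _ _ _]mxE !pdmE.
rewrite !dOm first opprD addrACA subrr add0r !prod.
rewrite [X in _ - X + _ - _]exchange_big [X in _ + X - _]exchange_big /=.
rewrite -sumrB -big_split -sumrB; apply: eq_bigr => b _ /=.
rewrite -sumrB -big_split -sumrB; apply: eq_bigr => d _ /=.
rewrite ![row _ _ _ _]mxE (mulrC (Phi p j d)) /riemann.
by rewrite !scalerDr !scalerN.
Qed.

Lemma riemann_op_space_form (u v : 'rV[R]_n.+1) (q : N) : Y q ->
  riemann_op y u v q = c *: (gram y q *m v^T *m u - gram y q *m u^T *m v).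
Proof.
move=> Yq; apply/row_matrixP => k; rewrite rowE [RHS]rowE.
rewrite (space_form_curvature N_space_form y_atlas _ _ _ Yq) -scalemxAr.
congr (_ *: _); rewrite mulmxBr !mulmxA /inner.
have e (d w z : 'rV[R]_n.+1) : (w *m gram y q *m d^T) 0 0 *: z
    = d *m gram y q *m w^T *m z.
  have -> : d *m gram y q *m w^T = (w *m gram y q *m d^T)^T.
    by rewrite !trmxM trmxK (gram_tr y_atlas Yq) mulmxA.
  rewrite -[X in X *: z]trace_mx11 -mxtrace_tr trace_mx11 -mul_scalar_mx.
  by rewrite -mx11_scalar.
by rewrite !e.
Qed.

Lemma immersion_dataP : immersion_data c W h Phi Om eta.
Proof.
have [seta eta1 eta0] := eta_normal.
split.
- exact: smooth_pulled_gram.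
- exact: smooth_immersion_mx.
- exact: smooth_pulled_christoffel.
- by move=> k l; rewrite ord1; exact: seta.
- by move=> p Wp; rewrite pulled_gramE; exact: (gram_tr y_atlas (WY Wp)).
- exact: pdm_pulled_gram.
- exact: immersion_mx_isometric.
- exact: immersion_mx_torsion.
- move=> p Wp; rewrite pulled_gramE [LHS]mx11_scalar; congr (_%:M).
  exact: eta1.
- move=> p Wp; rewrite pulled_gramE; apply/matrixP => i j; rewrite ord1 [RHS]mxE.
  have := eta0 p Wp i; rewrite /inner -!row_mul immersion_mx.unlock => <-.
  by rewrite [RHS]mxE.
- move=> i j p Wp; rewrite (pulled_curvature i j Wp) (riemann_op_space_form _ _ (WY Wp)).
  by rewrite pulled_gramE.
Qed.

End Immersion.

(** * Tension, bitension and stress-energy of a hypersurface *)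

Section TensionFields.
Variables (R : realType) (n : nat) (c : R).
Variables (M : riemannian R n) (N : riemannian R n.+1) (phi : M -> N).
Hypothesis N_space_form : space_form c N.
Hypothesis phi_isometric : isometric_immersion phi.
Variables (x : chart R n M) (y : chart R n.+1 N).
Hypothesis (x_atlas : atlas x) (y_atlas : atlas y).
Variables (W : subdomain x) (Y : subdomain y).
Hypothesis WY : forall p, W p -> Y (phi p).
Variable eta : M -> 'rV[R]_n.+1.
Hypothesis eta_normal : unit_normal phi x y W eta.
Implicit Types (p q : M) (i j : 'I_n) (V : M -> 'rV[R]_n.+1).

Local Notation Phi := (immersion_mx phi x y).
Local Notation Om := (pulled_christoffel phi x y).
Local Notation h := (pulled_gram phi y).
Local Notation b := (sff x h Phi Om eta).
Local Notation A := (shape x h Phi Om eta).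
Local Notation u := (trace_fun A).
Local Notation E := (@coord_field R n M).
Local Notation g := (fun p => invmx (gram x p)).

Let data := immersion_dataP N_space_form phi_isometric x_atlas y_atlas WY eta_normal.
Let sA : smooth_mx W A := smooth_shape x_atlas data.
Let su : smooth_in x W u := smooth_in_trace sA.
Let seta := immersion_eta_smooth data.
Let sPhi := immersion_Phi_smooth data.

Lemma nabla_phiE X V p : nabla_phi phi x y X V p
  = \sum_i X p 0 i *: (pdm x i V p + V p *m Om i p).
Proof.
apply: eq_bigr => i _; congr (_ *: (_ + _)).
  by apply/rowP => d; rewrite pdmE mxE.
by rewrite row_mul_pulled_christoffel immersion_mx.unlock.
Qed.

Lemma nabla_phi_coord i V p : nabla_phi phi x y (E i) V p = pdm x i V p + V p *m Om i p.
Proof.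
rewrite nabla_phiE (bigD1 i) //= big1 => [|j ji]; rewrite /coord_field mxE !eqxx /=.
  by rewrite scale1r addr0.
by rewrite (negbTE ji) scale0r.
Qed.

Lemma dphi_coord j p : dphi phi x y (E j) p = row j (Phi p).
Proof. by rewrite rowE immersion_mx.unlock. Qed.

Lemma nabla_coord_coord i j p : nabla x (E i) (E j) p = row j (christoffel_mx x i p).
Proof. by rewrite nabla_coord /cov /coord_field pdm_cst add0r rowE. Qed.

Lemma second_fundamental_coord i j p : W p ->
  second_fundamental phi x y (E i) (E j) p = b p i j *: eta p.
Proof.
move=> Wp; rewrite /second_fundamental nabla_phi_coord /dphi nabla_coord_coord.
rewrite -/(dphi phi x y (E j)) (pdm_ext i (fun q _ => dphi_coord j q) Wp) pdm_row.
have -> : coord_field j p *m dphi_mx phi x y p = row j (Phi p) by exact: dphi_coord.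
have -> : dphi_mx phi x y p = Phi p by rewrite immersion_mx.unlock.
rewrite -!row_mul -rowmxD -rowmxB.
have := sff_mxE x_atlas data i Wp; rewrite /sff_mx => ->.
by apply/rowP => d; rewrite mxE mxE big_ord1 [X in X * _]mxE [X in X * _]mxE [RHS]mxE.
Qed.

Let inner_eta p : W p -> inner y (phi p) (eta p) (eta p) = 1.
Proof. by case: eta_normal => _ + _; apply. Qed.

Let inner_Phi_eta p i : W p -> inner y (phi p) (row i (Phi p)) (eta p) = 0.
Proof. by rewrite immersion_mx.unlock; case: eta_normal => _ _ + Wp; apply. Qed.

Let inner_pulled p v w : inner y (phi p) v w = (v *m h p *m w^T) 0 0.
Proof. by rewrite pulled_gramE. Qed.

Lemma shape_operatorE p : W p -> shape_operator phi x y eta p = A p.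
Proof.
move=> Wp; rewrite /shape_operator /shape; congr (_ *m _).
apply/matrixP => i j; rewrite mxE (second_fundamental_coord i j Wp) innerZl.
by rewrite (inner_eta Wp) mulr1.
Qed.

Let g_tr p : W p -> (g p)^T = g p.
Proof. exact: invgram_tr. Qed.

Lemma tensionE p : W p -> tension phi x y p = u p *: eta p.
Proof.
move=> Wp; rewrite /tension /vec_trace.
under eq_bigr => i _ do under eq_bigr => j _ do
  rewrite (second_fundamental_coord i j Wp) scalerA.
rewrite /trace_fun /shape /mxtrace scaler_suml; apply: eq_bigr => i _.
rewrite mxE scaler_suml; apply: eq_bigr => j _.
by rewrite mulrC -[in RHS](g_tr Wp) [X in _ = (_ * X) *: _]mxE.
Qed.

Lemma nabla_tension j p : W p -> nabla_phi phi x y (E j) (tension phi x y) p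
  = pd x j u p *: eta p - u p *: (row j (A p) *m Phi p).
Proof.
move=> Wp; rewrite nabla_phi_coord (pdm_ext j tensionE Wp) (tensionE Wp).
rewrite (pdmZ j su seta Wp) (weingarten x_atlas data j Wp).
move: (pd x j u p) (u p) => d t; mx_abel.
Qed.

(** The normal part stays an unspecified multiple of [eta], because the tangential bitension field
    pairs with the image of the differential and does not see it. *)
Lemma nabla_phi2_tension i j p : W p -> exists z,
  nabla_phi phi x y (E i) (nabla_phi phi x y (E j) (tension phi x y)) p
  - nabla_phi phi x y (nabla x (E i) (E j)) (tension phi x y) p
  = (- (pd x j u p *: row i (A p)) - pd x i u p *: row j (A p)
     - u p *: row j (cov_op x i A p)) *m Phi p + z *: eta p.
Proof.
move=> Wp; have sAj := smooth_mx_row j sA.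
have sPj : smooth_mx W (fun q => row j (A q) *m Phi q) := smooth_mxM sAj sPhi.
have sdj : smooth_in x W (pd x j u) := smooth_in_pd j su.
have e1 := smooth_mxZ sdj seta; have e2 := smooth_mxZ su sPj.
rewrite nabla_phi_coord (nabla_tension j Wp) (pdm_ext i (fun q => @nabla_tension j q) Wp).
rewrite (pdmB i e1 e2 Wp) (pdmZ i sdj seta Wp) (pdmZ i su sPj Wp) (pdmM i sAj sPhi Wp).
rewrite pdm_row (pdm_Phi x_atlas data i Wp) (weingarten x_atlas data i Wp).
have -> : nabla_phi phi x y (nabla x (E i) (E j)) (tension phi x y) p
    = \sum_k row j (christoffel_mx x i p) 0 k
        *: (pd x k u p *: eta p - u p *: (row k (A p) *m Phi p)).
  rewrite nabla_phiE nabla_coord_coord; apply: eq_bigr => k _.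
  by rewrite -(nabla_tension k Wp) nabla_phi_coord.
have [s sE] : exists s, s = \sum_k row j (christoffel_mx x i p) 0 k * pd x k u p by eexists.
have -> : \sum_k row j (christoffel_mx x i p) 0 k
        *: (pd x k u p *: eta p - u p *: (row k (A p) *m Phi p))
    = s *: eta p - u p *: (row j (christoffel_mx x i p) *m A p *m Phi p).
  rewrite (mulmx_sum_row _ (A p)) mulmx_suml scaler_sumr sE scaler_suml -sumrB.
  apply: eq_bigr => k _; rewrite scalerBr !scalerA -scalemxAl scalerA.
  by rewrite [u p * _]mulrC.
have [z zE] : exists z : R, row j (A p) *m ((row i (b p))^T *m eta p) = z *: eta p.
  by eexists; rewrite mulmxA [X in X *m _]mx11_scalar mul_scalar_mx.
exists (pd x i (pd x j u) p - s - u p * z).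
rewrite /cov_op rowmxB rowmxD (row_mul j (A p) (christoffel_mx x i p)).
rewrite (row_mul j (christoffel_mx x i p) (A p)).
have -> : row j (A p) *m (christoffel_mx x i p *m Phi p - Phi p *m Om i p
     + (row i (b p))^T *m eta p)
   = row j (A p) *m christoffel_mx x i p *m Phi p - row j (A p) *m Phi p *m Om i p
     + z *: eta p.
  by rewrite -zE; mx_abel.
move: (pd x j u p) (pd x i u p) (u p) (pd x i (pd x j u) p) => d d' t dd.
mx_abel.
Qed.

Lemma bitensionE p : W p -> exists z, bitension phi x y p
  = (- (2 *: (grad x u p *m A p)) - u p *: grad x u p) *m Phi p + z *: eta p.
Proof.
move=> Wp; rewrite /bitension /rough_laplacian opprK.
(* In a space form [R(X, eta)Y] is a multiple of [eta] for tangent [X] and [Y], so the curvature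
   trace contributes nothing tangential. *)
have [k1 k1E] : exists k : R, vec_trace x p (fun i j =>
      curvature y (phi p) (row i (dphi_mx phi x y p)) (tension phi x y p)
        (row j (dphi_mx phi x y p))) = k *: eta p.
  exists (\sum_i \sum_j g p i j * (c * - (gram x p i j * u p))).
  rewrite /vec_trace scaler_suml; apply: eq_bigr => i _.
  rewrite scaler_suml; apply: eq_bigr => j _; rewrite -scalerA; congr (_ *: _).
  have -> : dphi_mx phi x y p = Phi p by rewrite immersion_mx.unlock.
  rewrite (curvature_op y_atlas _ _ _ (WY Wp)) (space_form_curvature N_space_form y_atlas _ _ _ (WY Wp)) (tensionE Wp).
  rewrite innerZl (innerC y_atlas _ _ (WY Wp)) (inner_Phi_eta j Wp) mulr0 scale0r sub0r.
  rewrite inner_pulled -row_mul mul_row_tr_row (immersion_isometric data Wp).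
  by rewrite scalerA -scaleNr scalerA.
rewrite k1E /vec_trace.
have [z zE] : exists z : 'I_n -> 'I_n -> R, forall i j,
   nabla_phi phi x y (E i) (nabla_phi phi x y (E j) (tension phi x y)) p
  - nabla_phi phi x y (nabla x (E i) (E j)) (tension phi x y) p
  = (- (pd x j u p *: row i (A p)) - pd x i u p *: row j (A p)
     - u p *: row j (cov_op x i A p)) *m Phi p + z i j *: eta p.
  have [z zE] := choice (fun ij => @nabla_phi2_tension ij.1 ij.2 p Wp).
  by exists (fun i j => z (i, j)) => i j; exact: (zE (i, j)).
exists (\sum_i \sum_j g p i j * z i j - k1).
have -> : - (2 *: (grad x u p *m A p)) - u p *: grad x u p
  = \sum_i \sum_j g p i j *: (- (pd x j u p *: row i (A p)) - pd x i u p *: row j (A p)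
     - u p *: row j (cov_op x i A p)).
  have gE : grad x u p *m A p = \sum_i \sum_j (g p i j * pd x i u p) *: row j (A p).
    rewrite (gradE x) mulmx_sum_row exchange_big /=; apply: eq_bigr => j _.
    rewrite mxE scaler_suml; apply: eq_bigr => i _.
    by rewrite differentialE mulrC.
  have gE' : grad x u p *m A p = \sum_i \sum_j (g p i j * pd x j u p) *: row i (A p).
    rewrite gE exchange_big /=; apply: eq_bigr => i _; apply: eq_bigr => j _.
    by rewrite -[in LHS](g_tr Wp) [X in (X * _) *: _]mxE.
  (* The divergence of [A] being [grad u], the term with a derivative of [A] gives [- u grad u]; the
     other two each give [- A grad u] by symmetry of the inverse metric. *)
  have sE := sum_row_cov_op x_atlas sA
    (fun q Wq => gram_shape_tr x_atlas data Wq) (fun q i j => codazzi x_atlas data i j) Wp.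
  transitivity (- (\sum_i \sum_j (g p i j * pd x j u p) *: row i (A p))
    - \sum_i \sum_j (g p i j * pd x i u p) *: row j (A p)
    - u p *: \sum_i row i (g p *m cov_op x i A p)).
    by rewrite -gE' -gE sE scaler_nat mulr2n opprD.
  rewrite scaler_sumr -!sumrN -!big_split; apply: eq_bigr => i _ /=.
  have -> : row i (g p *m cov_op x i A p) = \sum_j g p i j *: row j (cov_op x i A p).
    by rewrite row_mul mulmx_sum_row; apply: eq_bigr => j _; rewrite mxE.
  rewrite scaler_sumr -!sumrN -!big_split; apply: eq_bigr => j _ /=.
  by rewrite !scalerDr !scalerN !scalerA [u p * _]mulrC.
rewrite scalerBl addrA; congr (_ - _).
rewrite mulmx_suml scaler_suml -big_split; apply: eq_bigr => i _ /=.
rewrite mulmx_suml scaler_suml -big_split; apply: eq_bigr => j _ /=.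
by rewrite zE scalerDr scalerA scalemxAl.
Qed.

Lemma bitension_tanE p : W p -> bitension_tan phi x y p
  = - (2 *: (grad x u p *m A p)) - u p *: grad x u p.
Proof.
move=> Wp; have [z zE] := bitensionE Wp; rewrite /bitension_tan.
move: zE; set X := - _ - _ => zE.
have -> : \row_j inner y (phi p) (bitension phi x y p) (row j (dphi_mx phi x y p))
    = X *m gram x p.
  apply/rowP => j; rewrite mxE.
  have -> : dphi_mx phi x y p = Phi p by rewrite immersion_mx.unlock.
  rewrite zE innerDl innerZl (innerC y_atlas (eta p) (row j (Phi p)) (WY Wp)) (inner_Phi_eta j Wp) mulr0 addr0.
  rewrite inner_pulled -[_ *m h p](row_id 0) mul_row_tr_row.
  by rewrite -(immersion_isometric data Wp) !mulmxA.
by rewrite (mulmxK (gram_unit x_atlas Wp)).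
Qed.

(** By [nabla_tension] the matrix [D] is [- u b], with trace [- u^2]; the coefficient of the metric
    is therefore [u^2 / 2 - u^2], and [- D - D^T] gives [2 u b]. *)
Lemma stress_energyE p : W p -> stress_energy phi x y p
  = (2 * u p) *: b p - (u p * u p / 2) *: gram x p.
Proof.
move=> Wp; rewrite /stress_energy.
have -> : (\matrix_(i, j) inner y (phi p) (row i (dphi_mx phi x y p))
             (nabla_phi phi x y (E j) (tension phi x y) p)) = - (u p *: b p).
  apply/matrixP => i j; rewrite mxE (nabla_tension j Wp).
  have -> : dphi_mx phi x y p = Phi p by rewrite immersion_mx.unlock.
  rewrite innerDr innerNr !innerZr (inner_Phi_eta i Wp) mulr0 add0r [RHS]mxE [in RHS]mxE.
  congr (- (_ * _)).
  rewrite inner_pulled -(row_mul i _ (h p)) -(row_mul j) mul_row_tr_row trmxM mulmxA.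
  rewrite (immersion_isometric data Wp) (gram_shape_tr x_atlas data Wp).
  by rewrite (shape_gram x_atlas _ _ _ _ Wp).
rewrite (tensionE Wp) innerZl innerZr (inner_eta Wp) mulr1.
have -> : form_trace x p (- (u p *: b p)) = - (u p * u p).
  rewrite /form_trace -scaleNr -scalemxAr mxtraceZ mxtrace_mulC.
  by rewrite mulNr.
rewrite trmxN trmxZ (sff_tr x_atlas data Wp).
move: (u p) (b p) (gram x p) => t S T; apply/matrixP => i j; by rewrite !mxE; field.
Qed.

Lemma form_normsqE p (B : 'M[R]_n) : W p -> B^T = B ->
  form_normsq x p B = \tr (B *m g p *m (B *m g p)).
Proof.
move=> Wp BT; rewrite /form_normsq.
have -> : (\matrix_(i, k) form_trace x p (\matrix_(j, l) (B i j * B k l)))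
   = (B *m g p *m B)^T.
  apply/matrixP => i k; rewrite mxE [RHS]mxE /form_trace.
  have -> : \matrix_(j, l) (B i j * B k l) = (row i B)^T *m row k B.
    by apply/matrixP => j l; rewrite !mxE big_ord1 !mxE.
  rewrite mulmxA mxtrace_mulC mulmxA trace_mx11 -row_mul mul_row_tr_row.
  by rewrite BT.
have -> : (B *m g p *m B)^T = B *m g p *m B.
  by rewrite trmxM trmxM BT (g_tr Wp) mulmxA.
by rewrite /form_trace mxtrace_mulC !mulmxA.
Qed.

(** The trace of the square of [2 u A - (u^2 / 2) I]: the identity part gives [n u^4 / 4], and the
    cross term [- 2 u^3 \tr A] is [- 2 u^4] since [\tr A = u]. *)
Lemma stress_energy_normsq p : W p ->
  form_normsq x p (stress_energy phi x y p)
  = (n%:R / 4 - 2) * (u p * u p * (u p * u p))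
    + 4 * (u p * u p * \tr (A p *m A p)).
Proof.
move=> Wp; rewrite (stress_energyE Wp) (form_normsqE Wp); last first.
  by rewrite trmxB !trmxZ (sff_tr x_atlas data Wp) (gram_tr x_atlas Wp).
have -> : ((2 * u p) *: b p - (u p * u p / 2) *: gram x p) *m g p
   = (2 * u p) *: A p - (u p * u p / 2)%:M.
  rewrite mulmxBl -!scalemxAl (mulmxV (gram_unit x_atlas Wp)) scalemx1.
  by rewrite /shape.
rewrite mulmxBl !mulmxBr !mul_scalar_mx !mul_mx_scalar -!scalemxAl -!scalemxAr.
rewrite -scalemx1.
have trB (P Q : 'M[R]_n) : \tr (P - Q) = \tr P - \tr Q by exact: raddfB.
rewrite !(trB, mxtraceZ, mxtrace1) -/(u p).
by move: (\tr (A p *m A p)) (u p) => s t; field.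
Qed.

End TensionFields.

(** * Application of the operator identity to the hypersurface *)

Theorem theorem3p8 (R : realType) (m : nat) (c : R)
    (M : riemannian R m) (N : riemannian R m.+1) (phi : M -> N)
    (m_gt0 : (0 < m)%N)
    (N_space_form : space_form c N)
    (phi_isometric : isometric_immersion phi)
    (x : chart R m M) (y : chart R m.+1 N)
    (x_atlas : atlas x) (y_atlas : atlas y)
    (W : set M) (W_open : open W)
    (W_x : W `<=` chart_dom x) (W_y : W `<=` phi @^-1` chart_dom y)
    (eta : M -> 'rV[R]_m.+1) (eta_normal : unit_normal phi x y W eta)
    (p : M) (W_p : W p) :
  let mR : R := m%:R in
  let A := shape_operator phi x y eta in
  let f := mean_curvature phi x y eta in
  let s := scalar_curvature x in
  let T := bitension_tan phi x y in
  let A2 := fun q => \tr (A q *m A q) in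
  2^-1 * laplacian x (fun q => form_normsq x q (stress_energy phi x y q)) p =
    4 * c * mR ^+ 4 * f p ^+ 4
    - 4 * mR ^+ 3 * f p ^+ 3 * \tr (A p *m A p *m A p)
    - 4 * mR ^+ 2 * f p ^+ 2 * A2 p * (c * mR - A2 p)
    - 8 * mR ^+ 4 * f p ^+ 2 * inner x p (grad x f p) (grad x f p)
    - 4 * mR ^+ 2 * f p ^+ 2 * nabla_op_normsq x A p
    + 4 * mR ^+ 2 * f p * inner x p (grad x s p) (grad x f p)
    - 8 * mR ^+ 2 * divergence x (fun q => f q *: ricci x q (grad x f q)) p
    - 2 * mR ^+ 2
        * divergence x (fun q => A2 q *: grad x (fun r => f r ^+ 2) q) p
    + mR ^+ 5 / 8 * laplacian x (fun q => f q ^+ 4) p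
    - 4 * c * mR ^+ 2 * (mR - 1) * laplacian x (fun q => f q ^+ 2) p
    - 10 * mR ^+ 2 * f p * inner x p (T p) (grad x f p)
    - 4 * mR ^+ 2 * f p ^+ 2 * divergence x T p
    - 2 * inner x p (T p) (T p)
    + 4 * mR * f p * nabla_contract x T A p.
Proof.
pose W' := Subdomain W_open W_x.
pose Y := Subdomain (@chart_dom_open _ _ _ y) (@subset_refl _ (chart_dom y)).
have WY q : W' q -> Y (phi q) by exact: W_y.
have data := immersion_dataP N_space_form phi_isometric x_atlas y_atlas WY
  (eta_normal : unit_normal phi x y W' eta).
(* The two forms of the shape operator are known to agree on [W] only; statements about derivatives
   are transported by extensionality on this open set. *)
have AE q : W' q -> shape_operator phi x y eta q = _ :=
  @shape_operatorE _ _ _ _ _ _ N_space_form phi_isometric _ _ x_atlas y_atlas W' Y WY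
    _ eta_normal q.
pose S := shape x (pulled_gram phi y) (immersion_mx phi x y) (pulled_christoffel phi x y) eta.
have uE q : W' q -> trace_fun (shape_operator phi x y eta) q = trace_fun S q.
  by move=> Wq; rewrite /trace_fun AE.
have sA : smooth_mx W' (shape_operator phi x y eta).
  by apply: smooth_mx_ext (smooth_shape x_atlas data) => q Wq; rewrite AE.
have cE i q : W' q -> cov_op x i (shape_operator phi x y eta) q = cov_op x i S q.
  by move=> Wq; rewrite /cov_op (pdm_ext i AE Wq) (AE q Wq).
apply: (@codazzi_tensor_identity R m c M x m_gt0 x_atlas W' (shape_operator phi x y eta)
  sA _ _ _ (bitension_tan phi x y)
  (fun q => form_normsq x q (stress_energy phi x y q)) _ _ p W_p).
- by move=> q Wq; rewrite AE //; exact: (gram_shape_tr x_atlas data Wq).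
- by move=> q i j Wq; rewrite !cE //; exact: (codazzi x_atlas data i j Wq).
- move=> q i j Wq; rewrite (gauss x_atlas data i j Wq) (AE q Wq); congr (_ + _).
  (* Rewrites the second fundamental form as [A] times the metric, which brings the Gauss equation
     to the form that uses the operator alone. *)
  have rE k : (row k (sff x (pulled_gram phi y) (immersion_mx phi x y)
      (pulled_christoffel phi x y) eta q))^T = S q *m gram x q *m (delta_mx k 0 : 'cV_m).
    rewrite -(shape_gram x_atlas _ _ _ _ Wq) -/(S q) -(gram_shape_tr x_atlas data Wq).
    rewrite -/(S q) rowE trmxM trmxM trmxK trmx_delta.
    by rewrite (gram_tr x_atlas Wq) (gram_shape_tr x_atlas data Wq).
  by rewrite !rE !rowE !mulmxA.
- move=> q Wq; rewrite (AE q Wq) (uE q Wq) (grad_ext uE Wq).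
  exact: (bitension_tanE N_space_form phi_isometric x_atlas y_atlas WY eta_normal Wq).
- move=> q Wq; rewrite (uE q Wq) /trace_fun (AE q Wq).
  exact: (stress_energy_normsq N_space_form phi_isometric x_atlas y_atlas WY eta_normal Wq).
Qed.
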